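(* Let $s\in(\frac12,1)$. (a) Let $u\in L_s(\mathbb{R})$ be any solution of $(-\Delta)^s u = e^u$ in $\mathbb{R}$ with $\int_{\mathbb{R}} e^u\,dx<+\infty$. Then $u$ has finite Morse index greater or equal than one, i.e. $1\le n_-(\mathcal{L}_u)<+\infty$. As a consequence, $u$ is stable outside some compact set $\mathcal{K}\subset\mathbb{R}$ with $\mathcal{K}\neq\emptyset$. (b) Conversely, let $u\in L_s(\mathbb{R})$ be a solution of $(-\Delta)^s u=e^u$ in $\mathbb{R}$ with $e^u\in L^1_{\mathrm{loc}}(\mathbb{R})$ that is stable outside some compact set $\mathcal{K}\subset\mathbb{R}$. Then $e^u\in L^1(\mathbb{R})$; moreover $u$ is smooth, bounded from above, satisfies $u(x)=O(|x|^{2s-1})$ as $|x|\to+\infty$, there are $x_0\in\mathbb{R}$ and a strictly decreasing function $u_0:[0,\infty)\to\mathbb{R}$ with $u(x)=u_0(|x-x_0|)$ for all $x \in \mathbb{R}$, and $u(x)=Q_s(\mu(x+y))+2s\log\mu$ for some $y\in\mathbb{R}$, $\mu>0$. In particular, $u$ has finite Morse index.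
   Context: For $s\in(0,1)$ and $\varphi\in C_c^\infty(\mathbb{R})$, $(-\Delta)^s\varphi(x) = C_s\,\mathrm{PV}\int_{\mathbb{R}}\frac{\varphi(x)-\varphi(y)}{|x-y|^{1+2s}}\,dy$ with $C_s = \frac{4^s}{\sqrt{\pi}}\frac{\Gamma(\frac12+s)}{|\Gamma(-s)|}$. The space $L_s(\mathbb{R})$ consists of all real-valued $u\in L^1_{\mathrm{loc}}(\mathbb{R})$ with $\int_{\mathbb{R}}\frac{|u(x)|}{1+|x|^{1+2s}}\,dx<+\infty$. A function $u\in L_s(\mathbb{R})$ with $e^u\in L^1_{\mathrm{loc}}(\mathbb{R})$ is a solution of $(-\Delta)^s u = e^u$ if $\int_{\mathbb{R}} u\,(-\Delta)^s\varphi\,dx = \int_{\mathbb{R}} e^u\varphi\,dx$ for all $\varphi\in C_c^\infty(\mathbb{R})$; solutions are identified with their continuous representatives when these exist. For such a solution, $\mathcal{L}_u=(-\Delta)^s-e^u$ denotes the linearized operator with quadratic form $\langle\varphi,\mathcal{L}_u\varphi\rangle=\int_{\mathbb{R}}\varphi(-\Delta)^s\varphi\,dx-\int_{\mathbb{R}}e^u\varphi^2\,dx$ for $\varphi\in C_c^\infty(\mathbb{R})$. The Morse index $n_-(\mathcal{L}_u)\in\mathbb{N}_0\cup\{+\infty\}$ is the maximal dimension of linear subspaces $V\subset C_c^\infty(\mathbb{R})$ such that $\langle\varphi,\mathcal{L}_u\varphi\rangle<0$ for all $\varphi\in V\setminus\{0\}$. The solution $u$ is stable outside a compact set $\mathcal{K}\subset\mathbb{R}$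 if $\langle\varphi,\mathcal{L}_u\varphi\rangle\ge0$ for all $\varphi\in C_c^\infty(\mathbb{R}\setminus\mathcal{K})$. $Q_s\in L_s(\mathbb{R})$ denotes the (unique up to the transformations $Q_s(x) \mapsto Q_s(\mu(x+y))+2s\log\mu$, $y\in\mathbb{R}$, $\mu>0$) solution of $(-\Delta)^sQ_s=e^{Q_s}$ in $\mathbb{R}$ with $\int_{\mathbb{R}}e^{Q_s}\,dx<+\infty$; one fixes one such function. *)

(* Defs.v *)
From HB Require Import structures.
From mathcomp Require Import all_boot all_order all_algebra.
From mathcomp Require Import all_classical all_reals all_analysis.
Set Implicit Arguments.
Unset Strict Implicit.
Unset Printing Implicit Defensive.
Import Order.TTheory GRing.Theory Num.Theory.
Import numFieldNormedType.Exports.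
Local Open Scope classical_set_scope.
Local Open Scope ring_scope.

Section defs.
Context {R : realType}.
Implicit Types (s x : R) (u v f phi : R -> R) (K : set R) (V : set (R -> R)).

Local Notation mu := (@lebesgue_measure R).

Definition smooth f := forall n x, derivable (derive1n n f) x 1.

Definition tsupport f : set R := closure [set x | f x != 0].

Definition test_function phi := smooth phi /\ compact (tsupport phi).

Definition euler_integral x : R :=
  \int[mu]_(t in `]0, +oo[) (t `^ (x - 1) * expR (- t)).

(* Euler's integral for 0 < x, continued to the negative non-integers by
   Gamma (x + 1) = x * Gamma x; for x <= 0, [n] is the least natural number
   with 0 < x + n. *)
Definition Gamma x : R :=
  if 0 < x then euler_integral x else
  let n := (Num.truncn (- x)).+1 in
  euler_integral (x + n%:R) / \prod_(k < n) (x + k%:R).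

Definition frac_lap_const s : R :=
  4 `^ s / Num.sqrt pi * (Gamma (2^-1 + s) / `|Gamma (- s)|).

Definition frac_lap s phi x : R :=
  frac_lap_const s *
  lim ((\int[mu]_(y in [set y | (eps < `|x - y|)%R])
          ((phi x - phi y) / `|x - y| `^ (1 + 2 * s))) @[eps --> 0^'+]).

(* Elements of L^1_loc are represented by Borel functions; [solution],
   [morse_index] and [stable_outside] below only depend on the class of the
   representative modulo a.e. equality. *)
Definition L_s s u :=
  locally_integrable setT u /\
  (\int[mu]_x (`|u x| / (1 + `|x| `^ (1 + 2 * s)))%:E < +oo)%E.

Definition solution s u :=
  [/\ L_s s u,
      locally_integrable setT (fun x => expR (u x)) &
      forall phi, test_function phi ->
        \int[mu]_x (u x * frac_lap s phi x) = \int[mu]_x (expR (u x) * phi x)].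

Definition finite_mass u := (\int[mu]_x (expR (u x))%:E < +oo)%E.

(* the quadratic form of the linearized operator (-Delta)^s - e^u *)
Definition lin_form s u phi : R :=
  \int[mu]_x (phi x * frac_lap s phi x) - \int[mu]_x (expR (u x) * phi x ^+ 2).

Definition lin_indep n (e : 'I_n -> R -> R) :=
  forall c : 'I_n -> R, \sum_(i < n) c i *: e i = 0 -> forall i, c i = 0.

(* valued in N u {+oo} *)
Definition dimension V : \bar R :=
  ereal_sup [set n%:R%:E | n in [set n : nat |
    exists e : 'I_n -> R -> R, (forall i, V (e i)) /\ lin_indep e]].

Definition negative_subspace s u V :=
  [/\ GRing.submod_closed (mem V),
      V `<=` test_function &
      forall phi, V phi -> phi != 0 -> lin_form s u phi < 0].

Definition morse_index s u : \bar R :=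
  ereal_sup [set dimension V | V in negative_subspace s u].

Definition stable_outside s u K :=
  forall phi, test_function phi -> tsupport phi `<=` ~` K ->
    0 <= lin_form s u phi.

Definition continuous_representative u v := continuous v /\ u = v %[ae mu].

(* [Q] is an admissible choice of the function Q_s, taken as its continuous
   representative. *)
Definition is_Q s Q := [/\ solution s Q, finite_mass Q & continuous Q].

End defs.

(* Main.v *)
(* With a = 2 s - 1 in (0, 1), a function of energy E has oscillation at most
   (K |x - y|^a E)^(1/2). Together with cutoffs, whose energy r^(-a) tends to 0,
   this gives the bounds on the Morse index, and stability outside a compact set
   forces e^u to be integrable. Pairing the equation with approximations of
   |x|^a * g'' then shows that u(y) + c int e^u(x) (|x - y|^a - |x|^a) dx is affine,
   and constant because e^u is integrable. Regularity and growth are read off this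
   integral equation, and moving planes give symmetry. For uniqueness, rescale two
   solutions v0 and v1 to equal mass, write them as b_i - c (|x|^a convolved with
   e^v_i), and let T be the monotone map transporting e^v0 to e^v1: a virial identity
   and the concavity of t^a give int e^v0 (T')^a <= int e^v0, hence b0 <= b1 by
   log t <= t - 1, with equality only if T is a translation; exchange the roles. *)

(* The hypothesis [s > 1/2] enters as [a > 0]: point values are then controlled by the energy, so
   vanishing at finitely many points can replace a spectral argument for the Morse index. The weak
   equation admits only compactly supported smooth functions, whereas the convolution of [|x|^a]
   with g'' has unbounded support; hence the far part of [|x|^a] is subtracted at a scale r that
   tends to infinity. The constant [p0] that this produces is never evaluated: that it is nonzero
   and negative is deduced from the integrability of e^u. From then on only the integral equation
   [riesz_eq] is used, and no fractional operator occurs. Its kernel is unbounded, but the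
   difference of two kernels exchanged by a reflection is bounded uniformly in one variable, which
   is what moving planes require. For uniqueness no explicit solution is at hand to compare with.
   What makes the transport argument close is that the virial identity expresses the interaction
   energy of e^v through its mass alone: two solutions of equal mass have equal interaction
   energies, these cancel, and only the constants b0 and b1 remain. *)
Require Import Defs.
From HB Require Import structures.
From mathcomp Require Import all_boot all_order all_algebra.
From mathcomp Require Import all_classical all_reals all_analysis.
From mathcomp Require Import measurable_realfun.
From mathcomp Require Import ring lra.
Import Order.TTheory GRing.Theory Num.Theory.
Import numFieldNormedType.Exports.
Local Open Scope classical_set_scope.
Local Open Scope ring_scope.
Set Implicit Arguments.
Unset Strict Implicit.
Unset Printing Implicit Defensive.

(** * Integration on the real line *)

Section integrable_real.
Context d (T : measurableType d) (R : realType).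
Variable m : {measure set T -> \bar R}.
Implicit Types f g : T -> R.

Definition L1 f := m.-integrable setT (EFin \o f).

Lemma L1_measurable f : L1 f -> measurable_fun setT f.
Proof. by move=> /integrableP[/measurable_EFinP]. Qed.

Lemma eq_L1 f g : f =1 g -> L1 f -> L1 g.
Proof. by move=> fg; rewrite /L1 (funext fg). Qed.

Lemma L1_le g f : L1 g -> measurable_fun setT f ->
  (forall x, `|f x| <= g x) -> L1 f.
Proof.
move=> ig mf fg; apply: (le_integrable measurableT _ _ ig).
  exact/measurable_EFinP.
by move=> x _ /=; rewrite lee_fin (le_trans (fg x))// ler_norm.
Qed.

Lemma L1D f g : L1 f -> L1 g -> L1 (fun x => f x + g x).
Proof. by move=> hf hg; exact: (integrableD measurableT hf hg). Qed.

Lemma L1Z (k : R) f : L1 f -> L1 (fun x => k * f x).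
Proof. by move=> hf; exact: (integrableZl measurableT k hf). Qed.

Lemma L1Zr (k : R) f : L1 f -> L1 (fun x => f x * k).
Proof. by move=> /(L1Z k); apply: eq_L1 => x; rewrite mulrC. Qed.

Lemma L1N f : L1 f -> L1 (fun x => - f x).
Proof. by move=> /(L1Z (-1)); apply: eq_L1 => x; rewrite mulN1r. Qed.

Lemma L1B f g : L1 f -> L1 g -> L1 (fun x => f x - g x).
Proof. by move=> hf /L1N; exact: L1D. Qed.

Lemma L10 : L1 (fun=> 0).
Proof. exact: integrable0. Qed.

Lemma L1_abs f : L1 f -> L1 (fun x => `|f x|).
Proof. exact: integrable_norm. Qed.

Lemma L1_ge0P f : measurable_fun setT f -> (forall x, 0 <= f x) ->
  L1 f <-> (\int[m]_x (f x)%:E < +oo)%E.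
Proof.
move=> mf f0; split=> [/integrableP[_]|fi].
  by under eq_integral do rewrite /= ger0_norm//.
apply/integrableP; split; first exact/measurable_EFinP.
by under eq_integral do rewrite /= ger0_norm//.
Qed.

Lemma L1_bounded (k : R) g f : (forall x, `|g x| <= k) -> measurable_fun setT g ->
  L1 f -> L1 (fun x => g x * f x).
Proof.
move=> gk mg fi; apply: (L1_le (L1Z k (L1_abs fi))).
  by apply: measurable_funM => //; exact: L1_measurable.
by move=> x; rewrite normrM ler_wpM2r.
Qed.

Lemma EFin_Rintegral f : L1 f -> (\int[m]_x f x)%:E = (\int[m]_x (f x)%:E)%E.
Proof. by move=> fi; rewrite fineK//; exact: (integrable_fin_num measurableT). Qed.

Lemma intD f g : L1 f -> L1 g ->
  \int[m]_x (f x + g x) = \int[m]_x f x + \int[m]_x g x.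
Proof. exact: RintegralD. Qed.

Lemma intB f g : L1 f -> L1 g ->
  \int[m]_x (f x - g x) = \int[m]_x f x - \int[m]_x g x.
Proof. exact: RintegralB. Qed.

Lemma intZ (k : R) f : L1 f -> \int[m]_x (k * f x) = k * \int[m]_x f x.
Proof. by move=> fi; rewrite RintegralZl. Qed.

Lemma intZr (k : R) f : L1 f -> \int[m]_x (f x * k) = \int[m]_x f x * k.
Proof. by move=> fi; rewrite RintegralZr. Qed.

Lemma intN f : L1 f -> \int[m]_x (- f x) = - \int[m]_x f x.
Proof.
by move=> fi; rewrite -mulN1r -intZ//; apply: eq_Rintegral => x _; rewrite mulN1r.
Qed.

Lemma int0 : \int[m]_x (0 : R) = 0.
Proof. by rewrite /Rintegral integral0. Qed.

Lemma int_ge0 f : (forall x, 0 <= f x) -> 0 <= \int[m]_x f x.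
Proof. by move=> f0; exact: Rintegral_ge0. Qed.

Lemma int_le f g : L1 f -> L1 g -> (forall x, f x <= g x) ->
  \int[m]_x f x <= \int[m]_x g x.
Proof. by move=> fi gi fg; exact: le_Rintegral. Qed.

Lemma int_abs_le f : L1 f -> `|\int[m]_x f x| <= \int[m]_x `|f x|.
Proof. exact: le_normr_Rintegral. Qed.

Lemma int_abs_le_bound f g : L1 f -> L1 g -> (forall x, `|f x| <= g x) ->
  `|\int[m]_x f x| <= \int[m]_x g x.
Proof.
move=> fi gi fg; apply: (le_trans (int_abs_le fi)).
by apply: int_le => //; exact: L1_abs.
Qed.

Lemma eq_int f g : f =1 g -> \int[m]_x f x = \int[m]_x g x.
Proof. by move=> fg; apply: eq_Rintegral => x _. Qed.

Lemma ae_eq_int f g : measurable_fun setT f -> measurable_fun setT g ->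
  {ae m, forall x, f x = g x} -> \int[m]_x f x = \int[m]_x g x.
Proof.
move=> mf mg fg; rewrite /Rintegral; congr fine.
apply: ae_eq_integral => //; [exact/measurable_EFinP..|].
by apply: filterS fg => x + _ => ->.
Qed.

Lemma ae_L1 f g : measurable_fun setT g ->
  {ae m, forall x, f x = g x} -> L1 f -> L1 g.
Proof.
move=> mg fg fi; apply/integrableP; split; first exact/measurable_EFinP.
move/integrableP : (fi) => [_]; apply: le_lt_trans.
rewrite le_eqVlt; apply/orP; left; apply/eqP.
apply: ae_eq_integral => //.
- by apply: measurableT_comp => //; exact/measurable_EFinP.
- by apply: measurableT_comp => //; apply/measurable_EFinP; exact: L1_measurable.
- by apply: filterS fg => x /= + _ => ->.
Qed.

Lemma dct (F : nat -> T -> R) f g : (forall n, measurable_fun setT (F n)) ->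
  measurable_fun setT f -> {ae m, forall x, F n x @[n --> \oo] --> f x} ->
  L1 g -> (forall n x, `|F n x| <= g x) ->
  L1 f /\ \int[m]_x F n x @[n --> \oo] --> \int[m]_x f x.
Proof.
move=> mF mf Ff gi Fg.
have [] := @dominated_convergence _ _ _ m setT measurableT
  (fun n => EFin \o F n) (EFin \o f) (EFin \o g).
- by move=> n; exact/measurable_EFinP.
- exact/measurable_EFinP.
- by apply: filterS Ff => x /= h _; apply: cvg_EFin => //; exact: nearW.
- exact: gi.
- by apply: aeW => x n _ /=; rewrite lee_fin.
move=> fi _ h; split => //.
have e : (\int[m]_x (f x)%:E)%E = (\int[m]_x f x)%:E by rewrite EFin_Rintegral.
by move: h; rewrite /comp /= e => /fine_cvg; exact: cvg_trans.
Qed.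

Lemma dct_all (F : nat -> T -> R) f g : (forall n, measurable_fun setT (F n)) ->
  measurable_fun setT f -> (forall x, F n x @[n --> \oo] --> f x) ->
  L1 g -> (forall n x, `|F n x| <= g x) ->
  L1 f /\ \int[m]_x F n x @[n --> \oo] --> \int[m]_x f x.
Proof. by move=> mF mf Ff; apply: dct => //; exact: aeW. Qed.

(** Supplies integrability of the limit together with the bound. It serves where no dominating
    function is known beforehand: for powers near 0 and at infinity, for e^u under stability, and
    for the power of T' in the uniqueness proof. *)
Lemma L1_fatou (F : nat -> T -> R) f (C : R) :
  (forall n, L1 (F n)) -> (forall n x, 0 <= F n x) -> measurable_fun setT f ->
  (forall x, F n x @[n --> \oo] --> f x) -> (forall n, \int[m]_x F n x <= C) ->
  L1 f /\ \int[m]_x f x <= C.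
Proof.
move=> FI F0 mf Ff FC.
have f0 x : 0 <= f x.
  by apply: (cvgr_to_ge (Ff x)); exact: nearW.
have h : (\int[m]_x (f x)%:E <= C%:E)%E.
  have := @fatou _ _ _ m setT measurableT (fun n x => (F n x)%:E).
  have h1 : forall n, measurable_fun [set: T] (fun x => (F n x)%:E).
    by move=> n; apply/measurable_EFinP; exact: L1_measurable.
  have h2 : forall n x, [set: T] x -> (0 <= (F n x)%:E)%E by move=> n x _; rewrite lee_fin.
  move=> /(_ h1 h2).
  have -> : (fun x => limn_einf ((fun n => (F n x)%:E))) = (fun x => (f x)%:E).
    apply/funext => x; apply: (cvg_limn_einf_sup _).1.
    by apply: cvg_EFin; [exact: nearW|exact: Ff].
  move=> /le_trans; apply; rewrite limn_einf_lim; apply: lime_le.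
    exact: is_cvg_einfs.
  apply: nearW => n; apply: (@le_trans _ _ (\int[m]_x (F n x)%:E)%E).
    by apply: ereal_inf_lbound; exists n => /=.
  by rewrite -EFin_Rintegral// lee_fin.
have fi : L1 f by apply/(L1_ge0P mf f0); apply: (le_lt_trans h); rewrite ltry.
by split=> //; rewrite -lee_fin EFin_Rintegral.
Qed.

End integrable_real.

(** * Fubini's theorem for real-valued integrals *)

Section fubini_real.
Context d1 d2 (T1 : measurableType d1) (T2 : measurableType d2) (R : realType).
Variable m1 : {sigma_finite_measure set T1 -> \bar R}.
Variable m2 : {sigma_finite_measure set T2 -> \bar R}.
Implicit Type f : T1 -> T2 -> R.

Definition L1prod f := L1 (m1 \x m2)%E (fun z => f z.1 z.2).

Lemma L1prodP f g : measurable_fun setT (fun z => f z.1 z.2) ->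
  (forall x, L1 m2 (f x)) -> (forall x, \int[m2]_y `|f x y| <= g x) ->
  L1 m1 g -> L1prod f.
Proof.
move=> mf fi fg gi; apply/integrable12ltyP; first exact/measurable_EFinP.
move/integrableP : (gi) => [_]; apply: le_lt_trans; apply: ge0_le_integral => //=.
- by move=> x _; apply: integral_ge0.
- apply: (@measurable_fun_fubini_tonelli_F _ _ _ _ _ m2 (fun z => `|(f z.1 z.2)%:E|%E)) => //.
  by apply: measurableT_comp => //; exact/measurable_EFinP.
- apply/measurable_EFinP; apply: measurableT_comp => //.
  exact: L1_measurable gi.
- move=> x _; apply: (@le_trans _ _ (g x)%:E); last by rewrite lee_fin ler_norm.
  by rewrite -(EFin_Rintegral (L1_abs (fi x))) lee_fin.
Qed.

(** The sections of f are integrable only almost everywhere, so the real-valued inner integral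
    agrees with the extended one only almost everywhere; this is enough for the outer integral. *)
Lemma L1prod_int1 f : L1prod f -> L1 m1 (fun x => \int[m2]_y f x y) /\
  \int[m1]_x \int[m2]_y f x y = \int[(m1 \x m2)%E]_z f z.1 z.2.
Proof.
move=> fi; have Fi := integrable_fubini_F fi.
have ae := ae_integrable1 fi.
have e : {ae m1, forall x, fubini_F m2 (fun z => (f z.1 z.2)%:E) x
    = (\int[m2]_y f x y)%:E}.
  by apply: filterS ae => x h; rewrite EFin_Rintegral.
have mF : measurable_fun setT (fun x => \int[m2]_y f x y).
  by apply: measurableT_comp => //; exact: measurable_int Fi.
have FI : L1 m1 (fun x => \int[m2]_y f x y).
  apply/integrableP; split; first exact/measurable_EFinP.
  move/integrableP : (Fi) => [_]; apply: le_lt_trans.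
  rewrite le_eqVlt; apply/orP; left; apply/eqP; apply: ae_eq_integral => //.
  - by apply: measurableT_comp => //; exact/measurable_EFinP.
  - by apply: measurableT_comp => //; exact: measurable_int Fi.
  - by apply: filterS e => x h _; rewrite /comp -h.
split => //; apply: EFin_inj; rewrite EFin_Rintegral// EFin_Rintegral//.
rewrite -(integral12_prod_meas1 fi); apply: ae_eq_integral => //.
- exact/measurable_EFinP.
- exact: measurable_int Fi.
- by apply: filterS e => x ->.
Qed.

End fubini_real.

Section fubini_real_swap.
Context d1 d2 (T1 : measurableType d1) (T2 : measurableType d2) (R : realType).
Variable m1 : {sigma_finite_measure set T1 -> \bar R}.
Variable m2 : {sigma_finite_measure set T2 -> \bar R}.
Implicit Type f : T1 -> T2 -> R.

Lemma L1prod_swap f : L1prod m1 m2 f -> L1prod m2 m1 (fun y x => f x y).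
Proof.
move=> fi; have mf := L1_measurable fi.
apply/integrable12ltyP.
  apply/measurable_EFinP.
  exact: (measurableT_comp mf (@measurable_swap _ _ T2 T1)).
by move/integrable21ltyP : fi; apply; exact/measurable_EFinP.
Qed.

Lemma int_exchange f : L1prod m1 m2 f ->
  \int[m1]_x \int[m2]_y f x y = \int[m2]_y \int[m1]_x f x y.
Proof.
move=> fi; have [F1 E1] := L1prod_int1 fi.
have [F2 E2] := L1prod_int1 (L1prod_swap fi).
apply: EFin_inj; rewrite EFin_Rintegral// EFin_Rintegral//.
have := Fubini fi.
rewrite (_ : (\int[m1]_x \int[m2]_y _)%E = (\int[m1]_x (\int[m2]_y f x y)%:E)%E).
  rewrite (_ : (\int[m2]_x \int[m1]_y _)%E = (\int[m2]_y (\int[m1]_x f x y)%:E)%E) //.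
  apply: ae_eq_integral => //.
  - exact: measurable_fubini_G fi.
  - by apply/measurable_EFinP; exact: L1_measurable F2.
  - by apply: filterS (ae_integrable2 fi) => x h _ /=; rewrite EFin_Rintegral.
apply: ae_eq_integral => //.
- exact: measurable_fubini_F fi.
- by apply/measurable_EFinP; exact: L1_measurable F1.
- by apply: filterS (ae_integrable1 fi) => x h _ /=; rewrite EFin_Rintegral.
Qed.

End fubini_real_swap.
Arguments int_exchange {d1 d2 T1 T2 R} m1 m2 f.

(** * Affine changes of variable *)

Section lebesgue_affine.
Context (R : realType).
Notation mu := (@lebesgue_measure R).
Implicit Types (f : R -> R) (a b : R).

Lemma measurable_affine a b : measurable_fun (setT : set (measurableTypeR R))
  (fun x : measurableTypeR R => (a * x + b : measurableTypeR R)).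
Proof. by apply: measurable_funD => //; exact: measurable_funM. Qed.

Let affine_measure a b : {measure set (measurableTypeR R) -> \bar R} :=
  mscale (NngNum (normr_ge0 a))
    (measure_function_pushforward__canonical__measure_function_Measure mu
      (measurable_affine a b)).

(** By uniqueness of Lebesgue measure it suffices to compare half-open intervals; for negative [a]
    the preimage is closed at the other end. *)
Lemma lebesgue_affine a b : a != 0 -> forall A, measurable A ->
  (mu A = `|a|%:E * mu ((fun x => a * x + b)%R @^-1` A))%E.
Proof.
move=> a0.
pose nu := affine_measure a b.
suff: forall A, measurable A -> mu A = nu A by [].
apply: lebesgue_measure_unique => _ [[c d] _ <-] /=.
rewrite /nu /mscale /= /pushforward.
have [cd|dc] := ltP c d; last first.
  have m0 : mu (set0 : set R) = 0%E by exact: measure0.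
  by rewrite set_itv_ge ?bnd_simp -?leNgt// preimage_set0 m0 mule0.
have [apos|aneg|a00] := ltgtP a 0; last by rewrite a00 eqxx in a0.
- rewrite (_ : _ @^-1` _ = `[((d - b) / a), ((c - b) / a)[%classic).
    rewrite !lebesgue_measure_itv /= !lte_fin cd ltr_ndivrMr// divfK ?lt_eqF// ltrBlDr subrK cd.
    by rewrite ltr0_norm// -EFinB -EFinM; congr _%:E; field; rewrite lt_eqF.
  apply/seteqP; split => x /=; rewrite !in_itv /= => /andP[h1 h2]; apply/andP.
    by rewrite ler_ndivrMr// ltr_ndivlMr//; split; nra.
  by move: h1 h2; rewrite ler_ndivrMr// ltr_ndivlMr// => h1 h2; split; nra.
- rewrite (_ : _ @^-1` _ = `]((c - b) / a), ((d - b) / a)]%classic).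
    rewrite !lebesgue_measure_itv /= !lte_fin cd ltr_pdivrMr// divfK ?gt_eqF// ltrBlDr subrK cd.
    by rewrite gtr0_norm// -EFinB -EFinM; congr _%:E; field; rewrite gt_eqF.
  apply/seteqP; split => x /=; rewrite !in_itv /= => /andP[h1 h2]; apply/andP.
    by rewrite ltr_pdivrMr// ler_pdivlMr//; split; nra.
  by move: h1 h2; rewrite ltr_pdivrMr// ler_pdivlMr// => h1 h2; split; nra.
Qed.

Lemma ge0_integral_affine a b f : a != 0 -> measurable_fun setT f ->
  (forall x, 0 <= f x) ->
  (\int[mu]_x (f x)%:E = `|a|%:E * \int[mu]_x (f (a * x + b)%R)%:E)%E.
Proof.
move=> a0 mf f0.
pose nu := affine_measure a b.
rewrite (eq_measure_integral nu); last by move=> A mA _; exact: lebesgue_affine.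
have mEf : measurable_fun setT (EFin \o f) by exact/measurable_EFinP.
rewrite ge0_integral_mscale//.
  congr (_ * _)%E; rewrite ge0_integral_pushforward//.
    exact: measurable_affine.
  by move=> x _; rewrite lee_fin.
by move=> x _; rewrite lee_fin.
Qed.

Lemma L1_affine a b f : a != 0 -> L1 mu f -> L1 mu (fun x => f (a * x + b)).
Proof.
move=> a0 fi; have mf := L1_measurable fi.
apply/integrableP; split.
  by apply/measurable_EFinP; apply: measurableT_comp => //; exact: measurable_affine.
have := @ge0_integral_affine a b (fun x => `|f x|) a0.
move=> /(_ (measurableT_comp _ mf) (fun x => normr_ge0 _)) h.
move/integrableP : fi => [_] /=; rewrite h//.
have [|] := ltP (\int[mu]_x `|f (a * x + b)%R|%:E)%E +oo%E => //.
rewrite leye_eq => /eqP ->.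
by rewrite gt0_muley ?lte_fin ?normr_gt0.
Qed.

Lemma int_affine a b f : a != 0 -> L1 mu f ->
  \int[mu]_x f (a * x + b) = `|a|^-1 * \int[mu]_x f x.
Proof.
move=> a0 fi.
have pos g : L1 mu g -> (forall x, 0 <= g x) ->
    \int[mu]_x g (a * x + b) = `|a|^-1 * \int[mu]_x g x.
  move=> gi g0; have := ge0_integral_affine b a0 (L1_measurable gi) g0.
  rewrite -(EFin_Rintegral gi) -(EFin_Rintegral (L1_affine b a0 gi)) -EFinM => -[] ->.
  by rewrite mulKf// normr_eq0.
have e x : f x = (`|f x| + f x) / 2 - (`|f x| - f x) / 2 by field.
have ip : L1 mu (fun x => (`|f x| + f x) / 2) by apply/L1Zr/L1D => //; exact: L1_abs.
have im : L1 mu (fun x => (`|f x| - f x) / 2) by apply/L1Zr/L1B => //; exact: L1_abs.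
transitivity (\int[mu]_x ((`|f (a * x + b)| + f (a * x + b)) / 2 -
   (`|f (a * x + b)| - f (a * x + b)) / 2)); first exact: eq_int.
rewrite (intB (L1_affine b a0 ip) (L1_affine b a0 im)).
transitivity (`|a|^-1 * \int[mu]_x ((`|f x| + f x) / 2 - (`|f x| - f x) / 2)).
  2: by congr (_ * _); apply: eq_int.
rewrite (intB ip im) mulrBr (pos _ ip) ?(pos _ im)// => x; rewrite divr_ge0//.
  by rewrite subr_ge0 ler_norm.
by rewrite -lerBlDr sub0r -normrN ler_norm.
Qed.

Lemma L1_shift b f : L1 mu f -> L1 mu (fun x => f (x + b)).
Proof.
move=> /(L1_affine b (oner_neq0 R)); apply: eq_L1 => x; by rewrite mul1r.
Qed.

Lemma int_shift b f : L1 mu f -> \int[mu]_x f (x + b) = \int[mu]_x f x.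
Proof.
move=> fi; have := int_affine b (oner_neq0 R) fi.
by rewrite normr1 invr1 mul1r => <-; apply: eq_int => x; rewrite mul1r.
Qed.

Lemma L1_refl b f : L1 mu f -> L1 mu (fun x => f (b - x)).
Proof.
move=> fi; have n1 : (-1 : R) != 0 by rewrite oppr_eq0 oner_neq0.
by move: (L1_affine b n1 fi); apply: eq_L1 => x; rewrite mulN1r addrC.
Qed.

Lemma int_refl b f : L1 mu f -> \int[mu]_x f (b - x) = \int[mu]_x f x.
Proof.
move=> fi; have n1 : (-1 : R) != 0 by rewrite oppr_eq0 oner_neq0.
have := int_affine b n1 fi.
rewrite normrN1 invr1 mul1r => <-; apply: eq_int => x; by rewrite mulN1r addrC.
Qed.

End lebesgue_affine.

(** * Measurability of real expressions *)

Section measurable_real_combinators.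
Context d (T : measurableType d) (R : realType).
Implicit Types f g : T -> R.

Lemma mfunD f g : measurable_fun setT f -> measurable_fun setT g ->
  measurable_fun setT (fun x => f x + g x).
Proof. exact: measurable_funD. Qed.

Lemma mfunN f : measurable_fun setT f -> measurable_fun setT (fun x => - f x).
Proof. by move=> mf; apply: measurableT_comp => //. Qed.

Lemma mfunM f g : measurable_fun setT f -> measurable_fun setT g ->
  measurable_fun setT (fun x => f x * g x).
Proof. exact: measurable_funM. Qed.

Lemma mfun_comp (h : R -> R) f : measurable_fun setT h -> measurable_fun setT f ->
  measurable_fun setT (fun x => h (f x)).
Proof. by move=> mh mf; exact: measurableT_comp. Qed.

Lemma mfun_norm f : measurable_fun setT f -> measurable_fun setT (fun x => `|f x|).
Proof. by move=> mf; apply: measurableT_comp => //. Qed.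

Lemma mfunX n f : measurable_fun setT f -> measurable_fun setT (fun x => f x ^+ n).
Proof. exact: measurable_funX. Qed.

Lemma mfun_powR (p : R) f : measurable_fun setT f -> measurable_fun setT (fun x => f x `^ p).
Proof. by move=> mf; apply: (mfun_comp (measurable_powR p)). Qed.

Lemma mfun_expR f : measurable_fun setT f -> measurable_fun setT (fun x => expR (f x)).
Proof. by move=> mf; apply: (mfun_comp _ mf); exact: measurable_expR. Qed.

Lemma mfun_inv f : measurable_fun setT f -> measurable_fun setT (fun x => (f x)^-1).
Proof.
move=> mf.
have e : (fun x => (f x)^-1) = (fun x => f x * (f x ^+ 2) `^ (-1)).
  apply/funext => x; rewrite powR_inv1 ?sqr_ge0//.
  have [->|f0] := eqVneq (f x) 0; first by rewrite invr0 mul0r.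
  by rewrite expr2 invfM mulrA divff// mul1r.
by rewrite e; apply: mfunM => //; apply: mfun_powR; exact: mfunX.
Qed.

Lemma mfun_indic (A : set T) : measurable A ->
  measurable_fun setT (fun x => \1_A x : R).
Proof. exact: measurable_indic. Qed.

Lemma mfun_lt f g : measurable_fun setT f -> measurable_fun setT g ->
  measurable [set x | f x < g x].
Proof.
move=> mf mg; rewrite -[X in measurable X]setTI.
have -> : [set x | f x < g x] = (fun x => f x < g x) @^-1` [set true].
  by apply/seteqP; split => x /=.
exact: (measurable_fun_ltr mf mg).
Qed.

Lemma mfun_le f g : measurable_fun setT f -> measurable_fun setT g ->
  measurable [set x | f x <= g x].
Proof.
move=> mf mg; rewrite (_ : [set x | _] = ~` [set x | g x < f x]).
  by apply: measurableC; exact: mfun_lt.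
by apply/seteqP; split => x /=; rewrite leNgt => /negP.
Qed.

End measurable_real_combinators.

Lemma mfun_id (R : realType) : measurable_fun setT (fun x : R => x).
Proof. exact: measurable_id. Qed.

Lemma mfun_fst (R : realType) : measurable_fun setT (fun z : R * R => z.1).
Proof. exact: measurable_fst. Qed.

Lemma mfun_snd (R : realType) : measurable_fun setT (fun z : R * R => z.2).
Proof. exact: measurable_snd. Qed.

Ltac mfun1 := first
  [ assumption
  | exact: measurable_cst
  | exact: mfun_id
  | exact: mfun_fst
  | exact: mfun_snd
  | apply: mfunD
  | apply: mfunN
  | apply: mfunM
  | apply: mfun_norm
  | apply: mfunX
  | apply: mfun_powR
  | apply: mfun_expR
  | apply: mfun_inv
  | apply: mfun_lt
  | apply: mfun_le
  | match goal with
    | h : measurable_fun setT ?f |- measurable_fun setT (fun x => ?f _) =>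
      apply: (mfun_comp h)
    | h : continuous ?f |- measurable_fun setT (fun x => ?f _) =>
      apply: (mfun_comp (continuous_measurable_fun h))
    | h : continuous ?f |- measurable_fun setT ?f =>
      exact: (continuous_measurable_fun h)
    end
  | apply: mfun_indic
  | exact: measurable_itv ].
Ltac mfun := repeat mfun1.

(** * Rules of differentiation *)

Section derivative_combinators.
Context (R : realType).
Implicit Types (f g : R -> R) (x a b : R).

(* [is_derive] without its typeclass status, which would start a proof search
   at each application of the rules below. *)
Definition derat x f a : Prop := is_derive x (1 : R) f a.

Lemma der_id x : derat x (fun y : R => y) 1.
Proof. exact: is_derive_id. Qed.

Lemma der_cst x a : derat x (fun _ : R => a) 0.
Proof. exact: is_derive_cst. Qed.

Lemma derD f g x a b : derat x f a -> derat x g b ->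
  derat x (fun y => f y + g y) (a + b).
Proof. by move=> hf hg; exact: is_deriveD. Qed.

Lemma derN f x a : derat x f a ->
  derat x (fun y => - f y) (- a).
Proof. by move=> hf; exact: is_deriveN. Qed.

Lemma derM f g x a b : derat x f a -> derat x g b ->
  derat x (fun y => f y * g y) (a * g x + f x * b).
Proof.
move=> hf hg; apply: (is_derive_eq (is_deriveM hf hg)).
by rewrite addrC /GRing.scale /= (mulrC (g x)).
Qed.

Lemma derX n f x a : derat x f a ->
  derat x (fun y => f y ^+ n) (n%:R * f x ^+ n.-1 * a).
Proof.
move=> hf; elim: n => [|n ih].
  by rewrite !mul0r; exact: der_cst.
have h := derM hf ih.
have -> : (fun y => f y ^+ n.+1) = (fun y => f y * f y ^+ n).
  by apply/funext => y; rewrite exprS.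
apply: (is_derive_eq h); case: n {ih h} => [|n]; first by rewrite !expr0; ring.
by rewrite /= exprS -[n.+2%:R]natr1 -[n.+1%:R]natr1; ring.
Qed.

Lemma der_comp f g x a b : derat x f a ->
  derat (f x) g b -> derat x (fun y => g (f y)) (a * b).
Proof.
move=> hf hg; apply: (is_derive_eq (is_derive1_comp hg hf)).
by rewrite mulrC.
Qed.

Lemma der_expR f x a : derat x f a ->
  derat x (fun y => expR (f y)) (a * expR (f x)).
Proof. by move=> hf; apply: (der_comp hf); exact: is_derive_expR. Qed.

Lemma der_powR (p : R) f x a : derat x f a -> 0 < f x ->
  derat x (fun y => f y `^ p) (a * (p * f x `^ (p - 1))).
Proof. move=> hf fx; apply: (@der_comp f (fun y => y `^ p) x a _ hf).
exact: is_derive1_powR. Qed.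

Lemma derat_inv f x a : derat x f a -> f x != 0 ->
  derat x (fun y => (f y)^-1) (- a * (f x) ^- 2).
Proof.
move=> hf fx; apply: (is_derive_eq (is_deriveV fx hf)).
by rewrite /GRing.scale /= mulNr mulrC mulNr.
Qed.

Lemma der_eq f g x a b : derat x f a -> f =1 g -> a = b ->
  derat x g b.
Proof. by move=> hf /funext <- <-. Qed.

Lemma der_val f x a b : derat x f a -> a = b ->
  derat x f b.
Proof. by move=> hf <-. Qed.

Lemma der_near f g x a : derat x f a ->
  (\forall y \near x, f y = g y) -> derat x g a.
Proof.
move=> [h1 h2] fg; rewrite /derat; split.
  by apply: (@near_eq_derivable _ _ _ f) => //; near do rewrite (near fg).
rewrite -h2; apply/esym; apply: near_eq_derive => //.
Unshelve. all: end_near. Qed.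

Lemma der_cont f x a : derat x f a -> {for x, continuous f}.
Proof.
by move=> [h _]; apply: differentiable_continuous; exact/derivable1_diffP.
Qed.

Lemma der_derive1 f x a : derat x f a -> derive1 f x = a.
Proof. by move=> [_ h]; rewrite derive1E. Qed.

Lemma derivable_der f x : derivable f x 1 -> derat x f (derive1 f x).
Proof. by move=> h; rewrite /derat; split => //; rewrite derive1E. Qed.

End derivative_combinators.

Ltac der1 := first
  [ eassumption | exact: der_id | exact: der_cst | apply: derD | apply: derN
  | apply: derM | apply: derX | apply: der_expR | apply: der_powR
  | apply: derat_inv ].
Ltac der := repeat der1.

(** * Integrals over the line: fundamental theorem, positivity, integrable powers *)

Section lebesgue_real.
Context (R : realType).
Notation mu := (@lebesgue_measure R).
Implicit Types (f g : R -> R) (a b : R).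

Lemma indic_in (D : set R) x : D x -> \1_D x = 1 :> R.
Proof. by move=> xD; rewrite indicE mem_set. Qed.

Lemma indic_out (D : set R) x : ~ D x -> \1_D x = 0 :> R.
Proof. by move=> xD; rewrite indicE memNset. Qed.

Lemma eq_indic (A B : set R) x : (A x <-> B x) -> \1_A x = \1_B x :> R.
Proof.
move=> AB; have [xA|xA] := pselect (A x).
  by rewrite !indic_in//; exact/AB.
by rewrite !indic_out// => /AB.
Qed.

Lemma indic_restrict (D : set R) f : f \_ D = (fun x => \1_D x * f x).
Proof.
apply/funext => x; rewrite patchE indicE; case: ifPn => xD.
  by rewrite mul1r.
by rewrite mul0r.
Qed.

Lemma int_indic (D : set R) f :
  \int[mu]_(x in D) f x = \int[mu]_x (\1_D x * f x).
Proof. by rewrite Rintegral_mkcond indic_restrict. Qed.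

Lemma L1_indicP (D : set R) f : measurable D ->
  mu.-integrable D (EFin \o f) <-> L1 mu (fun x => \1_D x * f x).
Proof.
move=> mD; rewrite integrable_mkcond// /L1.
rewrite (_ : (EFin \o f) \_ D = EFin \o (fun x => \1_D x * f x))//.
apply/funext => x; rewrite /= patchE indicE; case: ifPn => xD.
  by rewrite mul1r.
by rewrite mul0r.
Qed.

Lemma L1_indicM (D : set R) f : measurable D -> L1 mu f ->
  L1 mu (fun x => \1_D x * f x).
Proof.
move=> mD fi; apply: (L1_bounded (k := 1)) => //.
  by move=> x; rewrite indicE; case: (_ \in _); rewrite ?normr1 ?normr0.
Qed.

Lemma ftc_itv (F f : R -> R) a b : a <= b ->
  (forall x, a <= x <= b -> derat x F (f x)) ->
  (forall x, a <= x <= b -> {for x, continuous f}) ->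
  L1 mu (fun x => \1_`[a, b] x * f x) /\
  \int[mu]_x (\1_`[a, b] x * f x) = F b - F a.
Proof.
rewrite le_eqVlt => /orP[/eqP <- _ _|ab dF cf].
  rewrite subrr set_itv1 -int_indic Rintegral_set1; split => //.
  apply/(L1_indicP _ (measurable_set1 a)).
  have m0 : mu [set a] = 0%E by exact: lebesgue_measure_set1.
  apply: null_set_integrable => //; exact: measurable_fun_set1.
have wcf : {within `[a, b], continuous f}.
  apply: continuous_in_subspaceT => x; rewrite inE/= in_itv/= => /cf; exact.
have fi : mu.-integrable `[a, b] (EFin \o f).
  by apply: continuous_compact_integrable => //; exact: segment_compact.
have fi' : L1 mu (fun x => \1_`[a, b] x * f x).
  exact/(@L1_indicP `[a, b]%classic f (measurable_itv _)).
split => //; rewrite -int_indic /Rintegral (continuous_FTC2 ab wcf (F := F)) ?EFinB//.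
- have dF' x : a <= x <= b -> derivable F x 1 by move=> /dF [].
  have cF x : a <= x <= b -> {for x, continuous F}.
    by move=> /dF' h; apply: differentiable_continuous; exact/derivable1_diffP.
  split.
  + by move=> x; rewrite in_itv/= => /andP[ax xb]; apply: dF'; rewrite !ltW.
  + by apply: cvg_at_right_filter; apply: cF; rewrite lexx ltW.
  + by apply: cvg_at_left_filter; apply: cF; rewrite lexx ltW.
- move=> x; rewrite in_itv/= => /andP[ax xb]; rewrite derive1E.
  by have [] := dF x _; rewrite ?ltW.
Qed.

Lemma int_indic_itv a b : a <= b -> L1 mu (fun x => \1_`[a, b] x) /\
  \int[mu]_x \1_`[a, b] x = b - a.
Proof.
move=> ab; have [] := @ftc_itv (fun x => x) (fun=> 1) a b ab.
- by move=> x _; exact: der_id.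
- by move=> x _; exact: cst_continuous.
move=> h1 h2; split.
  by apply: (eq_L1 _ h1) => x; rewrite mulr1.
by rewrite -h2; apply: eq_int => x; rewrite mulr1.
Qed.

Lemma int_gt0 f x0 : L1 mu f -> (forall x, 0 <= f x) -> {for x0, continuous f} ->
  0 < f x0 -> 0 < \int[mu]_x f x.
Proof.
move=> fi f0 cf fx0; have f2 : 0 < f x0 / 2 by rewrite divr_gt0.
have /cvgrPdist_lt/(_ _ f2)/nbhs_ballP[e /= e0 he] : f x @[x --> x0] --> f x0 := cf.
have [i1 i2] := @int_indic_itv (x0 - e / 2) (x0 + e / 2) ltac:(lra).
apply: (@lt_le_trans _ _ (f x0 / 2 * e)); first by rewrite mulr_gt0.
rewrite (_ : e = x0 + e / 2 - (x0 - e / 2)); last by field.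
rewrite -i2 -intZ//; apply: int_le => //; first exact: L1Z.
move=> x; have [xA|xA] := pselect (`[x0 - e / 2, x0 + e / 2]%classic x); last first.
  by rewrite indic_out ?mulr0.
rewrite indic_in// mulr1; move: xA; rewrite /= in_itv/= => /andP[h1 h2].
have : ball x0 e x by rewrite /ball/= ltr_norml; apply/andP; split; lra.
by move/he; rewrite ltr_norml => /andP[_]; lra.
Qed.

(** Serves for e^u before a continuous representative is known. If the integral vanished, f would be
    0 almost everywhere and [[a, b]] would be a null set. *)
Lemma int_gt0_itv f a b : a < b -> L1 mu f -> (forall x, 0 <= f x) ->
  (forall x, `[a, b]%classic x -> 0 < f x) -> 0 < \int[mu]_x f x.
Proof.
move=> ab fi f0 fab; rewrite lt_neqAle int_ge0// andbT; apply/eqP => i0.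
have mf := L1_measurable fi.
have z : (\int[mu]_x `|(f x)%:E|)%E = 0%E.
  rewrite -[RHS](congr1 EFin (esym i0)) EFin_Rintegral//.
  by apply: eq_integral => x _; rewrite gee0_abs// lee_fin.
have [N [mN N0 hN]] : {ae mu, forall x, setT x -> (f x)%:E = 0%E}.
  apply/(@ae_eq_integral_abs _ _ _ mu setT measurableT (EFin \o f)) => //.
  exact/measurable_EFinP.
have sub : `[a, b]%classic `<=` N.
  by move=> x /fab fx; apply: hN => /= /(_ I) [] e; rewrite e ltxx in fx.
have : (mu `[a, b]%classic <= mu N)%E by apply: le_measure; rewrite ?inE.
have -> : mu `[a, b]%classic = (b - a)%:E.
  by have := lebesgue_measure_itv `[a, b]; rewrite /= lte_fin ab -EFinB.
by rewrite N0 lee_fin leNgt subr_gt0 ab.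
Qed.

Lemma int_le0_eq0 f : L1 mu f -> (forall x, 0 <= f x) -> continuous f ->
  \int[mu]_x f x <= 0 -> forall x, f x = 0.
Proof.
move=> fi f0 cf i0 x; apply/eqP; rewrite eq_le f0 andbT leNgt; apply/negP => fx.
by have := int_gt0 fi f0 (cf x) fx; rewrite ltNge i0.
Qed.

Lemma cvg_indic_tail (x : R) : \1_[set y : R | n%:R < `|y|] x @[n --> \oo] --> (0 : R).
Proof.
apply: cvg_near_cst; near=> n; rewrite indic_out//= => h.
have : `|x| <= n%:R by near: n; exact: nbhs_infty_ger.
by rewrite leNgt h.
Unshelve. all: end_near. Qed.

Lemma int_tail f (e : R) : L1 mu f -> 0 < e ->
  exists n : nat, \int[mu]_x (\1_[set y : R | n%:R < `|y|] x * `|f x|) < e.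
Proof.
move=> fi e0; have mf := L1_measurable fi.
have [_ h] := @dct_all _ _ _ mu
  (fun n x => \1_[set y : R | n%:R < `|y|] x * `|f x|) (fun=> 0) (fun x => `|f x|)
  ltac:(by move=> n; mfun) ltac:(by mfun)
  ltac:(by move=> x; rewrite -(mul0r `|f x|); apply: cvgMr_tmp; exact: cvg_indic_tail)
  (L1_abs fi) ltac:(move=> n x /=; rewrite /= indicE;
     by case: (_ \in _); rewrite ?mul0r ?normr0 ?mul1r ?normr1 ?mul1r ?normr_id ?normr_ge0).
move: h; rewrite int0 => /cvgrPdist_lt/(_ _ e0)[n _ /(_ n (leqnn n))] h.
exists n; move: h; rewrite sub0r normrN => /(le_lt_trans _); apply.
exact: ler_norm.
Qed.

Lemma L1_even_majorant (f g : R -> R) : measurable_fun setT f -> L1 mu g ->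
  (forall x, 0 <= g x) -> (forall x, 0 <= x -> `|f x| <= g x) ->
  (forall x, 0 <= x -> `|f (- x)| <= g x) -> L1 mu f.
Proof.
move=> mf gi g0 h1 h2; apply: (L1_le (L1D gi (L1_refl 0 gi))) => // x.
have [x0|x0] := leP 0 x.
  by apply: (le_trans (h1 x x0)); rewrite lerDl g0.
rewrite -[X in f X]opprK sub0r.
by apply: (le_trans (h2 _ _)); rewrite ?lerDr ?g0// oppr_ge0 ltW.
Qed.

Lemma continuous_powR (p x : R) : 0 < x -> {for x, continuous (fun y : R => y `^ p)}.
Proof. by move=> x0; apply: der_cont; apply: is_derive1_powR. Qed.

(** The integrals from [1 / (n + 1)] to 1 are explicit and bounded by [1 / (1 - b)], so Fatou's
    lemma applies. At the singular point the power of 0 is 0 by convention. *)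
Lemma L1_powR_near0 b : 0 < b < 1 -> L1 mu (fun x => \1_`[-1, 1] x * `|x| `^ (- b)).
Proof.
move=> /andP[bpos b1].
have b0 : 0 < 1 - b by lra.
pose F (n : nat) (x : R) := \1_`[n.+1%:R^-1, 1] x * x `^ (- b) : R.
pose g (x : R) : R := \1_`]0, 1] x * x `^ (- b).
have n1 n : (n.+1%:R^-1 : R) <= 1 by rewrite invf_le1// ler1n.
have n0 n : 0 < (n.+1%:R^-1 : R) by rewrite invr_gt0.
have hF n : L1 mu (F n) /\ \int[mu]_x F n x =
    1 `^ (1 - b) / (1 - b) - (n.+1%:R^-1) `^ (1 - b) / (1 - b).
  apply: (@ftc_itv (fun x => x `^ (1 - b) / (1 - b)) (fun x => x `^ (- b))) => // x /andP[hx _].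
    have x0 : 0 < x := lt_le_trans (n0 n) hx.
    apply: der_val; first by apply: derM; [exact: (is_derive1_powR (1 - b) x0)|exact: der_cst].
    by rewrite mulr0 addr0 (_ : 1 - b - 1 = - b); [field; rewrite gt_eqF//; lra|ring].
  by apply: continuous_powR; exact: lt_le_trans (n0 n) hx.
have mg : measurable_fun setT g by rewrite /g; mfun.
have ind0 (A : set R) x : (0 : R) <= \1_A x by rewrite indicE.
have gi : L1 mu g.
  have [] // := @L1_fatou _ _ _ mu F g ((1 - b)^-1).
  - by move=> n; exact: (hF n).1.
  - by move=> n x; rewrite mulr_ge0 ?powR_ge0.
  - move=> x; apply: cvg_near_cst.
    have [x0|x0] := leP x 0.
      apply: nearW => n; rewrite /F /g; congr (_ * _); apply: eq_indic.
      rewrite /= !in_itv/= (ltNge 0) x0/=; split => // /andP[h _].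
      by have := lt_le_trans (n0 n) h; rewrite ltNge x0.
    near=> n; rewrite /F /g; congr (_ * _).
    have hn : n.+1%:R^-1 <= x.
      rewrite -[leRHS]invrK lef_pV2 ?posrE ?invr_gt0//.
      apply: (@le_trans _ _ n%:R); last by rewrite ler_nat.
      by near: n; exact: nbhs_infty_ger.
    by apply: eq_indic; rewrite /= !in_itv/= x0 hn.
  - move=> n; rewrite (hF n).2 powR1 mul1r lerBlDr lerDl.
    by rewrite divr_ge0 ?powR_ge0 ?ltW.
apply: (L1_even_majorant _ gi).
- by mfun.
- by move=> x; rewrite mulr_ge0 ?powR_ge0.
- move=> x x0; rewrite /g ger0_norm ?mulr_ge0 ?powR_ge0// (ger0_norm x0).
  move: x0; rewrite le_eqVlt => /orP[/eqP <-|x0].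
    by rewrite powR0 ?oppr_eq0 ?gt_eqF// !mulr0.
  rewrite ler_wpM2r ?powR_ge0// !indicE ler_nat; case: (boolP (x \in _)) => //.
  by rewrite inE/= in_itv/= => /andP[_ xle]; rewrite mem_set//= in_itv/= x0.
- move=> x x0; rewrite /g normrN ger0_norm ?mulr_ge0 ?powR_ge0// (ger0_norm x0).
  move: x0; rewrite le_eqVlt => /orP[/eqP <-|x0].
    by rewrite powR0 ?oppr_eq0 ?gt_eqF// !mulr0.
  rewrite ler_wpM2r ?powR_ge0// !indicE ler_nat; case: (boolP (- x \in _)) => //.
  rewrite inE/= in_itv/= => /andP[xle _]; rewrite mem_set//= in_itv/= x0/=; lra.
Unshelve. all: end_near. Qed.

Lemma L1_powR_infty (p : R) : 1 < p -> L1 mu (fun x => (1 + `|x|) `^ (- p)).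
Proof.
move=> p1.
pose F (n : nat) (x : R) := \1_`[0, n%:R] x * (1 + x) `^ (- p) : R.
pose g (x : R) : R := \1_`[0, +oo[ x * (1 + x) `^ (- p).
have hF n : L1 mu (F n) /\ \int[mu]_x F n x =
    (1 + n%:R) `^ (1 - p) / (1 - p) - (1 + 0) `^ (1 - p) / (1 - p).
  apply: (@ftc_itv (fun x => (1 + x) `^ (1 - p) / (1 - p)) (fun x => (1 + x) `^ (- p))) => // x /andP[x0 _].
    apply: der_val; first by der; lra.
    by rewrite mulr0 !addr0 add0r (_ : 1 - p - 1 = - p); [field; rewrite lt_eqF//; lra|ring].
  by apply: der_cont; der; lra.
have mg : measurable_fun setT g by rewrite /g; mfun.
have ind0 (A : set R) x : (0 : R) <= \1_A x by rewrite indicE.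
have gi : L1 mu g.
  have [] // := @L1_fatou _ _ _ mu F g ((p - 1)^-1).
  - by move=> n; exact: (hF n).1.
  - by move=> n x; rewrite mulr_ge0 ?powR_ge0.
  - move=> x; apply: cvg_near_cst.
    near=> n; rewrite /F /g; congr (_ * _).
    have hn : x <= n%:R by near: n; exact: nbhs_infty_ger.
    by apply: eq_indic; rewrite /= !in_itv/= hn.
  - move=> n; rewrite (hF n).2 addr0 powR1 -[1 - p]opprB invrN !mulrN opprK addrC.
    by rewrite mul1r lerBlDr lerDl mulr_ge0 ?powR_ge0// invr_ge0; lra.
apply: (L1_even_majorant _ gi).
- by mfun.
- by move=> x; rewrite mulr_ge0 ?powR_ge0.
- move=> x x0; rewrite /g ger0_norm ?powR_ge0// (ger0_norm x0).
  by rewrite indic_in ?mul1r//= in_itv/= x0.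
- move=> x x0; rewrite /g normrN ger0_norm ?powR_ge0// (ger0_norm x0).
  by rewrite indic_in ?mul1r//= in_itv/= x0.
Unshelve. all: end_near. Qed.

Lemma int_der_compact (F f : R -> R) (T : R) : 0 <= T -> (forall x, derat x F (f x)) ->
  continuous f -> (forall x, T < `|x| -> F x = 0) -> (forall x, T < `|x| -> f x = 0) ->
  L1 mu f /\ \int[mu]_x f x = 0.
Proof.
move=> T0 dF cf F0 f0.
have e x : \1_`[- (T + 1), T + 1] x * f x = f x.
  have [h|h] := leP `|x| T.
    rewrite indic_in ?mul1r//= in_itv/=; move: h; rewrite ler_norml => /andP[]; lra.
  by rewrite f0// mulr0.
have [] := @ftc_itv F f (- (T + 1)) (T + 1) ltac:(lra) (fun x _ => dF x) (fun x _ => cf x).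
rewrite (F0 (T + 1)) ?(F0 (- (T + 1))) ?normrN ?ger0_norm ?subrr; [|lra..].
by rewrite (funext e).
Qed.

Lemma L1_compact f (T : R) : continuous f -> (forall x, T < `|x| -> f x = 0) -> L1 mu f.
Proof.
move=> cf f0.
have e x : \1_`[- T, T] x * f x = f x.
  have [h|h] := leP `|x| T.
    by rewrite indic_in ?mul1r//= in_itv/=; move: h; rewrite ler_norml.
  by rewrite f0// mulr0.
rewrite -(funext e); apply/(@L1_indicP `[- T, T]%classic f (measurable_itv _)).
apply: continuous_compact_integrable; first exact: segment_compact.
exact: continuous_subspaceT.
Qed.

Lemma bounded_compact f (T : R) : continuous f -> (forall x, T < `|x| -> f x = 0) ->
  exists2 C : R, 0 < C & forall x, `|f x| <= C.
Proof.
move=> cf f0.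
have : bounded_set (f @` `[- T, T]).
  apply: compact_bounded; apply: continuous_compact; last exact: segment_compact.
  exact: continuous_subspaceT.
move=> [M [_ hM]]; exists (`|M| + 1); first by rewrite ltr_wpDl.
move=> x; have [h|h] := leP `|x| T; last by rewrite f0// normr0 addr_ge0.
apply: (hM (`|M| + 1)); first by have := ler_norm M; lra.
by exists x => //=; rewrite in_itv/=; move: h; rewrite ler_norml.
Qed.

End lebesgue_real.

(** * Smooth functions and cutoffs *)

Section smooth_calculus.
Context (R : realType).
Implicit Types (f g : R -> R) (x a b : R).

(** The recursion passes to [derive1 f], so closure properties follow by induction on n with f
    generalised. A finite order is what lets the induction treat inverses and powers, whose
    derivatives again contain an inverse or a power of the same function. *)
Fixpoint ndiff n f : Prop := match n with
  | 0 => True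
  | n'.+1 => (forall x, derivable f x 1) /\ ndiff n' (derive1 f)
  end.

Lemma derive1n_derive1 n f : derive1n n (derive1 f) = derive1n n.+1 f.
Proof. by rewrite derive1Sn. Qed.

Lemma smooth_derive1 f : smooth f -> smooth (derive1 f).
Proof. by move=> sf n x; rewrite derive1n_derive1; exact: sf. Qed.

Lemma smooth_derivable f x : smooth f -> derivable f x 1.
Proof. by move=> /(_ 0%N x). Qed.

Lemma smooth_der f x : smooth f -> derat x f (derive1 f x).
Proof. by move=> sf; apply: derivable_der; exact: smooth_derivable. Qed.

Lemma smooth_continuous f : smooth f -> continuous f.
Proof. by move=> sf x; apply: der_cont; exact: smooth_der. Qed.

Lemma smoothP f : smooth f <-> forall n, ndiff n f.
Proof.
split=> [sf n|nf n].
  elim: n f sf => //= n ih f sf; split; first by move=> x; exact: smooth_derivable.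
  by apply: ih; exact: smooth_derive1.
elim: n f nf => [|n ih] f nf x; first by have [] := nf 1%N.
rewrite -derive1n_derive1; apply: ih => k.
by have [] := nf k.+1.
Qed.

Lemma ndiffW n f : ndiff n.+1 f -> ndiff n f.
Proof.
elim: n f => //= n ih f [h1 h2]; split => //.
exact: ih.
Qed.

Lemma ndiffS n f f' : (forall x, derat x f (f' x)) -> ndiff n f' ->
  ndiff n.+1 f.
Proof.
move=> df nf'; split; first by move=> x; have [] := df x.
by rewrite (_ : derive1 f = f')//; apply/funext => x; exact: der_derive1.
Qed.

Lemma ndiff_der n f x : ndiff n.+1 f -> derat x f (derive1 f x).
Proof. by move=> [h _]; exact: derivable_der. Qed.

Lemma ndiff_cst n a : ndiff n (fun=> a).
Proof.
elim: n a => // n ih a; apply: (ndiffS (f' := fun=> 0)) => // x; exact: der_cst.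
Qed.

Lemma ndiffD n f g : ndiff n f -> ndiff n g -> ndiff n (fun x => f x + g x).
Proof.
elim: n f g => // n ih f g nf ng.
apply: (ndiffS (f' := fun x => derive1 f x + derive1 g x)).
  by move=> x; apply: derD; [exact: ndiff_der nf|exact: ndiff_der ng].
by apply: ih; [exact: nf.2|exact: ng.2].
Qed.

Lemma ndiffM n f g : ndiff n f -> ndiff n g -> ndiff n (fun x => f x * g x).
Proof.
elim: n f g => // n ih f g nf ng.
apply: (ndiffS (f' := fun x => derive1 f x * g x + f x * derive1 g x)).
  by move=> x; apply: derM; [exact: ndiff_der nf|exact: ndiff_der ng].
apply: ndiffD; apply: ih; [exact: nf.2|exact: ndiffW|exact: ndiffW|exact: ng.2].
Qed.

Lemma ndiffN n f : ndiff n f -> ndiff n (fun x => - f x).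
Proof.
move=> nf; rewrite (_ : (fun x => - f x) = (fun x => (-1) * f x)).
  by apply: ndiffM => //; exact: ndiff_cst.
by apply/funext => x; rewrite mulN1r.
Qed.

Lemma ndiff_affine n f a b : ndiff n f -> ndiff n (fun x => f (a * x + b)).
Proof.
elim: n f => // n ih f nf.
apply: (ndiffS (f' := fun x => a * derive1 f (a * x + b))).
  move=> x; apply: (@der_comp _ (fun x => a * x + b) f).
    by apply: der_val; [der|rewrite mul0r mulr1 add0r addr0].
  exact: ndiff_der nf.
by apply: ndiffM; [exact: ndiff_cst|apply: ih; exact: nf.2].
Qed.

Lemma ndiff_id n : ndiff n (fun x => x).
Proof.
case: n => // n; apply: (ndiffS (f' := fun=> 1)); last exact: ndiff_cst.
by move=> x; exact: der_id.
Qed.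

Lemma ndiff_inv n f : (forall x, f x != 0) -> ndiff n f -> ndiff n (fun x => (f x)^-1).
Proof.
move=> f0; elim: n => // n ih nf.
apply: (ndiffS (f' := fun x => - derive1 f x * ((f x)^-1 * (f x)^-1))).
  move=> x; apply: der_val; first by apply: derat_inv (ndiff_der x nf) (f0 x).
  by rewrite -expr2 exprVn.
apply: ndiffM; first by apply: ndiffN; exact: nf.2.
by apply: ndiffM; apply: ih; exact: ndiffW.
Qed.

Lemma ndiff_powR n (p : R) f : (forall x, 0 < f x) -> ndiff n f ->
  ndiff n (fun x => f x `^ p).
Proof.
move=> f0; elim: n p => // n ih p nf.
apply: (ndiffS (f' := fun x => derive1 f x * (p * f x `^ (p - 1)))).
  by move=> x; apply: der_powR (f0 x); exact: ndiff_der nf.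
apply: ndiffM; first exact: nf.2.
by apply: ndiffM; [exact: ndiff_cst|apply: ih; exact: ndiffW].
Qed.

Lemma der_cvg f x a :
  h^-1 * (f (h + x) - f x) @[h --> 0^'] --> a -> derat x f a.
Proof.
move=> h; have h' : (h^-1 *: ((f \o shift x) (h *: (1 : R)) - f x)) @[h --> 0^'] --> a.
  by under eq_fun do rewrite /= /GRing.scale /= mulr1.
by rewrite /derat; split; [apply/cvg_ex; exists a|apply: cvg_lim].
Qed.

Lemma der_quadratic f x (C : R) : f x = 0 -> (forall y, `|f y| <= C * (y - x) ^+ 2) ->
  derat x f 0.
Proof.
move=> fx fC.
have C0 : 0 <= C.
  have := le_trans (normr_ge0 _) (fC (x + 1)).
  by rewrite addrAC subrr add0r expr1n mulr1.
have C1 : 0 < C + 1 by exact: ltr_wpDl.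
apply: der_cvg; apply/cvgrPdist_le => e e0; near=> h.
rewrite sub0r normrN fx subr0 normrM normfV.
have h0 : h != 0 by near: h; exact: nbhs_dnbhs_neq.
rewrite ler_pdivrMl ?normr_gt0//.
apply: (le_trans (fC _)); rewrite addrK -[h ^+ 2]ger0_norm ?sqr_ge0// normrX expr2 mulrA.
rewrite [leRHS]mulrC ler_wpM2r//.
apply: (@le_trans _ _ ((C + 1) * `|h|)); first by rewrite ler_wpM2r//; lra.
rewrite -(ler_pdivlMl _ _ C1); near: h; apply: dnbhs0_le.
by rewrite mulr_gt0// invr_gt0.
Unshelve. all: end_near. Qed.

(* Every derivative of exp(-1/x), extended by 0 to x <= 0, is a combination of these. *)
Definition flat k x : R := if 0 < x then x ^- k * expR (- x^-1) else 0.

Lemma flat_ge0 k x : 0 <= flat k x.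
Proof.
rewrite /flat; case: ifPn => // x0.
by rewrite mulr_ge0 ?expR_ge0// invr_ge0 exprn_ge0// ltW.
Qed.

Lemma flat_gt0 k x : 0 < x -> 0 < flat k x.
Proof.
by move=> x0; rewrite /flat x0 mulr_gt0 ?expR_gt0// invr_gt0 exprn_gt0.
Qed.

Lemma flat_eq0 k x : x <= 0 -> flat k x = 0.
Proof. by move=> x0; rewrite /flat ltNge x0. Qed.

(** With [y = 1 / x], the inequality [y / (k + 1) <= exp (y / (k + 1))] is raised to the power k;
    using k + 1 avoids a division by 0 when k = 0. *)
Lemma flat_bounded k x : flat k x <= k.+1%:R ^+ k.
Proof.
have [x0|x0] := leP x 0; first by rewrite flat_eq0// exprn_ge0.
rewrite /flat x0; set y := x^-1; have y0 : 0 < y by rewrite invr_gt0.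
rewrite -exprVn -/y expRN ler_pdivrMr ?expR_gt0//.
have kp : 0 < k.+1%:R :> R by rewrite ltr0n.
have h1 : y / k.+1%:R <= expR (y / k.+1%:R).
  by apply: le_trans (expR_ge1Dx _); rewrite lerDr.
have h2 : expR (y / k.+1%:R) ^+ k <= expR y.
  rewrite -expRM_natl ler_expR mulrCA ger_pMr// ler_pdivrMr// mul1r ler_nat.
  exact: leqnSn.
apply: (@le_trans _ _ (k.+1%:R ^+ k * expR (y / k.+1%:R) ^+ k)).
  rewrite -exprMn lerXn2r ?nnegrE ?(ltW y0) ?mulr_ge0 ?expR_ge0 ?(ltW kp)//.
  by rewrite mulrC -ler_pdivrMr.
by rewrite ler_wpM2l// exprn_ge0// ltW.
Qed.

Lemma der_flat k x : derat x (flat k) (flat k.+2 x - k%:R * flat k.+1 x).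
Proof.
have [x0|x0|->] := ltgtP x 0.
- rewrite !flat_eq0 ?ltW// mulr0 subrr; apply: (@der_near _ (fun=> 0)).
    exact: der_cst.
  near=> y; rewrite flat_eq0//; apply: ltW; near: y; exact: lt_nbhsl.
- apply: (@der_near _ (fun x => x ^- k * expR (- x^-1))); last first.
    near=> y; rewrite /flat ifT//; near: y; exact: lt_nbhsr.
  have xn0 : x != 0 by rewrite gt_eqF.
  apply: der_val.
    apply: derM; first by apply: derat_inv; [der|rewrite expf_neq0].
    by apply: der_expR; apply: derN; apply: derat_inv; [der|exact: xn0].
  rewrite /flat x0; case: k => [|k].
    by rewrite /= !expr0; field.
  by rewrite /= !exprS expr0; field; rewrite ?xn0 ?expf_neq0.
- rewrite !flat_eq0// mulr0 subrr.
  (* At 0 the derivative vanishes because [flat k y = flat k.+2 y * y ^+ 2], and [flat_bounded]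
     bounds the first factor. *)
  apply: (@der_quadratic _ _ (k.+3%:R ^+ k.+2)); first by rewrite flat_eq0.
  move=> y; rewrite subr0 ger0_norm ?flat_ge0//.
  have -> : flat k y = flat k.+2 y * y ^+ 2.
    rewrite /flat; case: ifPn => [y0|]; last by rewrite mul0r.
    have yn0 : y != 0 by rewrite gt_eqF.
    by rewrite !exprS expr0; field; rewrite ?yn0 ?expf_neq0.
  by rewrite ler_wpM2r ?sqr_ge0// flat_bounded.
Unshelve. all: end_near. Qed.

Lemma ndiff_flat n k : ndiff n (flat k).
Proof.
elim: n k => // n ih k; apply: ndiffS; first exact: der_flat.
apply: ndiffD; first exact: ih.
by apply: ndiffN; apply: ndiffM; [exact: ndiff_cst|exact: ih].
Qed.

Definition step x := flat 0 x / (flat 0 x + flat 0 (1 - x)).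

Lemma step_den_gt0 x : 0 < flat 0 x + flat 0 (1 - x).
Proof.
have [x0|x0] := ltP 0 x; first by rewrite ltr_pwDl ?flat_gt0 ?flat_ge0.
by rewrite ltr_wpDl ?flat_ge0// flat_gt0//; lra.
Qed.

Lemma step_ge0 x : 0 <= step x.
Proof. by rewrite divr_ge0 ?flat_ge0// ltW// step_den_gt0. Qed.

Lemma step_le1 x : step x <= 1.
Proof. by rewrite ler_pdivrMr ?step_den_gt0// mul1r lerDl flat_ge0. Qed.

Lemma step0 x : x <= 0 -> step x = 0.
Proof. by move=> x0; rewrite /step flat_eq0// mul0r. Qed.

Lemma step1 x : 1 <= x -> step x = 1.
Proof.
move=> x1; rewrite /step (@flat_eq0 _ (1 - x)) ?addr0 ?divff ?gt_eqF ?flat_gt0//; lra.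
Qed.

Lemma ndiff_step n : ndiff n step.
Proof.
apply: ndiffM; first exact: ndiff_flat.
apply: ndiff_inv; first by move=> x; rewrite gt_eqF ?step_den_gt0.
apply: ndiffD; first exact: ndiff_flat.
have := @ndiff_affine n (flat 0) (-1) 1 (ndiff_flat n 0).
by under eq_fun do rewrite mulN1r addrC.
Qed.

Definition cutoff x := step (2 - x) * step (2 + x).

Lemma cutoff_ge0 x : 0 <= cutoff x.
Proof. by rewrite mulr_ge0 ?step_ge0. Qed.

Lemma cutoff_le1 x : cutoff x <= 1.
Proof. by rewrite mulr_ile1 ?step_ge0 ?step_le1. Qed.

Lemma cutoff1 x : `|x| <= 1 -> cutoff x = 1.
Proof.
by rewrite ler_norml => /andP[h1 h2]; rewrite /cutoff !step1 ?mulr1//; lra.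
Qed.

Lemma cutoff0 x : 2 <= `|x| -> cutoff x = 0.
Proof.
rewrite ler_normr => /orP[h|h]; rewrite /cutoff.
  by rewrite step0 ?mul0r//; lra.
by rewrite mulrC step0 ?mul0r//; lra.
Qed.

Lemma ndiff_cutoff n : ndiff n cutoff.
Proof.
apply: ndiffM.
  have := @ndiff_affine n step (-1) 2 (ndiff_step n).
  by under eq_fun do rewrite mulN1r addrC.
have := @ndiff_affine n step 1 2 (ndiff_step n).
by under eq_fun do rewrite mul1r addrC.
Qed.

Lemma closed_support_bounded f (T : R) : (forall x, T < `|x| -> f x = 0) ->
  tsupport f `<=` [set x | `|x| <= T].
Proof.
move=> f0; have cl : closed [set x : R | `|x| <= T].
  rewrite (_ : [set x : R | _] = (fun x : R => `|x|) @^-1` [set y | y <= T]) //.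
  by apply: preimage_closed => // x _; exact: norm_continuous.
apply: (@subset_trans _ (closure [set x : R | `|x| <= T])); last first.
  by rewrite -(closure_id _).1.
apply: closure_subset => x /=; apply: contraNT; rewrite -ltNge => /f0 ->.
by rewrite eqxx.
Qed.

Lemma test_functionP f : test_function f <->
  smooth f /\ exists2 T : R, 0 <= T & forall x, T < `|x| -> f x = 0.
Proof.
split=> [[sf cf]|[sf [T T0 f0]]]; split => //.
  have [M [_ hM]] := compact_bounded cf.
  exists (`|M| + 1) => [|x xM]; first by rewrite addr_ge0.
  apply/eqP; apply: contraT => fx.
  have xs : tsupport f x by apply: subset_closure.
  have M1 : M < `|M| + 1 by have := ler_norm M; lra.
  have := hM (`|M| + 1) M1 x xs.
  by rewrite /= leNgt xM.
apply: (@subclosed_compact _ _ `[- T, T]%classic).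
- exact: closed_closure.
- exact: segment_compact.
- by move=> x /(closed_support_bounded f0) /=; rewrite in_itv/= ler_norml.
Qed.

Lemma support_derive1 f (T : R) : (forall x, T < `|x| -> f x = 0) ->
  forall x, T < `|x| -> derive1 f x = 0.
Proof.
move=> f0 x xT; apply: der_derive1; apply: (@der_near _ (fun=> 0)).
  exact: der_cst.
have : `|y| @[y --> x] --> `|x| by exact: norm_continuous.
move/cvgr_gt => /(_ _ xT); apply: filterS => y /f0 ->//.
Qed.

Lemma test_derive1 f : test_function f -> test_function (derive1 f).
Proof.
move=> /test_functionP[sf [T T0 f0]]; apply/test_functionP; split.
  exact: smooth_derive1.
by exists T => //; exact: support_derive1.
Qed.

Lemma test_continuous f : test_function f -> continuous f.
Proof. by move=> [sf _]; exact: smooth_continuous. Qed.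

Lemma test_bounded f : test_function f -> exists2 C : R, 0 < C & forall x, `|f x| <= C.
Proof.
move=> tf; have cf := test_continuous tf.
move/test_functionP : tf => [_ [T T0 f0]]; exact: bounded_compact f0.
Qed.

Lemma test_L1 f : test_function f -> L1 (@lebesgue_measure R) f.
Proof.
move=> tf; have cf := test_continuous tf.
move/test_functionP : tf => [_ [T T0 f0]]; exact: L1_compact f0.
Qed.

Lemma test_affine f a b : a != 0 -> test_function f ->
  test_function (fun x => f (a * x + b)).
Proof.
move=> a0 /test_functionP[sf [T T0 f0]]; apply/test_functionP; split.
  by apply/smoothP => n; apply: ndiff_affine; move/smoothP : sf; exact.
exists ((T + `|b|) / `|a|); first by rewrite divr_ge0 ?addr_ge0.
move=> x; rewrite ltr_pdivrMr ?normr_gt0// => h; apply: f0.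
have : `|x| * `|a| <= `|a * x + b| + `|b|.
  rewrite -normrM mulrC -{1}(addrK b (a * x)); exact: ler_normB.
lra.
Qed.

Lemma testZ f a : test_function f -> test_function (fun x => a * f x).
Proof.
move=> /test_functionP[sf [T T0 f0]]; apply/test_functionP; split.
  apply/smoothP => n; apply: ndiffM; first exact: ndiff_cst.
  by move/smoothP : sf; exact.
by exists T => // x /f0 ->; rewrite mulr0.
Qed.

Lemma testD f g : test_function f -> test_function g ->
  test_function (fun x => f x + g x).
Proof.
move=> /test_functionP[sf [T T0 f0]] /test_functionP[sg [S S0 g0]].
apply/test_functionP; split.
  by apply/smoothP => n; apply: ndiffD; [move/smoothP : sf|move/smoothP : sg]; exact.
exists (T + S) => [|x h]; first by rewrite addr_ge0.
by rewrite f0 ?g0 ?addr0//; lra.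
Qed.

Lemma smoothM f g : smooth f -> smooth g -> smooth (fun x => f x * g x).
Proof.
move=> /smoothP sf /smoothP sg; apply/smoothP => n; exact: ndiffM.
Qed.

Lemma testM f g : test_function f -> smooth g -> test_function (fun x => f x * g x).
Proof.
move=> /test_functionP[sf [T T0 f0]] sg; apply/test_functionP; split.
  exact: smoothM.
by exists T => // x /f0 ->; rewrite mul0r.
Qed.

Lemma smooth_cutoff : smooth cutoff.
Proof. by apply/smoothP => n; exact: ndiff_cutoff. Qed.

Lemma test_cutoff : test_function cutoff.
Proof.
apply/test_functionP; split; first exact: smooth_cutoff.
by exists 2 => // x x2; rewrite cutoff0// ltW.
Qed.

End smooth_calculus.

(** * Mean value bounds and second differences *)

Section mean_value_bounds.
Context (R : realType).
Implicit Types (f : R -> R) (x y h B : R).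

Lemma mvt_bound f f' x y B : (forall z, `|z - x| <= `|y - x| -> derat z f (f' z)) ->
  (forall z, `|z - x| <= `|y - x| -> `|f' z| <= B) ->
  `|f y - f x| <= B * `|y - x|.
Proof.
move=> df fB.
have main u v : u <= v -> (forall z, u <= z <= v -> `|z - x| <= `|y - x|) ->
    `|f v - f u| <= B * `|v - u|.
  move=> uv sub; have hB z (hz : u <= z <= v) := fB z (sub z hz).
  have [] := @MVT_segment R f f' u v uv.
  - by move=> z; rewrite in_itv/= => /andP[h1 h2]; apply/df/sub; rewrite !ltW.
  - apply: continuous_in_subspaceT => z; rewrite inE/= in_itv/= => hz.
    exact: der_cont (df z (sub z hz)).
  - by move=> c; rewrite in_itv/= => hc ->; rewrite normrM ler_wpM2r// hB.
have [xy|yx] := leP x y.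
  by apply: main => // z /andP[h1 h2]; rewrite !ger0_norm; lra.
rewrite distrC (distrC y); apply: main => [|z /andP[h1 h2]]; first exact: ltW.
by rewrite !ler0_norm; lra.
Qed.

Definition diff2 f x h := 2 * f x - f (x + h) - f (x - h).

Lemma diff2_0 f x : diff2 f x 0 = 0.
Proof. by rewrite /diff2 addr0 subr0; ring. Qed.

Lemma diff2_bound0 f x h B : (forall y, `|f y| <= B) -> `|diff2 f x h| <= 4 * B.
Proof.
move=> fB; rewrite /diff2; apply: (le_trans (ler_normB _ _)).
have := ler_normB (2 * f x) (f (x + h)); rewrite normrM normr_nat.
by have := fB x; have := fB (x + h); have := fB (x - h); lra.
Qed.

(** Only f'' within distance [|h|] of x enters. This transfers decay of f'' to second differences,
    and it tolerates functions such as x |x|^a whose second derivative is singular at 0. *)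
Lemma diff2_bound2 f f' f'' x h B : (forall z, derat z f (f' z)) ->
  (forall z, `|z - x| <= `|h| -> derat z f' (f'' z)) ->
  (forall z, `|z - x| <= `|h| -> `|f'' z| <= B) ->
  `|diff2 f x h| <= 2 * B * h ^+ 2.
Proof.
move=> df df' fB.
pose p t := f (x + t) + f (x - t).
pose p' t := f' (x + t) - f' (x - t).
have dp t : derat t p (p' t).
  apply: der_val.
    by apply: derD; (apply: der_comp; [|exact: df]); der.
  by rewrite /p'; ring.
have -> : diff2 f x h = - (p h - p 0).
  by rewrite /diff2 /p addr0 subr0; ring.
have B0 : 0 <= B.
  by apply: le_trans (fB x _); rewrite ?subrr ?normr0.
rewrite normrN; apply: (@le_trans _ _ (2 * B * `|h| * `|h - 0|)); last first.
  by rewrite subr0 -mulrA -expr2 real_normK ?num_real.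
apply: (mvt_bound (fun t _ => dp t)) => t; rewrite !subr0 => th; rewrite /p'.
have -> : f' (x + t) - f' (x - t) = (f' (x + t) - f' x) - (f' (x - t) - f' x) by ring.
apply: (le_trans (ler_normB _ _)).
have h1 : `|f' (x + t) - f' x| <= B * `|x + t - x|.
  have sub z : `|z - x| <= `|x + t - x| -> `|z - x| <= `|h|.
    by move=> hz; apply: (le_trans hz); rewrite addrAC subrr add0r.
  by apply: (mvt_bound (fun z hz => df' z (sub z hz))) => z /sub; exact: fB.
have h2 : `|f' (x - t) - f' x| <= B * `|x - t - x|.
  have sub z : `|z - x| <= `|x - t - x| -> `|z - x| <= `|h|.
    by move=> hz; apply: (le_trans hz); rewrite addrAC subrr add0r normrN.
  by apply: (mvt_bound (fun z hz => df' z (sub z hz))) => z /sub; exact: fB.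
have e1 : x + t - x = t by ring.
have e2 : x - t - x = - t by ring.
move: h1 h2; rewrite e1 e2 normrN.
have := ler_wpM2l B0 th; lra.
Qed.

End mean_value_bounds.

(** * The fractional Laplacian and its energy *)

Section fractional_kernel.
Context (R : realType) (a : R) (a0 : 0 < a) (a1 : a < 1).
Notation mu := (@lebesgue_measure R).
Implicit Types (f g phi : R -> R) (x y h : R).

Ltac alra := pose proof a0; pose proof a1; lra.

(** For [a = 2 s - 1] the exponent [2 + a] is the [1 + 2 s] of the fractional Laplacian. The value
    at 0 is 0 by the convention on powers of 0. *)
Definition frac_kern h : R := `|h| `^ (- (2 + a)).

Lemma kern_ge0 h : 0 <= frac_kern h.
Proof. exact: powR_ge0. Qed.

Lemma kernN h : frac_kern (- h) = frac_kern h.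
Proof. by rewrite /frac_kern normrN. Qed.

Lemma measurable_kern : measurable_fun setT frac_kern.
Proof. rewrite /frac_kern; mfun. Qed.

Lemma kern_sqr h : h ^+ 2 * frac_kern h <= `|h| `^ (- a).
Proof.
have [->|h0] := eqVneq h 0; first by rewrite expr0n/= mul0r powR_ge0.
have hp : 0 < `|h| by rewrite normr_gt0.
rewrite /frac_kern opprD powRD; last by rewrite (gt_eqF hp) ?implybT.
by rewrite powR_invn ?normr_ge0// real_normK ?num_real// mulrA divff ?mul1r// expf_neq0.
Qed.

(** An integrable majorant of [min(1, h^2) * frac_kern h]: near 0 the exponent - a is integrable
    because a < 1, and 8 bounds [2^(2 + a)] in the tail. *)
Definition kern_major h : R :=
  \1_`[-1, 1] h * `|h| `^ (- a) + 8 * (1 + `|h|) `^ (- (2 + a)).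

Lemma kern_major_ge0 h : 0 <= kern_major h.
Proof. by rewrite addr_ge0// mulr_ge0 ?powR_ge0// indicE. Qed.

Lemma L1_kern_major : L1 mu kern_major.
Proof.
apply: L1D; first by apply: L1_powR_near0; rewrite a0 a1.
by apply: L1Z; apply: L1_powR_infty; alra.
Qed.

Lemma kern_tail h : 1 < `|h| -> frac_kern h <= 8 * (1 + `|h|) `^ (- (2 + a)).
Proof.
move=> h1; have h0 : 0 < `|h| by lra.
have h2 : (2 * `|h|) `^ (- (2 + a)) <= (1 + `|h|) `^ (- (2 + a)).
  have p1 : 0 < 1 + `|h| by lra.
  have p2 : 0 < 2 * `|h| by lra.
  rewrite !powRN lef_pV2 ?posrE ?powR_gt0//.
  by apply: ge0_ler_powR; rewrite ?nnegrE; alra.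
rewrite /frac_kern -(ler_pM2l (_ : 0 < 8^-1)) ?invr_gt0// mulKf//.
apply: le_trans h2; rewrite (powRM _ (ler0n R 2) (ltW h0)) ler_wpM2r ?powR_ge0//.
rewrite powRN lef_pV2 ?posrE ?powR_gt0//.
apply: (@le_trans _ _ (2 `^ 3)); last by rewrite powR_mulrn//; lra.
by rewrite ler_powR//; alra.
Qed.

Lemma kern_majorP (A v : R) h : 0 <= A -> `|v| <= A -> `|v| <= A * h ^+ 2 ->
  `|v * frac_kern h| <= A * kern_major h.
Proof.
move=> A0 v1 v2; rewrite normrM (ger0_norm (kern_ge0 h)) /kern_major mulrDr.
have [h1|h1] := leP `|h| 1.
  rewrite indic_in ?mul1r /=; last by rewrite in_itv/= -ler_norml.
  apply: (@le_trans _ _ (A * `|h| `^ (- a))).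
    apply: (@le_trans _ _ (A * h ^+ 2 * frac_kern h)); first by rewrite ler_wpM2r ?kern_ge0.
    by rewrite -mulrA ler_wpM2l// kern_sqr.
  by rewrite lerDl !mulr_ge0// powR_ge0.
rewrite indic_out; last by rewrite /= in_itv/= -ler_norml leNgt h1.
rewrite mul0r mulr0 add0r; apply: ler_pM => //; first exact: kern_ge0.
exact: kern_tail.
Qed.

(* The principal value, symmetrised so as to converge absolutely, without the
   constant C_s. *)
Definition frac_op phi x : R := 2^-1 * \int[mu]_h (diff2 phi x h * frac_kern h).

Lemma L1_diff2 phi x (A : R) : measurable_fun setT phi -> 0 <= A ->
  (forall h, `|diff2 phi x h| <= A) -> (forall h, `|diff2 phi x h| <= A * h ^+ 2) ->
  L1 mu (fun h => diff2 phi x h * frac_kern h).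
Proof.
move=> mphi A0 h1 h2; apply: (L1_le (L1Z A L1_kern_major)).
  by rewrite /diff2; have := measurable_kern; mfun.
by move=> h; apply: kern_majorP.
Qed.

(** For each truncation, the substitution y = x - h followed by averaging over h and - h turns the
    first difference into half of [diff2]; dominated convergence then removes the truncation. *)
Lemma frac_lapE (s : R) phi x (A : R) : a = 2 * s - 1 -> continuous phi ->
  (forall y, `|phi y| <= A) -> (forall h, `|diff2 phi x h| <= A * h ^+ 2) ->
  frac_lap s phi x = frac_lap_const s * frac_op phi x.
Proof.
move=> sa cphi phiA d2.
have A0 : 0 <= A := le_trans (normr_ge0 _) (phiA x).
rewrite /frac_lap; congr (_ * _); apply: cvg_lim => //.
have Di : L1 mu (fun h => diff2 phi x h * frac_kern h).
  apply: (@L1_diff2 _ _ (4 * A)) => //; first exact: continuous_measurable_fun.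
  - by rewrite mulr_ge0.
  - by move=> h; exact: diff2_bound0.
  - by move=> h; apply: (le_trans (d2 h)); rewrite ler_wpM2r ?sqr_ge0//; lra.
have mk := measurable_kern.
have trunc (e : R) : 0 < e -> \int[mu]_(y in [set y | (e < `|x - y|)%R])
      ((phi x - phi y) / `|x - y| `^ (1 + 2 * s)) =
    2^-1 * \int[mu]_h (\1_[set h : R | e < `|h|] h * (diff2 phi x h * frac_kern h)).
  move=> e0.
  pose g h := \1_[set h : R | e < `|h|] h * ((phi x - phi (x - h)) * frac_kern h).
  have gi : L1 mu g.
    (* Where [|h| > e] one has [d <= 1] and [d <= h^2], so the constant [2 A / d] serves for both
       bounds that [kern_majorP] asks for. *)
    pose d := Num.min 1 (e ^+ 2).
    have d0 : 0 < d by rewrite lt_min ltr01 exprn_gt0.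
    apply: (L1_le (L1Z (2 * A / d) L1_kern_major)); first by rewrite /g; mfun.
    move=> h; rewrite /g; have [eh|eh] := ltP e `|h|; last first.
      rewrite indic_out /= ?ltNge ?eh// mul0r normr0 mulr_ge0 ?kern_major_ge0//.
      by rewrite divr_ge0 ?mulr_ge0// ltW.
    rewrite indic_in// mul1r.
    have v1 : `|phi x - phi (x - h)| <= 2 * A.
      by apply: (le_trans (ler_normB _ _)); have := phiA x; have := phiA (x - h); lra.
    apply: kern_majorP; first by rewrite divr_ge0 ?mulr_ge0// ltW.
      apply: (le_trans v1); rewrite ler_pdivlMr// ler_piMr ?mulr_ge0//.
      by rewrite ge_min lexx.
    apply: (le_trans v1); rewrite -mulrA ler_peMr ?mulr_ge0// ler_pdivlMl// mulr1.
    rewrite ge_min; apply/orP; right.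
    by rewrite -[leRHS]real_normK ?num_real// lerXn2r ?nnegrE ?normr_ge0// ltW.
  rewrite int_indic.
  transitivity (\int[mu]_h g (x - h)).
    apply: eq_int => y; rewrite /g; have -> : x - (x - y) = y by ring.
    congr (_ * (_ * _)); rewrite /frac_kern powRN; congr (_^-1); congr (_ `^ _).
    by rewrite sa; ring.
  rewrite (int_refl x gi).
  have e2 : \int[mu]_h g h = \int[mu]_h g (- h).
    by rewrite -(int_refl 0 gi); apply: eq_int => h; rewrite sub0r.
  have giN : L1 mu (fun h => g (- h)).
    by move: (L1_refl 0 gi); apply: eq_L1 => h; rewrite sub0r.
  have -> : \int[mu]_h g h = 2^-1 * (\int[mu]_h g h + \int[mu]_h g (- h)).
    by rewrite -e2; field.
  rewrite -(intD gi giN); congr (_ * _); apply: eq_int => h.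
  rewrite /g kernN opprK.
  have -> : \1_[set h0 : R | e < `|h0|] (- h) = \1_[set h0 : R | e < `|h0|] h :> R.
    by rewrite !indicE; congr (nat_of_bool _)%:R; apply/idP/idP; rewrite !inE /= normrN.
  by rewrite /diff2; ring.
apply/cvg_at_rightP => u [u0 ucvg].
under eq_fun do rewrite trunc//.
apply: cvgMl_tmp.
apply: (@dct_all _ _ _ mu _ _ (fun h => `|diff2 phi x h * frac_kern h|) _ _ _ (L1_abs Di) _).2.
- by move=> n; rewrite /diff2; mfun.
- by rewrite /diff2; mfun.
- move=> h; have [->|h0] := eqVneq h 0.
    under eq_fun do rewrite diff2_0 mul0r mulr0.
    by rewrite diff2_0 mul0r; exact: cvg_cst.
  apply: cvg_near_cst; near=> n; rewrite indic_in ?mul1r//=.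
  near: n; have hp : 0 < `|h| by rewrite normr_gt0.
  exact: (cvgr_lt _ ucvg _ hp).
- move=> n h; rewrite normrM ger0_norm; last by rewrite indicE.
  by rewrite ler_piMl// indicE; case: (_ \in _).
Unshelve. all: end_near. Qed.

Lemma test_diff2 phi : test_function phi -> exists2 A : R, 0 < A &
  forall x h, `|diff2 phi x h| <= A /\ `|diff2 phi x h| <= A * h ^+ 2.
Proof.
move=> tp; have [B B0 hB] := test_bounded tp.
have [C C0 hC] := test_bounded (test_derive1 (test_derive1 tp)).
exists (4 * B + 2 * C) => [|x h]; first by lra.
split; first by apply: (le_trans (diff2_bound0 _ _ hB)); lra.
apply: (@le_trans _ _ (2 * C * h ^+ 2)).
  apply: (diff2_bound2 (f := phi) (f' := derive1 phi) (f'' := derive1 (derive1 phi))).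
  - by move=> z; apply: smooth_der; case: tp.
  - by move=> z _; apply: smooth_der; apply: smooth_derive1; case: tp.
  - by move=> z _; exact: hC.
by rewrite ler_wpM2r ?sqr_ge0//; lra.
Qed.

Lemma test_L1_diff2 phi x : test_function phi ->
  L1 mu (fun h => diff2 phi x h * frac_kern h).
Proof.
move=> tp; have [A A0 hA] := test_diff2 tp.
apply: (@L1_diff2 _ _ A); [|exact: ltW|..].
- by apply: continuous_measurable_fun; exact: test_continuous.
- by move=> h; have [] := hA x h.
- by move=> h; have [] := hA x h.
Qed.

Lemma test_frac_lapE (s : R) phi x : a = 2 * s - 1 -> test_function phi ->
  frac_lap s phi x = frac_lap_const s * frac_op phi x.
Proof.
move=> sa tp; have [A A0 hA] := test_diff2 tp.
have [B B0 hB] := test_bounded tp.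
apply: (@frac_lapE _ _ _ (A + B)) => //; first exact: test_continuous.
- by move=> y; apply: (le_trans (hB y)); lra.
- by move=> h; have [_ h2] := hA x h; apply: (le_trans h2); rewrite ler_wpM2r ?sqr_ge0//; lra.
Qed.

Definition incr2 phi h : R := \int[mu]_x (phi (x + h) - phi x) ^+ 2.

(** The squared Gagliardo seminorm of order [s = (1 + a) / 2], without its constant. *)
Definition energy phi : R := \int[mu]_h (incr2 phi h * frac_kern h).

(** For fixed h, translation invariance shows that the integral of [phi * diff2 phi _ h] is
    [incr2 phi h]; exchanging the integrals gives half of the energy. *)
Lemma test_fracD_energy phi : test_function phi ->
  [/\ L1 mu (fun h => incr2 phi h * frac_kern h),
      L1 mu (fun x => phi x * frac_op phi x) &
      \int[mu]_x (phi x * frac_op phi x) = 2^-1 * energy phi].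
Proof.
move=> tp; have cphi := test_continuous tp; have [A A0 hA] := test_diff2 tp.
have mk := measurable_kern.
have phii := test_L1 tp; have [B B0 hB] := test_bounded tp.
have Mi c : L1 mu (fun x => phi x * phi (x + c)).
  apply: (L1_bounded (k := B)) => //; last exact: L1_shift.
  exact: continuous_measurable_fun.
have M0 : L1 mu (fun x => phi x * phi x).
  by apply: (eq_L1 _ (Mi 0)) => x; rewrite addr0.
have ip : L1prod mu mu (fun x h => phi x * (diff2 phi x h * frac_kern h)).
  apply: (@L1prodP _ _ _ _ _ mu mu _ ( fun x => `|phi x| * (A * \int[mu]_h kern_major h))).
  - by rewrite /diff2; mfun.
  - by move=> x; apply: L1Z; exact: test_L1_diff2.
  - move=> x; have Dx := test_L1_diff2 x tp.
    have Ki := L1Z A L1_kern_major.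
    rewrite -intZ; last exact: L1_kern_major.
    rewrite -intZ//; apply: int_le; [by apply: L1_abs; exact: L1Z|exact: L1Z|].
    move=> h; rewrite normrM ler_wpM2l//; have [h1 h2] := hA x h.
    by apply: kern_majorP => //; exact: ltW.
  - by apply: L1Zr; exact: L1_abs.
have inner h : \int[mu]_x (phi x * (diff2 phi x h * frac_kern h)) = incr2 phi h * frac_kern h.
  have e1 : incr2 phi h = 2 * \int[mu]_x (phi x * phi x) - 2 * \int[mu]_x (phi x * phi (x + h)).
    rewrite -(intZ 2 M0) -(intZ 2 (Mi h)) -intB; [|exact: L1Z..].
    have s2 : L1 mu (fun x => phi (x + h) * phi (x + h)) by exact: (L1_shift h M0).
    transitivity (\int[mu]_x ((phi (x + h) * phi (x + h) + phi x * phi x) - 2 * (phi x * phi (x + h)))).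
      by apply: eq_int => x; ring.
    rewrite (intB (L1D s2 M0) (L1Z 2 (Mi h))).
    rewrite (intB (L1Z 2 M0) (L1Z 2 (Mi h))).
    by rewrite intD// (int_shift h M0) (intZ 2 M0); ring.
  have e2 : \int[mu]_x (phi x * phi (x - h)) = \int[mu]_x (phi x * phi (x + h)).
    rewrite -(int_shift h (Mi (- h))); apply: eq_int => x.
    by rewrite addrK mulrC.
  transitivity (frac_kern h * \int[mu]_x (phi x * diff2 phi x h)).
    rewrite -intZ; first by apply: eq_int => x; ring.
    have h3 := L1B (L1B (L1Z 2 M0) (Mi h)) (Mi (- h)).
    by apply: (eq_L1 _ h3) => x; rewrite /diff2; ring.
  rewrite mulrC; congr (_ * _); rewrite e1.
  transitivity (\int[mu]_x (2 * (phi x * phi x) - phi x * phi (x + h) - phi x * phi (x - h))).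
    by apply: eq_int => x; rewrite /diff2; ring.
  rewrite (intB (L1B (L1Z 2 M0) (Mi h)) (Mi (- h))) (intB (L1Z 2 M0) (Mi h)).
  by rewrite (intZ 2 M0) e2; ring.
have [i1 _] := L1prod_int1 ip; have [i2 _] := L1prod_int1 (L1prod_swap ip).
have e x : phi x * frac_op phi x = 2^-1 * \int[mu]_h (phi x * (diff2 phi x h * frac_kern h)).
  by rewrite intZ ?/frac_op; [ring|exact: test_L1_diff2].
split.
- by apply: (eq_L1 _ i2) => h; exact: inner.
- by apply: (eq_L1 _ (L1Z 2^-1 i1)) => x; rewrite e.
transitivity (\int[mu]_x (2^-1 * \int[mu]_h (phi x * (diff2 phi x h * frac_kern h)))).
  exact: eq_int.
rewrite (intZ 2^-1 i1); congr (_ * _).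
by rewrite (int_exchange _ _ _ ip); apply: eq_int => h; exact: inner.
Qed.

Lemma incr2_ge0 phi h : 0 <= incr2 phi h.
Proof. by apply: int_ge0 => x; exact: sqr_ge0. Qed.

Lemma energy_ge0 phi : 0 <= energy phi.
Proof. by apply: int_ge0 => h; rewrite mulr_ge0 ?incr2_ge0 ?kern_ge0. Qed.

Lemma lin_formE (s : R) (u : R -> R) phi : a = 2 * s - 1 -> test_function phi ->
  lin_form s u phi = frac_lap_const s / 2 * energy phi -
    \int[mu]_x (expR (u x) * phi x ^+ 2).
Proof.
move=> sa tp; rewrite /lin_form; congr (_ - _).
have [_ i e] := test_fracD_energy tp.
rewrite -mulrA -e -intZ//; apply: eq_int => x.
by rewrite (test_frac_lapE _ sa tp); ring.
Qed.

End fractional_kernel.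

(** * Algebra and scaling of the energy *)

Section energy_properties.
Context (R : realType) (a : R) (a0 : 0 < a) (a1 : a < 1).
Notation mu := (@lebesgue_measure R).
Notation kern := (@frac_kern R a).
Notation energy := (@energy R a).
Implicit Types (f g phi : R -> R) (x y h r : R).

Ltac alra := pose proof a0; pose proof a1; lra.

Lemma test_sqr_L1 phi : test_function phi -> L1 mu (fun x => phi x ^+ 2).
Proof.
move=> tp; have [sp _] := tp.
by apply: (eq_L1 _ (test_L1 (testM tp sp))) => x; rewrite expr2.
Qed.

Lemma test_shift phi h : test_function phi -> test_function (fun x => phi (x + h)).
Proof.
move=> /(test_affine h (oner_neq0 R)).
by under eq_fun do rewrite mul1r.
Qed.

Lemma testN phi : test_function phi -> test_function (fun x => - phi x).
Proof.
by move=> /(testZ (-1)); under eq_fun do rewrite mulN1r.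
Qed.

Lemma test_incr phi h : test_function phi ->
  test_function (fun x => phi (x + h) - phi x).
Proof. by move=> tp; apply: testD; [exact: test_shift|exact: testN]. Qed.

Lemma test_L1_incr2 phi h : test_function phi ->
  L1 mu (fun x => (phi (x + h) - phi x) ^+ 2).
Proof. by move=> tp; apply: test_sqr_L1; exact: test_incr. Qed.

Lemma test_L1_energy phi : test_function phi -> L1 mu (fun h => incr2 phi h * kern h).
Proof. by move=> tp; have [] := test_fracD_energy a0 a1 tp. Qed.

Lemma kernM r h : 0 < r -> kern (r * h) = r `^ (- (2 + a)) * kern h.
Proof. by move=> r0; rewrite /kern normrM (gtr0_norm r0) powRM// ltW. Qed.

Lemma energyZ c phi : test_function phi ->
  energy (fun x => c * phi x) = c ^+ 2 * energy phi.
Proof.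
move=> tp; rewrite /energy -(intZ _ (test_L1_energy tp)); apply: eq_int => h.
rewrite mulrA; congr (_ * _); rewrite /incr2 -(intZ _ (test_L1_incr2 h tp)).
by apply: eq_int => x; ring.
Qed.

Lemma energyD f g : test_function f -> test_function g ->
  energy (fun x => f x + g x) <= 2 * energy f + 2 * energy g.
Proof.
move=> tf tg; have Ef := L1Z 2 (test_L1_energy tf); have Eg := L1Z 2 (test_L1_energy tg).
rewrite [leRHS](_ : _ = \int[mu]_h (2 * (incr2 f h * kern h) + 2 * (incr2 g h * kern h))); last first.
  by rewrite (intD Ef Eg) (intZ 2 (test_L1_energy tf)) (intZ 2 (test_L1_energy tg)).
apply: int_le; [exact: test_L1_energy (testD tf tg)|exact: L1D Ef Eg|move=> h].
rewrite !mulrA -mulrDl ler_wpM2r ?kern_ge0//.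
have If := L1Z 2 (test_L1_incr2 h tf); have Ig := L1Z 2 (test_L1_incr2 h tg).
rewrite /incr2 -(intZ _ (test_L1_incr2 h tf)) -(intZ _ (test_L1_incr2 h tg)) -(intD If Ig).
apply: int_le; [exact: test_L1_incr2 (testD tf tg)|exact: L1D If Ig|move=> x].
have := sqr_ge0 ((f (x + h) - f x) - (g (x + h) - g x)); nra.
Qed.

Lemma energy_scale r phi : 0 < r -> test_function phi ->
  energy (fun x => phi (r^-1 * x)) = r `^ (- a) * energy phi.
Proof.
move=> r0 tp; have rV0 : r^-1 != 0 by rewrite invr_eq0 gt_eqF.
have rn0 : r != 0 by rewrite gt_eqF.
have nr : `|r^-1|^-1 = r by rewrite gtr0_norm ?invr_gt0// invrK.
have e1 h : incr2 (fun x => phi (r^-1 * x)) h = r * incr2 phi (r^-1 * h).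
  rewrite /incr2 -[X in X * _]nr -(int_affine 0 rV0 (test_L1_incr2 _ tp)).
  by apply: eq_int => x; rewrite addr0 mulrDr.
have e2 h : kern h = r `^ (- (2 + a)) * kern (r^-1 * h).
  by rewrite -kernM// mulrA divff// mul1r.
transitivity (\int[mu]_h (r * r `^ (- (2 + a)) * (incr2 phi (r^-1 * h) * kern (r^-1 * h)))).
  by apply: eq_int => h; rewrite e1 e2; ring.
have Li := L1_affine 0 rV0 (test_L1_energy tp).
have e3 := int_affine 0 rV0 (test_L1_energy tp).
have e4 : (fun h => incr2 phi (r^-1 * h) * kern (r^-1 * h)) =
  (fun h => incr2 phi (r^-1 * h + 0) * kern (r^-1 * h + 0)).
  by apply/funext => h; rewrite addr0.
rewrite intZ; last by rewrite e4.
rewrite e4 e3 nr -/(energy phi).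
have -> : - (2 + a) = - a - 2 by ring.
rewrite powRB; last by rewrite rn0 implybT.
have -> : r `^ 2 = r ^+ 2 by rewrite powR_mulrn// ltW.
by field.
Qed.

(** The product with the kernel is measurable by Fubini, and multiplying by [|h|^(2 + a)] undoes the
    kernel. At h = 0, where the kernel is 0 by convention, the increment vanishes too. *)
Lemma measurable_incr2 phi : test_function phi -> measurable_fun setT (incr2 phi).
Proof.
move=> tp; have mE := L1_measurable (test_L1_energy tp).
have -> : incr2 phi = (fun h => (incr2 phi h * kern h) * `|h| `^ (2 + a)).
  apply/funext => h; rewrite -mulrA.
  have [->|h0] := eqVneq h 0.
    rewrite [LHS](_ : _ = 0) ?[X in X * _](_ : _ = 0) ?mul0r//; rewrite /incr2;
    by rewrite -[RHS](int0 mu); apply: eq_int => x; rewrite addr0 subrr expr0n.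
  by rewrite /kern powRN mulVf ?mulr1// gt_eqF// powR_gt0// normr_gt0.
by mfun.
Qed.

Lemma int_incr2_ball phi r : 0 < r -> test_function phi ->
  L1 mu (fun h => \1_`[- r, r] h * incr2 phi h) /\
  \int[mu]_h (\1_`[- r, r] h * incr2 phi h) <= r `^ (2 + a) * energy phi.
Proof.
move=> r0 tp; have mi := measurable_incr2 tp; have Ei := test_L1_energy tp.
have b h : \1_`[- r, r] h * incr2 phi h <= r `^ (2 + a) * (incr2 phi h * kern h).
  have [->|h0] := eqVneq h 0.
    rewrite [X in _ * X](_ : _ = 0) ?mulr0; last first.
      by rewrite /incr2 -[RHS](int0 mu); apply: eq_int => x; rewrite addr0 subrr expr0n.
    by rewrite mulr_ge0 ?powR_ge0// mulr_ge0 ?incr2_ge0 ?kern_ge0.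
  have hp : 0 < `|h| by rewrite normr_gt0.
  rewrite mulrC mulrCA ler_wpM2l ?incr2_ge0//.
  have [hr|hr] := leP `|h| r; last first.
    rewrite indic_out; first by rewrite mulr_ge0 ?powR_ge0 ?kern_ge0.
    by rewrite /= in_itv/= -ler_norml leNgt hr.
  rewrite indic_in; last by rewrite /= in_itv/= -ler_norml.
  rewrite /kern powRN ler_pdivlMr ?powR_gt0// mul1r.
  by apply: ge0_ler_powR; rewrite ?nnegrE; alra.
have i1 : L1 mu (fun h => \1_`[- r, r] h * incr2 phi h).
  apply: (L1_le (L1Z (r `^ (2 + a)) Ei)); first by mfun.
  by move=> h; rewrite ger0_norm ?b// mulr_ge0 ?incr2_ge0// indicE.
split=> //; rewrite /energy -(intZ _ Ei); apply: int_le => //; exact: L1Z.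
Qed.

End energy_properties.

(** * Morrey's inequality *)

Lemma powR2_half_lt1 (R : realType) (a : R) : 0 < a -> 2 `^ (- (a / 2)) < 1 :> R.
Proof.
move=> a0; rewrite powRN invf_lt1 ?powR_gt0//.
have h : 1 `^ (a / 2) < 2 `^ (a / 2) :> R.
  by apply: gt0_ltr_powR; rewrite ?nnegrE; lra.
by rewrite powR1 in h.
Qed.

Lemma normr_young (R : realFieldType) (l d : R) :
  0 < l -> `|d| <= l / 2 * d ^+ 2 + l^-1 / 2.
Proof.
move=> l0; rewrite -(real_normK (num_real d)); move: `|d| => {}d.
have l1 : l * l^-1 = 1 by rewrite divff// gt_eqF.
have : 0 <= l^-1 * (l * d - 1) ^+ 2 by rewrite mulr_ge0 ?sqr_ge0// invr_ge0 ltW.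
have -> : l^-1 * (l * d - 1) ^+ 2 = (l * l^-1) * l * d ^+ 2 - 2 * (l * l^-1) * d + l^-1 by ring.
by rewrite l1; lra.
Qed.

Section morrey.
Context (R : realType) (a : R) (a0 : 0 < a) (a1 : a < 1).
Notation mu := (@lebesgue_measure R).
Notation energy := (@energy R a).
Implicit Types (x y h r p q : R).

Ltac alra := pose proof a0; pose proof a1; lra.

Variables (phi : R -> R) (tp : test_function phi).

Let av p r : R := r^-1 * \int[mu]_y (\1_`[p, p + r] y * phi y).

Let phii : L1 mu phi. Proof. exact: test_L1. Qed.

Let cphi : continuous phi. Proof. exact: test_continuous. Qed.

Let Iphi p r : L1 mu (fun y => \1_`[p, p + r] y * phi y).
Proof. by apply: L1_indicM. Qed.

Let I1 p r : 0 <= r -> L1 mu (fun y => \1_`[p, p + r] y).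
Proof. by move=> r0; have [] := @int_indic_itv R p (p + r) ltac:(lra). Qed.

Let I1E p r : 0 <= r -> \int[mu]_y \1_`[p, p + r] y = r.
Proof.
move=> r0; have [_ ->] := @int_indic_itv R p (p + r) ltac:(lra); ring.
Qed.

(* The free parameter l replaces the square root of the Cauchy-Schwarz
   inequality. *)
Lemma average_step p q r (l : R) : 0 < r -> 0 < l -> p <= q -> q + r / 2 <= p + r ->
  `|av p r - av q (r / 2)| <= l * (r `^ a * energy phi) + l^-1 / 2.
Proof.
move=> r0 l0 pq qp; have [B B0 hB] := test_bounded tp.
(* W selects the pairs with y in the half interval and y + h in the whole one, which forces
   [|h| <= r]. The double integral of the increments weighted by W is [r^2 / 2] times the difference
   of the two averages. *)
pose W y h : R := \1_`[p, p + r] (y + h) * \1_`[q, q + r / 2] y.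
pose G y h : R := W y h * (phi (y + h) - phi y).
have r2 : 0 <= r / 2 by lra.
have ind0 (A : set R) x : (0 : R) <= \1_A x by rewrite indicE.
have W0 y h : 0 <= W y h by rewrite mulr_ge0.
have mI : measurable_fun setT (\1_`[p, p + r] : R -> R) by mfun.
have mJ : measurable_fun setT (\1_`[q, q + r / 2] : R -> R) by mfun.
have Wy y : L1 mu (W y).
  apply: L1Zr; apply: (eq_L1 _ (L1_shift y (I1 p (ltW r0)))) => h.
  by rewrite (addrC h).
have WyE y : \int[mu]_h W y h = r * \1_`[q, q + r / 2] y.
  rewrite -[X in X * _](I1E p (ltW r0)) -(int_shift y (I1 p (ltW r0))) -intZr.
    by apply: eq_int => h; rewrite /W (addrC h).
  exact: L1_shift (I1 p (ltW r0)).
have Wp : L1prod mu mu W.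
  apply: (@L1prodP _ _ _ _ _ mu mu W (fun y => r * \1_`[q, q + r / 2] y)) => //.
  - by rewrite /W; mfun.
  - move=> y; rewrite -WyE le_eqVlt; apply/orP; left; apply/eqP.
    by apply: eq_int => h; rewrite ger0_norm.
  - by apply: L1Z; exact: I1.
have Gp : L1prod mu mu G.
  apply: (L1_le (L1Z (2 * B) Wp)); first by rewrite /G /W; mfun.
  move=> z; rewrite /G normrM (ger0_norm (W0 _ _)) mulrC ler_wpM2r//.
  by apply: (le_trans (ler_normB _ _)); rewrite mulr_natl mulr2n lerD.
have WE : \int[mu]_h \int[mu]_y W y h = r * (r / 2).
  rewrite -(int_exchange mu mu W Wp).
  by rewrite (eq_int mu WyE) (intZ _ (I1 q r2)) I1E.
have GE : \int[mu]_h \int[mu]_y G y h = r ^+ 2 / 2 * (av p r - av q (r / 2)).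
  rewrite -(int_exchange mu mu G Gp).
  have GyE y : \int[mu]_h G y h = (\int[mu]_y (\1_`[p, p + r] y * phi y)) * \1_`[q, q + r / 2] y -
      r * (\1_`[q, q + r / 2] y * phi y).
    rewrite mulrA -WyE -(int_shift y (Iphi p r)).
    rewrite -(intZr _ (L1_shift y (Iphi p r))) -(intZr _ (Wy y)).
    rewrite -(intB (L1Zr _ (L1_shift y (Iphi p r))) (L1Zr _ (Wy y))).
    by apply: eq_int => h; rewrite /G /W (addrC h y); ring.
  rewrite (eq_int mu GyE) (intB (L1Z _ (I1 q r2)) (L1Z r (Iphi q (r / 2)))).
  rewrite (intZ _ (I1 q r2)) (intZ _ (Iphi q (r / 2))) I1E// /av.
  by field; rewrite gt_eqF.
have [Bi Bl] := int_incr2_ball a0 a1 r0 tp.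
have [Gh _] := L1prod_int1 (L1prod_swap Gp).
have [Wh _] := L1prod_int1 (L1prod_swap Wp).
have sup y h : W y h != 0 -> - r <= h <= r.
  rewrite /W mulf_eq0 negb_or => /andP[]; rewrite !indicE.
  case: (boolP (_ \in _)); rewrite ?eqxx// inE/= in_itv/= => /andP[h1 h2] _.
  case: (boolP (_ \in _)); rewrite ?eqxx// inE/= in_itv/= => /andP[h3 h4] _.
  by apply/andP; clear -pq qp h1 h2 h3 h4; split; lra.
have W1 y h : W y h <= 1.
  by rewrite mulr_ile1// indicE; case: (_ \in _).
have bound h : `|\int[mu]_y G y h| <=
    l / 2 * (\1_`[- r, r] h * incr2 phi h) + l^-1 / 2 * \int[mu]_y W y h.
  have Wmeas : measurable_fun setT (fun y => W y h) by rewrite /W; mfun.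
  have Gmeas : measurable_fun setT (fun y => G y h) by rewrite /G; mfun.
  have WI : L1 mu (fun y => W y h).
    apply: (L1_le (I1 q r2)) => // y; rewrite ger0_norm// /W -[leRHS]mul1r.
    by rewrite ler_wpM2r// indicE; case: (_ \in _).
  have GI : L1 mu (fun y => G y h).
    apply: (L1_le (L1Z (2 * B) WI)) => // y.
    rewrite /G normrM (ger0_norm (W0 _ _)) mulrC ler_wpM2r//.
    by apply: (le_trans (ler_normB _ _)); rewrite mulr_natl mulr2n lerD.
  have Si := L1Z (\1_`[- r, r] h) (test_L1_incr2 h tp).
  rewrite /incr2 -(intZ _ (test_L1_incr2 h tp)) -(intZ _ Si) -(intZ _ WI).
  rewrite -(intD (L1Z (l / 2) Si) (L1Z (l^-1 / 2) WI)).
  apply: int_abs_le_bound => //; first exact: L1D (L1Z (l / 2) Si) (L1Z (l^-1 / 2) WI).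
  move=> y; rewrite /G normrM (ger0_norm (W0 _ _)).
  have [->|Wn] := eqVneq (W y h) 0.
    rewrite mul0r mulr0 addr0; apply: mulr_ge0; first by rewrite divr_ge0// ltW.
    by apply: mulr_ge0 => //; exact: sqr_ge0.
  rewrite indic_in ?mul1r; last by rewrite /= in_itv/=; exact: sup Wn.
  set D := phi (y + h) - phi y.
  apply: (@le_trans _ _ (W y h * (l / 2 * D ^+ 2 + l^-1 / 2))).
    by rewrite ler_wpM2l// normr_young.
  rewrite mulrDr (mulrC (W y h) (l^-1 / 2)) lerD2r ler_piMl// mulr_ge0 ?sqr_ge0// divr_ge0 ?(ltW l0)//.
have main : `|\int[mu]_h \int[mu]_y G y h| <=
    l / 2 * (r `^ (2 + a) * energy phi) + l^-1 / 2 * (r * (r / 2)).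
  have bi := L1D (L1Z (l / 2) Bi) (L1Z (l^-1 / 2) Wh).
  apply: (le_trans (int_abs_le_bound Gh bi bound)).
  rewrite (intD (L1Z (l / 2) Bi) (L1Z (l^-1 / 2) Wh)) (intZ _ Bi) (intZ _ Wh) WE lerD2r.
  by rewrite ler_wpM2l// divr_ge0 ?(ltW l0)//.
move: main; rewrite GE normrM ger0_norm; last by rewrite divr_ge0 ?sqr_ge0.
rewrite powRD; last by rewrite (gt_eqF r0) implybT.
rewrite (powR_mulrn 2 (ltW r0)) => main.
rewrite -(ler_pM2l (_ : 0 < r ^+ 2 / 2)); last by rewrite divr_gt0// exprn_gt0.
by apply: (le_trans main); rewrite le_eqVlt; apply/orP; left; apply/eqP; ring.
Qed.

Let qq : R := 2 `^ (- (a / 2)).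

Let qq0 : 0 < qq. Proof. exact: powR_gt0. Qed.

Let qq1 : qq < 1. Proof. exact: powR2_half_lt1. Qed.

Lemma average_chain (p : nat -> R) r (t : R) k : 0 < r -> 0 < t ->
  (forall k, p k <= p k.+1 /\ p k.+1 + r / 2 ^+ k.+1 <= p k + r / 2 ^+ k) ->
  `|av (p 0%N) r - av (p k) (r / 2 ^+ k)| <=
  (energy phi / t + t) * r `^ (a / 2) * ((1 - qq ^+ k) / (1 - qq)).
Proof.
move=> r0 t0 hp; have q1 : 1 - qq != 0 by rewrite subr_eq0 (gt_eqF qq1).
have E0 := energy_ge0 a phi.
elim: k => [|k ih]; first by rewrite !expr0 divr1 !subrr normr0 mul0r mulr0.
set rk := r / 2 ^+ k.
have rk0 : 0 < rk by rewrite divr_gt0// exprn_gt0.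
have rkS : r / 2 ^+ k.+1 = rk / 2 by rewrite /rk exprS; field; rewrite expf_neq0.
have rkE : rk `^ (a / 2) = r `^ (a / 2) * qq ^+ k.
  rewrite /rk powRM ?(ltW r0) ?invr_ge0 ?exprn_ge0//; congr (_ * _).
  rewrite -(@powR_invn R 2 k (ler0n R 2)) -powRrM.
  by rewrite -(@powR_mulrn R qq k (ltW qq0)) /qq -powRrM; congr (_ `^ _); ring.
have [h1 h2] := hp k; rewrite rkS in h2.
(* With this l both terms of [average_step] are multiples of the power a / 2 of [rk], so the errors
   of successive halvings form a geometric series of ratio [qq]. *)
pose l := rk `^ (- (a / 2)) / t.
have l0 : 0 < l by rewrite divr_gt0// powR_gt0.
have := average_step rk0 l0 h1 h2; rewrite -rkS => st.
have st2 : l * (rk `^ a * energy phi) + l^-1 / 2 <=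
    (energy phi / t + t) * (r `^ (a / 2) * qq ^+ k).
  rewrite -rkE /l invfM invrK -powRN opprK.
  have -> : rk `^ a = rk `^ (a / 2) * rk `^ (a / 2).
    by rewrite -powRD ?(gt_eqF rk0) ?implybT//; congr (_ `^ _); field.
  have -> : rk `^ (- (a / 2)) = (rk `^ (a / 2))^-1 by rewrite powRN.
  set X := rk `^ (a / 2); have X0 : 0 < X by rewrite powR_gt0.
  have -> : X^-1 / t * (X * X * energy phi) = energy phi / t * X.
    by field; rewrite !gt_eqF.
  by rewrite mulrDl lerD2l; nra.
have := ler_normD (av (p 0%N) r - av (p k) rk) (av (p k) rk - av (p k.+1) (r / 2 ^+ k.+1)).
rewrite addrA subrK => tri; apply: (le_trans tri).
apply: (le_trans (lerD ih (le_trans st st2))).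
rewrite le_eqVlt; apply/orP; left; apply/eqP; rewrite exprS; field; rewrite ?q1 ?(gt_eqF t0)//.
Qed.

(** The bound on the derivative only identifies the limit of the averages over shrinking intervals;
    its constant C disappears in that limit and leaves no trace in Morrey's inequality. *)
Lemma average_point p r x (C : R) : 0 < r -> (forall y, `|derive1 phi y| <= C) ->
  p <= x <= p + r -> `|av p r - phi x| <= C * r.
Proof.
move=> r0 hC /andP[px xp].
have e : av p r - phi x = r^-1 * \int[mu]_y (\1_`[p, p + r] y * (phi y - phi x)).
  have -> : \int[mu]_y (\1_`[p, p + r] y * (phi y - phi x)) =
      \int[mu]_y (\1_`[p, p + r] y * phi y) - r * phi x.
    rewrite -[X in X * phi x](I1E p (ltW r0)) -(intZr _ (I1 p (ltW r0))).
    rewrite -(intB (Iphi p r) (L1Zr _ (I1 p (ltW r0)))).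
    by apply: eq_int => y; rewrite mulrBr.
  by rewrite /av; field; rewrite gt_eqF.
rewrite e normrM gtr0_norm ?invr_gt0// ler_pdivrMl// mulrCA.
have ii : L1 mu (fun y => \1_`[p, p + r] y * (phi y - phi x)).
  have := L1B (Iphi p r) (L1Zr (phi x) (I1 p (ltW r0))).
  by apply: eq_L1 => y; rewrite mulrBr.
rewrite mulrA -[X in _ <= _ * X](I1E p (ltW r0)) -(intZ _ (I1 p (ltW r0))).
apply: int_abs_le_bound => //; first exact: L1Z (I1 p (ltW r0)).
move=> y; have [yp|yp] := pselect (`[p, p + r]%classic y); last first.
  by rewrite indic_out// mul0r normr0 mulr0.
rewrite indic_in// mul1r mulr1; move: yp; rewrite /= in_itv/= => /andP[py yp].
apply: (@le_trans _ _ (C * `|y - x|)).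
  apply: (mvt_bound (f' := derive1 phi)) => // z _.
  by apply: smooth_der; case: tp.
rewrite ler_wpM2l ?ler_norml//; first exact: le_trans (normr_ge0 _) (hC x).
by apply/andP; split; lra.
Qed.

Lemma average_endpoint (p : nat -> R) r (t : R) x : 0 < r -> 0 < t ->
  (forall k, p k <= p k.+1 /\ p k.+1 + r / 2 ^+ k.+1 <= p k + r / 2 ^+ k) ->
  (forall k, p k <= x <= p k + r / 2 ^+ k) ->
  `|av (p 0%N) r - phi x| <= (energy phi / t + t) * r `^ (a / 2) / (1 - qq).
Proof.
move=> r0 t0 hp hx; have [C C0 hC] := test_bounded (test_derive1 tp).
have q1 : 0 < 1 - qq by rewrite subr_gt0 qq1.
have E0 := energy_ge0 a phi.
have B0 : 0 <= (energy phi / t + t) * r `^ (a / 2).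
  by rewrite mulr_ge0 ?powR_ge0// addr_ge0 ?divr_ge0// ltW.
set Bd := (energy phi / t + t) * r `^ (a / 2) in B0 *.
pose f (k : nat) := Bd / (1 - qq) + geometric (C * r) (2^-1) k.
have fc : f k @[k --> \oo] --> Bd / (1 - qq) + 0.
  apply: cvgD; first exact: cvg_cst.
  by apply: cvg_geometric; rewrite ger0_norm; lra.
rewrite -[leRHS]addr0; apply: (cvgr_to_ge fc); apply: nearW => k.
have rk0 : 0 < r / 2 ^+ k by rewrite divr_gt0// exprn_gt0.
have h1 := average_chain k r0 t0 hp; have h2 := average_point rk0 hC (hx k).
have := ler_normD (av (p 0%N) r - av (p k) (r / 2 ^+ k)) (av (p k) (r / 2 ^+ k) - phi x).
rewrite addrA subrK => tri; apply: (le_trans tri); rewrite /f /geometric /=.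
apply: lerD; last by rewrite exprVn -mulrA.
apply: (le_trans h1); rewrite -/Bd ler_wpM2l// ler_piMl ?invr_ge0 ?(ltW q1)//.
by rewrite lerBlDr lerDl exprn_ge0// ltW.
Qed.

Lemma morrey_param x r (t : R) : 0 < r -> 0 < t ->
  `|phi x - phi (x + r)| <= (energy phi / t + t) * (2 * r `^ (a / 2) / (1 - qq)).
Proof.
move=> r0 t0.
have h1 : `|av x r - phi x| <= (energy phi / t + t) * r `^ (a / 2) / (1 - qq).
  apply: (@average_endpoint (fun=> x)) => // k.
    split; first exact: lexx.
    by rewrite lerD2l ler_pM2l// lef_pV2 ?posrE ?exprn_gt0// exprS ler_peMl ?exprn_ge0// ler1n.
  by rewrite lexx lerDl divr_ge0 ?exprn_ge0// ltW.
have h2 : `|av x r - phi (x + r)| <= (energy phi / t + t) * r `^ (a / 2) / (1 - qq).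
  (* These intervals keep their right endpoint x + r, those before kept the left endpoint x. Both
     chains start from the average over the same interval. *)
  have := @average_endpoint (fun k => x + (r - r / 2 ^+ k)) r t (x + r) r0 t0.
  rewrite expr0 divr1 subrr addr0; apply => k.
    have hk : r / 2 ^+ k.+1 <= r / 2 ^+ k.
      by rewrite ler_pM2l// lef_pV2 ?posrE ?exprn_gt0// exprS ler_peMl ?exprn_ge0// ler1n.
    by split; lra.
  have hk : 0 <= r / 2 ^+ k by rewrite divr_ge0 ?exprn_ge0// ltW.
  by apply/andP; split; lra.
have := ler_normD (phi x - av x r) (av x r - phi (x + r)).
rewrite addrA subrK (distrC (phi x) (av x r)); move: h1 h2; set X := _ / (1 - qq).
have -> : (energy phi / t + t) * (2 * r `^ (a / 2) / (1 - qq)) = 2 * X.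
  by rewrite /X; ring.
lra.
Qed.

End morrey.

Lemma morrey (R : realType) (a : R) : 0 < a -> a < 1 ->
  exists2 K : R, 0 < K & forall (phi : R -> R) (x y : R), test_function phi ->
    (phi x - phi y) ^+ 2 <= K * `|x - y| `^ a * energy a phi.
Proof.
move=> a0 a1; pose q : R := 2 `^ (- (a / 2)).
have q1 : 0 < 1 - q by rewrite subr_gt0 powR2_half_lt1.
exists (16 / (1 - q) ^+ 2); first by rewrite divr_gt0// exprn_gt0.
move=> phi.
have main (x r : R) : 0 < r -> test_function phi ->
    (phi x - phi (x + r)) ^+ 2 <= 16 / (1 - q) ^+ 2 * r `^ a * energy a phi.
  move=> r0 tp; pose c := 2 * r `^ (a / 2) / (1 - q).
  have c0 : 0 < c by rewrite divr_gt0// mulr_gt0// powR_gt0.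
  set D := `|phi x - phi (x + r)|.
  have E0 := energy_ge0 a phi.
  have e : 16 / (1 - q) ^+ 2 * r `^ a * energy a phi = 4 * c ^+ 2 * energy a phi.
    have -> : r `^ a = r `^ (a / 2) ^+ 2.
      by rewrite -powR_mulrn ?powR_ge0// -powRrM; congr (_ `^ _); field.
    by rewrite /c; field; rewrite gt_eqF.
  rewrite e -(real_normK (num_real (phi x - phi (x + r)))) -/D.
  have [D0|D0] := leP D 0.
    have -> : D = 0 by apply/eqP; rewrite eq_le D0 normr_ge0.
    rewrite expr0n/=; apply: mulr_ge0 => //; apply: mulr_ge0 => //; exact: sqr_ge0.
  (* For [t = D / (2 c)] the bound reads [D <= 2 c^2 E / D + D / 2], with E the energy, and half of
     D is absorbed on the left. *)
  have t0 : 0 < D / (2 * c) by rewrite divr_gt0// mulr_gt0.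
  have := morrey_param a0 a1 tp x r0 t0; rewrite -/D -/q -/c => h.
  have h2 : D <= 2 * c ^+ 2 * energy a phi / D + D / 2.
    apply: (le_trans h); rewrite le_eqVlt; apply/orP; left; apply/eqP.
    by field; rewrite !gt_eqF.
  have h3 : D / 2 <= 2 * c ^+ 2 * energy a phi / D by lra.
  move: h3; rewrite ler_pdivlMr// => h3.
  by rewrite expr2; lra.
move=> x y tp; have [xy|yx|->] := ltgtP x y.
- have := @main x (y - x) ltac:(lra) tp.
  by rewrite addrCA subrr addr0 ltr0_norm ?subr_lt0// opprB.
- have := @main y (x - y) ltac:(lra) tp.
  by rewrite addrCA subrr addr0 -sqrrN opprB gtr0_norm ?subr_gt0.
- have h := powR_ge0 `|y - y| a.
  rewrite subrr expr0n/= !mulr_ge0 ?energy_ge0 ?powR_ge0 ?invr_ge0 ?sqr_ge0//.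
Qed.

(** * Stability and Morse index *)

Section frac_lap_const_gt0.
Context (R : realType).
Notation mu := (@lebesgue_measure R).

Lemma euler_integral_gt0 (x : R) : 0 < x -> x < 2 -> 0 < euler_integral x.
Proof.
move=> x0 x2; rewrite /euler_integral int_indic.
pose F (t : R) : R := \1_`]0, +oo[ t * (t `^ (x - 1) * expR (- t)).
have F0 t : 0 <= F t by rewrite !mulr_ge0 ?powR_ge0 ?expR_ge0// indicE.
(* The exponent [x - 1] may be nonnegative; on (0, 1] the power is bounded by the one with exponent
   [x / 2 - 1], which always lies strictly between -1 and 0. *)
have bx : 0 < 1 - x / 2 < 1 by apply/andP; split; lra.
have Fi : L1 mu F.
  have i1 := L1_powR_near0 bx.
  have i2 := @L1_powR_infty R 2 ltac:(lra).
  apply: (L1_le (L1D i1 (L1Z 108 i2))); first by rewrite /F; mfun.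
  move=> t; rewrite ger0_norm// /F.
  have [t0|t0] := ltP 0 t; last first.
    rewrite indic_out; last by rewrite /= in_itv/= andbT ltNge t0.
    by rewrite mul0r addr_ge0// ?mulr_ge0 ?powR_ge0// indicE.
  rewrite indic_in; last by rewrite /= in_itv/= andbT.
  rewrite mul1r (gtr0_norm t0).
  have [t1|t1] := leP t 1.
    rewrite indic_in; last by rewrite /= in_itv/=; apply/andP; split; lra.
    rewrite mul1r ler_wpDr ?mulr_ge0 ?powR_ge0//.
    apply: (@le_trans _ _ (t `^ (x - 1))).
      by rewrite ler_piMr ?powR_ge0// -expR0 ler_expR; lra.
    by apply: ger_powR; [rewrite t0 t1|lra].
  rewrite ler_wpDl ?mulr_ge0 ?powR_ge0 ?indicE//.
  rewrite powR_invn; last by lra.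
  have tx : t `^ (x - 1) <= t.
    rewrite -[leRHS](powRr1 (ltW t0)); apply: ler_powR; lra.
  (* Here t > 1, so [t (1 + t)^2 <= 4 t^3 = 108 (t / 3)^3 <= 108 exp t]; this is the origin of
     108. *)
  have e3 : (t / 3) ^+ 3 <= expR t.
    have -> : expR t = expR (t / 3) ^+ 3.
      by rewrite -expRM_natl; congr expR; field.
    rewrite lerXn2r ?nnegrE ?expR_ge0 ?divr_ge0//; first by lra.
    by apply: le_trans (expR_ge1Dx _); lra.
  rewrite expRN ler_pdivrMr ?expR_gt0// mulrAC ler_pdivlMr ?exprn_gt0//; last by lra.
  apply: (@le_trans _ _ (t * (1 + t) ^+ 2)); first by rewrite ler_wpM2r ?sqr_ge0.
  apply: (@le_trans _ _ (108 * (t / 3) ^+ 3)); last by rewrite ler_wpM2l.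
  have -> : 108 * (t / 3) ^+ 3 = 4 * t ^+ 3 by field.
  have -> : 4 * t ^+ 3 = t * (4 * t ^+ 2) by ring.
  rewrite ler_wpM2l ?(ltW t0)//; nra.
apply: (@int_gt0 R F 1 Fi F0).
  have d : derat 1 F (1 * ((x - 1) * 1 `^ (x - 1 - 1)) * expR (- 1) + 1 `^ (x - 1) * (-1 * expR (- 1))).
    apply: (@der_near _ (fun t => t `^ (x - 1) * expR (- t))).
      apply: derM; first by der; lra.
      by apply: der_expR; apply: derN; exact: der_id.
    near=> t; rewrite /F indic_in ?mul1r//= in_itv/= andbT; near: t.
    exact: lt_nbhsr.
  exact: der_cont d.
rewrite /F indic_in ?mul1r; last by rewrite /= in_itv/= andbT.
by rewrite powR1 mul1r expR_gt0.
Unshelve. all: end_near. Qed.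

Lemma frac_lap_const_gt0 (s : R) : 2^-1 < s -> s < 1 -> 0 < frac_lap_const s.
Proof.
move=> s0 s1; rewrite /frac_lap_const mulr_gt0//.
  by rewrite divr_gt0 ?powR_gt0// sqrtr_gt0 pi_gt0.
rewrite divr_gt0//.
  rewrite /Gamma ifT; last by lra.
  by apply: euler_integral_gt0; lra.
rewrite normr_gt0 /Gamma ifF; last by apply/negbTE; rewrite -leNgt; lra.
(* As [- s] lies between -1 and 0, one step of the functional equation suffices: [Gamma (- s)] is
   [euler_integral (1 - s) / (- s)]. *)
have -> : Num.truncn (- - s) = 0%N.
  by apply: truncn_def; rewrite opprK; apply/andP; split; lra.
rewrite big_ord1 /= addr0 mulf_neq0// ?invr_eq0 ?oppr_eq0; last by rewrite gt_eqF//; lra.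
by rewrite gt_eqF//; apply: euler_integral_gt0; lra.
Qed.

End frac_lap_const_gt0.

(** * Spectral bounds on the linearized form, and integrability from stability *)

Section morse.
Context (R : realType) (s : R) (s0 : 2^-1 < s) (s1 : s < 1).
Notation mu := (@lebesgue_measure R).
Implicit Types (u phi : R -> R) (x y r : R).

Notation a := (2 * s - 1).

Let a0 : 0 < a. Proof. by pose proof s0; lra. Qed.
Let a1 : a < 1. Proof. by pose proof s1; lra. Qed.

Ltac alra := pose proof a0; pose proof a1; lra.

Let Cs : R := frac_lap_const s.
Let Cs0 : 0 < Cs. Proof. exact: frac_lap_const_gt0. Qed.

Lemma locally_integrable_L1 (f : R -> R) r : locally_integrable setT f ->
  L1 mu (fun x => \1_`[- r, r] x * f x).
Proof.
move=> [mf _ hf]; apply/(@L1_indicP R `[- r, r]%classic f (measurable_itv _)).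
apply/integrableP; split.
  by apply/measurable_EFinP; apply: measurable_funS mf.
exact: hf (@segment_compact _ _ _).
Qed.

Lemma locally_integrableM (f phi : R -> R) : locally_integrable setT f ->
  test_function phi -> L1 mu (fun x => f x * phi x).
Proof.
move=> lf tp; have [B B0 hB] := test_bounded tp; have cphi := test_continuous tp.
move/test_functionP : tp => [_ [T T0 p0]].
have i := locally_integrable_L1 T lf.
have := @L1_bounded _ _ _ mu B phi _ hB (continuous_measurable_fun cphi) i.
apply: eq_L1 => x; have [xT|xT] := leP `|x| T.
  by rewrite indic_in ?mul1r 1?mulrC//= in_itv/= -ler_norml.
by rewrite p0// mul0r mulr0.
Qed.

Lemma locally_integrable_sqr u phi : locally_integrable setT (fun x => expR (u x)) ->
  test_function phi -> L1 mu (fun x => expR (u x) * phi x ^+ 2).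
Proof.
move=> lf tp; have [sp _] := tp.
apply: (eq_L1 _ (locally_integrableM lf (testM tp sp))) => x.
by rewrite expr2.
Qed.

Lemma lin_form_eq u phi : test_function phi ->
  lin_form s u phi = Cs / 2 * energy a phi - \int[mu]_x (expR (u x) * phi x ^+ 2).
Proof. by move=> tp; rewrite (lin_formE a0 a1 u erefl tp). Qed.

(** Shared by stability outside a ball and by finiteness of the index. In both uses g bounds the
    a-th power of the distance to a zero of phi wherever phi is nonzero, so Morrey's inequality
    supplies the pointwise hypothesis. *)
Lemma lin_form_ge0 u phi (g : R -> R) (K : R) : test_function phi ->
  L1 mu (fun x => expR (u x) * phi x ^+ 2) ->
  L1 mu (fun x => expR (u x) * g x) ->
  (forall x, phi x ^+ 2 <= K * g x * energy a phi) ->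
  K * \int[mu]_x (expR (u x) * g x) <= Cs / 2 -> 0 <= lin_form s u phi.
Proof.
move=> tp pi gi pg hK; rewrite lin_form_eq// subr_ge0.
apply: (@le_trans _ _ (\int[mu]_x (K * energy a phi * (expR (u x) * g x)))).
  apply: int_le => //; first exact: L1Z gi.
  by move=> x; rewrite [leRHS]mulrCA ler_wpM2l ?expR_ge0// mulrAC.
rewrite (intZ _ gi) mulrAC ler_wpM2r//; exact: energy_ge0.
Qed.

Definition weighted_mass u := L1 mu (fun x => expR (u x)) /\
  L1 mu (fun x => expR (u x) * `|x| `^ a).

Lemma sqr_L1_bounded u phi : measurable_fun setT u -> L1 mu (fun x => expR (u x)) ->
  test_function phi -> L1 mu (fun x => expR (u x) * phi x ^+ 2).
Proof.
move=> mu_ ui tp; have [B B0 hB] := test_bounded tp.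
have cphi := test_continuous tp.
apply: (L1_le (L1Z (B ^+ 2) ui)); first by mfun.
move=> x; rewrite (ger0_norm (mulr_ge0 (expR_ge0 _) (sqr_ge0 _))) mulrC.
rewrite ler_wpM2r ?expR_ge0//.
by rewrite -(real_normK (num_real (phi x))) lerXn2r ?nnegrE ?normr_ge0 ?(ltW B0)//.
Qed.

(* A test function vanishing near 0 satisfies phi(x)^2 <= K |x|^a E(phi), so only
   the tail of e^u |x|^a matters. *)
Lemma stable_outside_ball u : measurable_fun setT u -> weighted_mass u ->
  exists n : nat, stable_outside s u `[- n%:R, n%:R].
Proof.
move=> mu_ [ui wi]; have [K K0 hK] := morrey a0 a1.
have e0 : 0 < Cs / 2 / K by rewrite !divr_gt0// Cs0.
have [n hn] := int_tail wi e0; exists n => phi tp sp.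
pose g x : R := \1_[set y : R | n%:R < `|y|] x * `|x| `^ a.
have gE x : \1_[set y : R | n%:R < `|y|] x * `|expR (u x) * `|x| `^ a| = expR (u x) * g x.
  by rewrite ger0_norm ?mulr_ge0 ?expR_ge0 ?powR_ge0// /g mulrCA.
have gi : L1 mu (fun x => expR (u x) * g x).
  apply: (L1_le wi); first by rewrite /g; mfun.
  move=> x; rewrite normrM (gtr0_norm (expR_gt0 _)) ler_wpM2l ?expR_ge0// /g normrM.
  rewrite [X in _ * X]ger0_norm ?powR_ge0// ler_piMl ?powR_ge0//.
  by rewrite indicE; case: (_ \in _); rewrite ?normr1 ?normr0.
apply: (@lin_form_ge0 u phi g K) => //; first exact: sqr_L1_bounded.
  move=> x; have [xn|xn] := ltP n%:R `|x|; last first.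
    have -> : phi x = 0.
      apply/eqP; apply: contraT => px; have : tsupport phi x by apply: subset_closure.
      by move/sp; rewrite /= in_itv/= -ler_norml xn.
    rewrite expr0n/= !mulr_ge0 ?energy_ge0 ?powR_ge0 ?(ltW K0)// indicE//.
  have p0 : phi 0 = 0.
    apply/eqP; apply: contraT => px; have : tsupport phi 0 by apply: subset_closure.
    by move/sp; rewrite /= in_itv/= -ler_norml normr0 ler0n.
  have := hK phi x 0 tp; rewrite p0 !subr0 /g indic_in ?mul1r//.
rewrite -(eq_int mu gE); move: hn; rewrite ltr_pdivlMr// mulrC; exact: ltW.
Qed.

(* The points j/n, |j| <= n^2: the distance of x to the nearest one is at most
   1/n if |x| <= n and at most |x| otherwise. *)
Let grid (n : nat) (j : 'I_((n.+1 ^ 2).*2.+1)) : R :=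
  (j%:R - (n.+1 ^ 2)%:R) / n.+1%:R.

Let grid_dist (n : nat) x : R :=
  \1_[set y : R | `|y| <= n.+1%:R] x * (n.+1%:R^-1) `^ a +
  \1_[set y : R | n.+1%:R < `|y|] x * `|x| `^ a.

Lemma near_grid n x : exists j : 'I_((n.+1 ^ 2).*2.+1),
  `|x - grid j| `^ a <= grid_dist n x.
Proof.
have n0 : 0 < n.+1%:R :> R by rewrite ltr0n.
rewrite /grid_dist; have [xn|xn] := leP `|x| n.+1%:R; last first.
  (* The middle index is the grid point 0, at distance [|x|] from x. *)
  have h : (n.+1 ^ 2 < (n.+1 ^ 2).*2.+1)%N by rewrite -addnn ltnS leq_addr.
  exists (Ordinal h); rewrite /grid /= subrr mul0r subr0.
  rewrite (@indic_out _ _ x); last by rewrite /= leNgt xn.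
  by rewrite indic_in// mul0r add0r mul1r.
have x1 : - n.+1%:R <= x <= n.+1%:R by rewrite -ler_norml.
case/andP: x1 => x1 x2.
pose y := x * n.+1%:R + (n.+1 ^ 2)%:R.
have y0 : 0 <= y.
  by rewrite /y natrX; nra.
have y2 : y <= ((n.+1 ^ 2).*2)%:R.
  by rewrite /y -addnn natrD !natrX; nra.
have /andP[t1 t2] := truncn_itv y0.
have jl : (Num.truncn y < (n.+1 ^ 2).*2.+1)%N.
  by rewrite ltnS -(ler_nat R); apply: le_trans y2.
exists (Ordinal jl); rewrite /grid /=.
rewrite indic_in// mul1r; apply: (@le_trans _ _ (n.+1%:R^-1 `^ a)); last first.
  by rewrite lerDl mulr_ge0 ?powR_ge0// indicE.
have e : x - ((Num.truncn y)%:R - (n.+1 ^ 2)%:R) / n.+1%:R = (y - (Num.truncn y)%:R) / n.+1%:R.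
  by rewrite /y; field; rewrite gt_eqF.
rewrite e; apply: ge0_ler_powR; rewrite ?nnegrE ?invr_ge0 ?(ltW n0)//; first by alra.
rewrite normrM normfV (gtr0_norm n0) ger0_norm; last by rewrite subr_ge0.
rewrite ler_pdivrMr// mulVf ?gt_eqF//; move: t2; rewrite -natr1; lra.
Qed.

Lemma grid_dist_small u (e : R) : measurable_fun setT u -> weighted_mass u -> 0 < e ->
  exists n, L1 mu (fun x => expR (u x) * grid_dist n x) /\
    \int[mu]_x (expR (u x) * grid_dist n x) < e.
Proof.
move=> mu_ [ui wi] e0.
have ind01 (A : set R) x : (0 : R) <= (\1_A x : R) <= 1.
  by rewrite indicE; case: (_ \in _); rewrite ?lexx ?ler01.
have gd0 n x : 0 <= grid_dist n x.
  by rewrite addr_ge0// mulr_ge0 ?powR_ge0//; have /andP[] := ind01 _ x.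
have md n : measurable_fun setT (fun x => expR (u x) * grid_dist n x).
  by rewrite /grid_dist; mfun.
have dom n x : `|expR (u x) * grid_dist n x| <= expR (u x) + expR (u x) * `|x| `^ a.
  rewrite ger0_norm; last by rewrite mulr_ge0 ?expR_ge0.
  rewrite -[X in X + _]mulr1 -mulrDr ler_wpM2l ?expR_ge0//.
  apply: lerD.
    apply: (@le_trans _ _ (1 * 1)); last by rewrite mulr1.
    have /andP[h1 h2] := ind01 [set y : R | `|y| <= n.+1%:R] x.
    apply: ler_pM => //.
    rewrite -[leRHS](powRr0 n.+1%:R^-1); apply: ger_powR; last by alra.
    by rewrite invr_gt0 ltr0n invf_le1 ?ltr0n// ler1n.
  by rewrite ler_piMl ?powR_ge0//; have /andP[] := ind01 [set y : R | n.+1%:R < `|y|] x.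
have dcv : forall x, expR (u x) * grid_dist n x @[n --> \oo] --> (0 : R).
  move=> x; rewrite -[X in _ --> X](mulr0 (expR (u x))); apply: cvgMl_tmp.
  have c1 : (n.+1%:R^-1 `^ a) @[n --> \oo] --> (0 : R).
    apply/cvgrPdist_lt => d d0.
    have /cvgrPdist_lt/(_ _ (powR_gt0 a^-1 d0))[N _ hN] := @cvg_harmonic R.
    exists N => // n /hN; rewrite !sub0r !normrN /= (ger0_norm (powR_ge0 _ _)).
    rewrite ger0_norm ?invr_ge0// => h.
    have -> : d = (d `^ a^-1) `^ a.
      by rewrite -powRrM mulVf ?powRr1 ?(ltW d0)// gt_eqF// alra.
    by apply: gt0_ltr_powR; rewrite ?nnegrE ?invr_ge0 ?powR_ge0//; alra.
  apply: cvg_trans c1; apply: near_eq_cvg; near=> n.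
  have xn : `|x| <= n.+1%:R.
    apply: (@le_trans _ _ n%:R); last by rewrite ler_nat.
    by near: n; exact: nbhs_infty_ger.
  rewrite /grid_dist indic_in// (@indic_out _ _ x); last by rewrite /= ltNge xn.
  by rewrite mul1r mul0r addr0.
have dj := L1D ui wi.
have [_ h] := @dct_all _ _ _ mu _ (fun=> 0) _ md (@measurable_cst _ _ _ _ _ (0 : R)) dcv dj dom.
move: h; rewrite int0 => /cvgrPdist_lt/(_ _ e0)[n _ /(_ n (leqnn n))] h.
exists n; split; first exact: L1_le dj (md n) (dom n).
by move: h; rewrite sub0r normrN; apply: le_lt_trans; exact: ler_norm.
Unshelve. all: end_near. Qed.

(* The form is nonnegative on functions vanishing on a fine grid, so a negative
   subspace embeds in the space of values on that grid. *)
Lemma morse_index_finite u : measurable_fun setT u -> weighted_mass u ->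
  (morse_index s u < +oo)%E.
Proof.
move=> mu_ wu; have [K K0 hK] := morrey a0 a1.
have e0 : 0 < Cs / 2 / K by rewrite !divr_gt0// Cs0.
have [n [gi gn]] := grid_dist_small mu_ wu e0.
set N := ((n.+1 ^ 2).*2.+1)%N.
apply: (@le_lt_trans _ _ (N%:R%:E : \bar R)); last exact: ltry.
apply: ge_ereal_sup => _ [V [[V0 Vlin] Vtest Vneg] <-].
apply: ge_ereal_sup => _ [k [e [Ve linde]] <-].
rewrite lee_fin ler_nat leqNgt; apply/negP => Nk.
pose A : 'M[R]_(k, N) := \matrix_(i, j) e i (grid j).
(* There are more independent functions than grid points, so a nontrivial combination of them
   vanishes on the whole grid. *)
have : kermx A != 0.
  rewrite -mxrank_eq0 mxrank_ker subn_eq0 -ltnNge.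
  by apply: leq_ltn_trans Nk; exact: rank_leq_col.
move=> /rowV0Pn[c /sub_kermxP cA c0].
pose phi : R -> R := \sum_(i < k) c 0 i *: e i.
have phiE x : phi x = \sum_(i < k) c 0 i * e i x.
  by rewrite /phi fct_sumE.
have phi0 : phi != 0.
  apply: contraNN c0 => /eqP h; apply/eqP/rowP => i; rewrite mxE.
  exact: (linde (fun i => c 0 i) h).
have Vsum : forall (r : seq 'I_k), V (\sum_(i <- r) c 0 i *: e i).
  elim=> [|i r ih]; first by rewrite big_nil; move: V0; rewrite inE.
  by rewrite big_cons; have := Vlin (c 0 i) (e i) (\sum_(i <- r) c 0 i *: e i); rewrite !inE; apply.
have Vphi : V phi := Vsum _.
have tp := Vtest _ Vphi.
have := Vneg _ Vphi phi0; rewrite ltNge => /negP; apply.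
apply: (@lin_form_ge0 u phi (grid_dist n) K tp _ gi).
- by case: wu => ui _; exact: sqr_L1_bounded.
- move=> x; have [j hj] := near_grid n x.
  have pj : phi (grid j) = 0.
    rewrite phiE; move/rowP : cA => /(_ j); rewrite !mxE => h; rewrite -[RHS]h.
    by apply: eq_bigr => i _; rewrite mxE.
  have := hK phi x (grid j) tp; rewrite pj subr0 => /le_trans; apply.
  by rewrite ler_wpM2r ?energy_ge0// ler_wpM2l// ltW.
- by move: gn; rewrite ltr_pdivlMr// mulrC; exact: ltW.
Qed.

Let dilate r x := cutoff (r^-1 * x).

Let test_dilate r : 0 < r -> test_function (dilate r).
Proof.
move=> r0; have := @test_affine R (@cutoff R) r^-1 0 _ (test_cutoff R).
rewrite invr_eq0 gt_eqF// => /(_ isT); by under eq_fun do rewrite addr0.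
Qed.

Let energy_dilate r : 0 < r -> energy a (dilate r) = r `^ (- a) * energy a (@cutoff R).
Proof. by move=> r0; rewrite -(energy_scale a0 a1 r0)//; exact: test_cutoff. Qed.

Let dilate1 r x : 0 < r -> `|x| <= r -> dilate r x = 1.
Proof.
move=> r0 xr; rewrite /dilate cutoff1// normrM gtr0_norm ?invr_gt0//.
by rewrite mulrC ler_pdivrMr// mul1r.
Qed.

Let dilate0 r x : 0 < r -> 2 * r <= `|x| -> dilate r x = 0.
Proof.
move=> r0 xr; rewrite /dilate cutoff0// normrM gtr0_norm ?invr_gt0//.
by rewrite mulrC ler_pdivlMr.
Qed.

(* The energy of cutoff (x / r) is of order r^(-a), and a > 0. *)
Lemma morse_index_ge1 u :
  locally_integrable setT (fun x => expR (u x)) -> (1 <= morse_index s u)%E.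
Proof.
move=> lu; pose m := \int[mu]_x (\1_`[-1, 1] x * expR (u x)).
have mi := locally_integrable_L1 1 lu.
have m0 : 0 < m.
  apply: (@int_gt0_itv R _ (-1) 1) => //.
  by move=> x x1; rewrite indic_in ?mul1r ?expR_gt0.
set E := energy a (@cutoff R).
have E0 : 0 <= E := energy_ge0 _ _.
(* Since r is defined by [r^a = b], the dilated cutoff has energy E / b, and [Cs * E < m * b] makes
   the form negative. From [b >= 1] follows [r >= 1], so the cutoff is 1 on [-1, 1]. *)
pose b := Cs * E / m + 1.
have b1 : 1 <= b.
  by rewrite lerDr; apply: divr_ge0 (ltW m0); exact: mulr_ge0 (ltW Cs0) E0.
pose r := b `^ a^-1.
have r0 : 0 < r by rewrite powR_gt0; lra.
have r1 : 1 <= r.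
  by rewrite -(powRr0 b); apply: ler_powR => //; rewrite invr_ge0; alra.
have ra : r `^ (- a) = b^-1.
  rewrite powRN -powRrM mulVf ?powRr1//; first by lra.
  by rewrite gt_eqF// a0.
have tr := test_dilate r0.
have neg : lin_form s u (dilate r) < 0.
  rewrite lin_form_eq// subr_lt0 energy_dilate// ra -/E.
  apply: (@lt_le_trans _ _ m).
    rewrite mulrCA mulrC ltr_pdivrMr; last by lra.
    have -> : m * b = Cs * E + m by rewrite /b; field; rewrite gt_eqF.
    have := mulr_ge0 (ltW Cs0) E0; lra.
  apply: int_le => //; first exact: locally_integrable_sqr.
  move=> x; have [x1|x1] := pselect (`[-1, 1]%classic x); last first.
    by rewrite indic_out// mul0r mulr_ge0 ?expR_ge0 ?sqr_ge0.
  rewrite indic_in// mul1r dilate1 ?expr1n ?mulr1//.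
  by move: x1; rewrite /= in_itv/= -ler_norml => x1; exact: le_trans r1.
pose V : set (R -> R) := [set f | exists c : R, f = c *: (dilate r : R -> R)].
have scaleE (c : R) : c *: (dilate r : R -> R) = (fun x => c * dilate r x).
  by apply/funext.
have Vneg : negative_subspace s u V.
  split.
  - split; first by rewrite inE; exists 0; rewrite scale0r.
    move=> c f g; rewrite !inE => -[d ->] [e ->]; exists (c * d + e).
    by rewrite scalerA scalerDl.
  - by move=> f [c ->]; rewrite scaleE; exact: testZ.
  - move=> f [c ->] cn; have c0 : c != 0.
      by apply: contraNN cn => /eqP ->; rewrite scale0r.
    rewrite scaleE lin_form_eq; last exact: testZ.
    rewrite (energyZ a0 a1 c tr).
    have -> : \int[mu]_x (expR (u x) * (c * dilate r x) ^+ 2) =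
        c ^+ 2 * \int[mu]_x (expR (u x) * dilate r x ^+ 2).
      rewrite -intZ; last exact: locally_integrable_sqr.
      by apply: eq_int => x; ring.
    have := neg; rewrite lin_form_eq// => neg'.
    have c2 : 0 < c ^+ 2 by rewrite exprn_even_gt0.
    have := nmulr_rlt0 (c ^+ 2) neg'; rewrite -(pmulr_rlt0 _ c2) => h.
    have -> : Cs / 2 * (c ^+ 2 * energy a (dilate r)) -
      c ^+ 2 * \int[mu]_x (expR (u x) * dilate r x ^+ 2) =
      c ^+ 2 * (Cs / 2 * energy a (dilate r) - \int[mu]_x (expR (u x) * dilate r x ^+ 2)) by ring.
    by rewrite pmulr_rlt0.
apply: (@le_trans _ _ (dimension V)); last by apply: ereal_sup_ubound; exists V.
apply: ereal_sup_ubound; exists 1%N => //=.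
exists (fun=> dilate r); split; first by move=> i; exists 1; rewrite scale1r.
move=> c; rewrite big_ord1 scaleE => /(congr1 (fun f => f 0)) /=.
by rewrite dilate1 ?normr0 ?(ltW r0)// mulr1 => c0 i; rewrite ord1.
Qed.

(* Test with a wide cutoff minus a fixed one that equals 1 near K: its energy
   stays bounded as the first one widens. *)
Lemma stable_finite_mass u K : compact K ->
  locally_integrable setT (fun x => expR (u x)) -> stable_outside s u K ->
  L1 mu (fun x => expR (u x)).
Proof.
move=> cK lu st; have [M [_ hM]] := compact_bounded cK.
pose b := `|M| + 1.
have b1 : 1 <= b by rewrite lerDr.
(* The slack 1/2 keeps K away from the closed set [b <= |x|], which contains the support of the
   function tested below. *)
have Kb x : K x -> `|x| <= `|M| + 2^-1.
  move=> Kx; apply: (hM (`|M| + 2^-1)) => //; have := ler_norm M; lra.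
have mE : measurable_fun setT (fun x => expR (u x)) by case: lu.
set E := energy a (@cutoff R).
have E0 : 0 <= E := energy_ge0 _ _.
have b0 : 0 < b by lra.
pose A := [set y : R | 2 * b <= `|y|].
have mA : measurable A by rewrite /A; mfun.
pose F r x := \1_A x * (\1_`[- r, r] x * expR (u x)).
have Fi r : L1 mu (F r).
  by apply: L1_indicM => //; exact: locally_integrable_L1.
have bound r : 2 * b <= r ->
    L1 mu (F r) /\ \int[mu]_x F r x <= 2 * Cs * E.
  move=> rb; have r0 : 0 < r by lra.
  split; first exact: Fi.
  pose phi x := dilate r x + - dilate b x.
  have tN := testN (test_dilate b0).
  have tp : test_function phi by apply: testD => //; exact: test_dilate.
  have phi_in x : `|x| <= b -> phi x = 0.
    by move=> xb; rewrite /phi !dilate1 ?subrr//; lra.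
  have sp : tsupport phi `<=` ~` K.
    have cl : closed [set x : R | b <= `|x|].
      rewrite (_ : [set x : R | _] = (fun x : R => `|x|) @^-1` [set y | b <= y]) //.
      by apply: preimage_closed => // x _; exact: norm_continuous.
    apply: (@subset_trans _ (closure [set x : R | b <= `|x|])).
      apply: closure_subset => x /=; apply: contraNT; rewrite -ltNge => /ltW/phi_in ->.
      by rewrite eqxx.
    rewrite -(closure_id _).1// => x /= bx /Kb; rewrite /b in bx; lra.
  have pw p : 1 <= p -> p `^ (- a) <= 1.
    move=> p1; rewrite powRN invf_le1 ?powR_gt0//; last by lra.
    by rewrite -[leLHS](powRr0 p); apply: ler_powR => //; exact: (ltW a0).
  have Ep : energy a phi <= 4 * E.
    apply: (le_trans (energyD a0 a1 (test_dilate r0) tN)).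
    have -> : energy a (fun x => - dilate b x) = energy a (dilate b).
      have := energyZ a0 a1 (-1) (test_dilate b0).
      by under eq_fun do rewrite mulN1r; rewrite sqrrN expr1n mul1r.
    rewrite !energy_dilate// -/E.
    have h1 := ler_wpM2r E0 (pw r ltac:(lra)); have h2 := ler_wpM2r E0 (pw b b1).
    lra.
  have := st phi tp sp; rewrite lin_form_eq// subr_ge0 => h.
  have h2 : Cs / 2 * energy a phi <= 2 * Cs * E.
    have -> : 2 * Cs * E = Cs / 2 * (4 * E) by field.
    exact: (ler_wpM2l (divr_ge0 (ltW Cs0) (ler0n _ 2)) Ep).
  apply: le_trans h2; apply: le_trans h.
  have pi := locally_integrable_sqr lu tp.
  apply: int_le => //.
  move=> x; rewrite /F; have [xA|xA] := pselect (A x); last first.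
    by rewrite indic_out// mul0r mulr_ge0 ?expR_ge0 ?sqr_ge0.
  rewrite indic_in// mul1r; have [xr|xr] := leP `|x| r; last first.
    rewrite indic_out ?mul0r; first exact: mulr_ge0 (expR_ge0 _) (sqr_ge0 _).
    by rewrite /= in_itv/= -ler_norml leNgt xr.
  rewrite indic_in ?mul1r; last by rewrite /= in_itv/= -ler_norml.
  by rewrite /phi dilate1// dilate0// subr0 expr1n mulr1.
have ind0 (S : set R) x : (0 : R) <= (\1_S x : R) by rewrite indicE.
have hn (n : nat) : 2 * b <= 2 * b + n%:R by rewrite lerDl ler0n.
have cF x : F (2 * b + n%:R) x @[n --> \oo] --> \1_A x * expR (u x).
  apply: cvg_near_cst; near=> n; rewrite /F.
  rewrite (@indic_in _ `[- (2 * b + n%:R), 2 * b + n%:R]%classic) ?mul1r//.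
  rewrite /= in_itv/= -ler_norml; apply: (@le_trans _ _ n%:R); last by lra.
  by near: n; exact: nbhs_infty_ger.
have mF : measurable_fun setT (fun x => \1_A x * expR (u x)) by mfun.
have [iA _] := @L1_fatou _ _ _ mu (fun n => F (2 * b + n%:R))
  (fun x => \1_A x * expR (u x)) (2 * Cs * E) (fun n => Fi _)
  (fun n x => mulr_ge0 (ind0 _ _) (mulr_ge0 (ind0 _ _) (expR_ge0 _))) mF cF
  (fun n => (bound _ (hn n)).2).
have i2 := locally_integrable_L1 (2 * b) lu.
apply: (L1_le (L1D iA i2)) => // x; rewrite ger0_norm ?expR_ge0//.
have [xA|xA] := leP (2 * b) `|x|.
  by rewrite indic_in// mul1r lerDl mulr_ge0 ?expR_ge0.
rewrite (@indic_in _ `[- (2 * b), 2 * b]%classic); last first.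
  by rewrite /= in_itv/= -ler_norml ltW.
by rewrite mul1r lerDr mulr_ge0 ?expR_ge0.
Unshelve. all: end_near. Qed.

End morse.

(** * Convolutions and weak derivatives *)

Section parameter_integrals.
Context (R : realType).
Notation mu := (@lebesgue_measure R).
Implicit Types (F dF : R -> R -> R) (f g : R -> R) (x y B : R).

Lemma der_int F dF g x : (forall t, L1 mu (F t)) ->
  (forall t y, derat t (F ^~ y) (dF t y)) -> L1 mu g ->
  (forall t y, `|dF t y| <= g y) ->
  derat x (fun t => \int[mu]_y F t y) (\int[mu]_y dF x y).
Proof.
move=> Fi dFF gi gB; apply: der_cvg.
have xI : `]x - 1, x + 1[%classic x by rewrite /= in_itv/=; apply/andP; split; lra.
have dE t y : partial1of2 F t y = dF t y by exact: der_derive1.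
have := @cvg_differentiation_under_integral R _ _ mu F setT measurableT x _ _ xI
  (fun t _ => Fi t) (fun t y _ _ => @ex_derive _ _ _ _ _ _ _ (dFF t y)) g
  (fun y => le_trans (normr_ge0 _) (gB 0 y)) gi.
rewrite (eq_int mu (dE x)); apply => t y _ _; by rewrite dE.
Qed.

Lemma continuous_int F g : (forall t, measurable_fun setT (F t)) ->
  (forall y, continuous (F ^~ y)) -> L1 mu g ->
  (forall t y, `|F t y| <= g y) -> continuous (fun t => \int[mu]_y F t y).
Proof.
move=> mF cF gi gB x.
have xI : x \in `]x - 1, x + 1[%classic by rewrite inE/= in_itv/=; apply/andP; split; lra.
apply: (@continuity_under_integral R _ _ mu F setT measurableT (x - 1) (x + 1) _ _ g gi _ x xI).
- by move=> t _; exact: L1_le gi (mF t) (gB t).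
- by apply: aeW => y _ t _; exact: cF.
- by move=> t _; apply: aeW => y _; exact: gB.
Qed.

End parameter_integrals.

Section convolution.
Context (R : realType).
Notation mu := (@lebesgue_measure R).
Implicit Types (f g : R -> R) (x y B : R).

Definition convol f g x : R := \int[mu]_y (f y * g (x - y)).

Lemma convolC f g x : L1 mu (fun y => f y * g (x - y)) ->
  convol f g x = \int[mu]_y (f (x - y) * g y).
Proof.
move=> i; rewrite /convol -(int_refl x i); apply: eq_int => y.
by congr (_ * g _); ring.
Qed.

Lemma L1_convol f g B x : L1 mu f -> measurable_fun setT g -> (forall y, `|g y| <= B) ->
  L1 mu (fun y => f y * g (x - y)).
Proof.
move=> fi mg gB.
have m : measurable_fun setT (fun y => g (x - y)).
  by apply: (mfun_comp mg); mfun.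
have := @L1_bounded _ _ _ mu B (fun y => g (x - y)) f (fun y => gB _) m fi.
by apply: eq_L1 => y; rewrite mulrC.
Qed.

Lemma der_convol f g g' B0 B1 x : L1 mu f -> (forall y, derat y g (g' y)) ->
  (forall y, `|g y| <= B0) -> (forall y, `|g' y| <= B1) ->
  derat x (convol f g) (convol f g' x).
Proof.
move=> fi dg gB gB1.
have mg : measurable_fun setT g.
  by apply: continuous_measurable_fun => y; exact: der_cont (dg y).
apply: (@der_int R (fun t y => f y * g (t - y)) (fun t y => f y * g' (t - y))
  (fun y => `|f y| * B1)) => [t|t y||t y].
- exact: L1_convol gB.
- apply: der_val.
    by apply: derM; [exact: der_cst|apply: der_comp; [|exact: dg]; der].
  by rewrite mul0r add0r addr0 mul1r.
- exact: L1Zr (L1_abs fi).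
- by rewrite normrM ler_wpM2l.
Qed.

Lemma smooth_convol f g : L1 mu f -> test_function g -> smooth (convol f g).
Proof.
move=> fi tg; apply/smoothP => n; elim: n g tg => [//|n ih] g tg.
have [B0 _ hB0] := test_bounded tg.
have [B1 _ hB1] := test_bounded (test_derive1 tg).
apply: (@ndiffS _ _ _ (convol f (derive1 g))); last by apply: ih; exact: test_derive1.
by move=> x; apply: der_convol hB0 hB1 => // y; apply: smooth_der; case: tg.
Qed.

Lemma test_convol f g (T : R) : L1 mu f -> 0 <= T -> (forall x, T < `|x| -> f x = 0) ->
  test_function g -> test_function (convol f g).
Proof.
move=> fi T0 f0 tg; have sm := smooth_convol fi tg.
move/test_functionP : tg => [_ [T' T'0 g0]].
apply/test_functionP; split=> //; exists (T + T'); first exact: addr_ge0.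
move=> x xT; rewrite /convol -[RHS](@int0 _ _ _ mu); apply: eq_int => y.
have [yT|yT] := ltP T `|y|; first by rewrite f0 ?mul0r.
rewrite g0 ?mulr0//; have := ler_normD (x - y) y; rewrite subrK; lra.
Qed.

End convolution.

(** * The fundamental lemma of the calculus of variations *)

Section fundamental_lemma.
Context (R : realType).
Notation mu := (@lebesgue_measure R).
Implicit Types (f g : R -> R) (x y B : R).

(* At a Lebesgue point x, test against cutoff ((y - x) / r) and let r -> 0. *)
Lemma fundamental_lemma f : locally_integrable setT f ->
  (forall phi, test_function phi -> \int[mu]_x (f x * phi x) = 0) ->
  {ae mu, forall x, f x = 0}.
Proof.
move=> lf h; have := lebesgue_differentiation lf.
apply: (@filterS _ _ (ae_filter_ringOfSetsType mu)) => x lx; apply/eqP; rewrite -normr_le0; apply/ler_addgt0Pr => e e0.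
have ci : L1 mu (@cutoff R) := test_L1 (test_cutoff R).
pose c := \int[mu]_y (@cutoff R y).
have c2 : 2 <= c.
  have [i1 e1] := @int_indic_itv R (-1) 1 ltac:(lra).
  have <- : \int[mu]_y \1_`[(-1 : R), 1] y = 2 by rewrite e1; ring.
  apply: int_le => // y; have [y1|y1] := pselect (`[(-1 : R), 1]%classic y).
    rewrite indic_in// cutoff1//; move: y1; rewrite /= in_itv/=; by rewrite ler_norml.
  by rewrite indic_out// cutoff_ge0.
have e2 : 0 < e / 2 by lra.
move/fine_cvgP : lx => [fin /cvgrPdist_lt/(_ _ e2) nr].
near (0 : R)^'+ => r; have r0 : 0 < r by near: r; exact: nbhs_right_gt.
rewrite add0r.
(* [cutoff] is supported in [-2, 2], so the scale r / 2 puts the support of [phi] inside the closure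
   of the ball of radius r. *)
pose s := r / 2; have s0 : 0 < s by rewrite /s; lra.
pose phi y := cutoff (s^-1 * y + - (s^-1 * x)).
have tphi : test_function phi.
  by apply: test_affine (test_cutoff R); rewrite invr_eq0 gt_eqF.
have fphi := locally_integrableM lf tphi.
have iphi : \int[mu]_y phi y = s * c.
  by rewrite /phi int_affine ?invr_eq0 ?gt_eqF// gtr0_norm ?invr_gt0// invrK.
pose B := ball x r : set R.
have mB : measurable B by exact: measurable_ball.
have lfB : L1 mu (fun y => \1_B y * f y).
  have i := locally_integrable_L1 (`|x| + r) lf.
  apply: (eq_L1 _ (L1_indicM mB i)) => y; have [By|By] := pselect (B y); last first.
    by rewrite indic_out// !mul0r.
  rewrite (@indic_in _ `[- (`|x| + r), `|x| + r]%classic) ?mul1r//= in_itv/= -ler_norml.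
  by move: By; rewrite /B /ball/= => By; have := ler_normB x (x - y); rewrite subKr; lra.
have iB : L1 mu (fun y => \1_B y * 1).
  have [i _] := @int_indic_itv R (x - r) (x + r) ltac:(lra).
  apply: (L1_le i); first by mfun.
  move=> y; rewrite mulr1; have [By|By] := pselect (B y); last first.
    by rewrite indic_out// normr0 indicE.
  rewrite !indic_in ?normr1//= in_itv/=.
  by move: By; rewrite /B /ball/= ltr_norml => /andP[? ?]; apply/andP; split; lra.
have dB : L1 mu (fun y => \1_B y * `|f y - f x|).
  have := L1_abs (L1B lfB (L1Zr (f x) iB)); apply: eq_L1 => y.
  have [By|By] := pselect (B y); first by rewrite indic_in// !mul1r.
  by rewrite indic_out// !mul0r subrr normr0.
have phiB y : ~ B y -> phi y = 0.
  move=> By; rewrite /phi cutoff0//.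
  have -> : s^-1 * y + - (s^-1 * x) = s^-1 * (y - x) by ring.
  rewrite normrM normfV (gtr0_norm s0) mulrC ler_pdivlMr// /s.
  move/negP : By; rewrite /B /ball/= -leNgt distrC; lra.
have key : `|f x| * (s * c) <= \int[mu]_y (\1_B y * `|f y - f x|).
  have -> : `|f x| * (s * c) = `|\int[mu]_y (f y * phi y - f x * phi y)|.
    rewrite intB//; last exact: L1Z (test_L1 tphi).
    by rewrite (intZ _ (test_L1 tphi)) iphi h// sub0r normrN normrM (gtr0_norm (mulr_gt0 _ _))//; lra.
  apply: int_abs_le_bound => //; first by apply: L1B => //; exact: L1Z (test_L1 tphi).
  move=> y; have [By|By] := pselect (B y); last first.
    by rewrite phiB// !mulr0 subrr normr0 indic_out// mul0r.
  rewrite indic_in// mul1r -mulrBl normrM ler_piMr// ger0_norm ?cutoff_ge0//.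
  exact: cutoff_le1.
have dE : fine (davg f x r) = (2 * r)^-1 * \int[mu]_y (\1_B y * `|f y - f x|).
  rewrite /davg /iavg lebesgue_measure_ball ?(ltW r0)//.
  have -> : (\int[mu]_(y in ball x r) `|((center (f x) \o f) y)%:E|)%E =
      (\int[mu]_y (\1_B y * `|f y - f x|))%:E.
    rewrite (EFin_Rintegral dB) [LHS]integral_mkcond; congr (integral _ _ _); apply/funext => y.
    rewrite patchE -/B; have [By|By] := pselect (B y).
      by rewrite mem_set// indic_in// mul1r.
    by rewrite memNset// indic_out// mul0r.
  by rewrite inver mulrn_eq0/= gt_eqF//= mulr_natl.
have dlt : fine (davg f x r) < e / 2.
  have : `|0 - fine (davg f x r)| < e / 2 by near: r; exact: nr.
  by rewrite sub0r normrN; apply: le_lt_trans; exact: ler_norm.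
move: dlt; rewrite dE mulrC ltr_pdivrMr; last by lra.
move=> dlt; have n0 := normr_ge0 (f x).
have sc : r <= s * c by rewrite /s; nra.
have := le_lt_trans key dlt => k2.
have : `|f x| * r <= `|f x| * (s * c) by rewrite ler_wpM2l.
move=> k3; have k4 : `|f x| * r < e * r by lra.
by move: k4; rewrite ltr_pM2r// => /ltW.
Unshelve. all: end_near. Qed.

End fundamental_lemma.

(** * Functions whose second weak derivative vanishes *)

Section du_bois_reymond.
Context (R : realType).
Notation mu := (@lebesgue_measure R).
Implicit Types (f g h theta : R -> R) (x y B : R).

Lemma continuous_locally_integrable f : continuous f -> locally_integrable setT f.
Proof.
move=> cf; split; [exact: continuous_measurable_fun|exact: openT|].
move=> K _ cK; have /integrableP[_] // : mu.-integrable K (EFin \o f).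
by apply: continuous_compact_integrable => //; exact: continuous_subspaceT.
Qed.

Lemma der_primitive f x : L1 mu f -> continuous f ->
  derat x (fun x => \int[mu]_y (\1_`]-oo, x] y * f y)) (f x).
Proof.
move=> fi cf.
have E : (fun x => \int[mu]_(t in [set` `]-oo, x]]) f t) =
  (fun x => \int[mu]_y (\1_`]-oo, x] y * f y)).
  by apply/funext => z; rewrite int_indic.
have x1 : x < x + 1 by lra.
have := @continuous_FTC1 R f -oo%O x (x + 1) x1; rewrite E => h.
have fi' : mu.-integrable `]-oo, x + 1] (EFin \o f).
  by apply: integrableS fi => //; exact: measurable_itv.
have [d e] := h fi' (ltNyr _) (cf x).
by rewrite -e; exact: derivable_der.
Qed.

Lemma test_primitive f : test_function f -> \int[mu]_x f x = 0 ->
  exists2 g, test_function g & forall x, derat x g (f x).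
Proof.
move=> tf f0; have fi := test_L1 tf; have cf := test_continuous tf.
pose g x := \int[mu]_y (\1_`]-oo, x] y * f y).
have dg x : derat x g (f x) by exact: der_primitive.
exists g => //; have [sf _] := tf.
move/test_functionP : tf => [_ [T T0 hT]].
apply/test_functionP; split.
  by apply/smoothP => -[//|n]; apply: (ndiffS dg); exact: (smoothP f).1.
exists T => // x; rewrite lter_normr => /orP[xT|xT].
  rewrite /g -[RHS]f0; apply: eq_int => y.
  have [yx|yx] := leP y x; first by rewrite indic_in ?mul1r//= in_itv.
  by rewrite hT ?mulr0// lter_normr; apply/orP; left; lra.
rewrite /g -[RHS](@int0 _ _ _ mu); apply: eq_int => y.
have [yx|yx] := leP y x; last by rewrite indic_out ?mul0r//= in_itv/= leNgt yx.
by rewrite hT ?mulr0// lter_normr; apply/orP; right; lra.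
Qed.

Lemma test_ibp f h : test_function f -> smooth h ->
  \int[mu]_x (h x * derive1 f x) = - \int[mu]_x (derive1 h x * f x).
Proof.
move=> tf sh; have [sf _] := tf.
have t1 : test_function (fun x => h x * derive1 f x).
  have := testM (test_derive1 tf) sh; congr test_function.
  by apply/funext => x; rewrite mulrC.
have t2 : test_function (fun x => derive1 h x * f x).
  have := testM tf (smooth_derive1 sh); congr test_function.
  by apply/funext => x; rewrite mulrC.
apply/eqP; rewrite -addr_eq0 -(intD (test_L1 t1) (test_L1 t2)); apply/eqP.
have t3 := testD t1 t2; have t4 := testM tf sh.
move/test_functionP : (t3) => [_ [T T0 hT]].
move/test_functionP : (t4) => [_ [T' T'0 hT']].
have [] // := @int_der_compact R (fun x => f x * h x)
  (fun x => h x * derive1 f x + derive1 h x * f x) (T + T').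
- exact: addr_ge0.
- move=> x; apply: der_val.
    by apply: derM; exact: smooth_der.
  by rewrite /=; ring.
- exact: test_continuous.
- by move=> x xT; apply: hT'; lra.
- by move=> x xT; apply: hT; lra.
Qed.

Lemma smooth_id : smooth (fun x : R => x).
Proof. by apply/smoothP => n; exact: ndiff_id. Qed.

Lemma derive1_id x : derive1 (fun x : R => x) x = 1.
Proof. exact: der_derive1 (der_id x). Qed.

(** A test function whose integral and first moment vanish is the second derivative of a test
    function. Any phi is brought to this form by subtracting multiples of [e0], of integral 1 and
    first moment 0, and of [e1 = - e0'], of integral 0 and first moment 1. The pairings of f with
    these two are the coefficients of the affine function. *)
Lemma du_bois_reymond2 f : locally_integrable setT f ->
  (forall g, test_function g -> \int[mu]_x (f x * derive1 (derive1 g) x) = 0) ->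
  exists b c : R, {ae mu, forall x, f x = b + c * x}.
Proof.
move=> lf h.
have ci := test_L1 (test_cutoff R).
pose c := \int[mu]_y (@cutoff R y).
have c0 : 0 < c.
  apply: (@int_gt0_itv R _ (-1) 1) => //.
    by move=> x; exact: cutoff_ge0.
  by move=> x; rewrite /= in_itv/= -ler_norml => /cutoff1 ->.
have tm f1 : test_function f1 -> L1 mu f1 /\ L1 mu (fun x => x * f1 x).
  move=> t1; split; first exact: test_L1.
  by apply: (eq_L1 _ (test_L1 (testM t1 smooth_id))) => x; rewrite mulrC.
pose e0 x := c^-1 * @cutoff R x.
have te0 : test_function e0 by exact: testZ (test_cutoff R).
have cE x : @cutoff R (- x) = cutoff x by rewrite /cutoff opprK mulrC.
have ie0 : \int[mu]_x e0 x = 1 by rewrite /e0 (intZ _ ci) mulVf// gt_eqF.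
have ye0 : \int[mu]_x (x * e0 x) = 0.
  have [_ i] := tm _ te0.
  have := int_refl 0 i; set I := \int[mu]_x (x * e0 x).
  rewrite (_ : \int[mu]_x _ = - I); first by lra.
  rewrite /I -(intN i); apply: eq_int => x.
  by rewrite sub0r /e0 cE; ring.
pose e1 x := - derive1 e0 x.
have te1 : test_function e1 by exact: testN (test_derive1 te0).
have s1 : smooth (fun=> 1 : R) by apply/smoothP => n; exact: ndiff_cst.
have ie1 : \int[mu]_x e1 x = 0.
  rewrite /e1 intN; last exact: test_L1 (test_derive1 te0).
  have := test_ibp te0 s1.
  rewrite (eq_int mu (g := derive1 e0)); last by move=> x; rewrite mul1r.
  move=> ->; rewrite opprK -[RHS](@int0 _ _ _ mu); apply: eq_int => x.
  by rewrite (der_derive1 (der_cst x 1)) mul0r.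
have ye1 : \int[mu]_x (x * e1 x) = 1.
  have := test_ibp te0 smooth_id.
  rewrite (eq_int mu (f := fun x => derive1 (fun x : R => x) x * e0 x) (g := e0)).
    rewrite ie0 => E.
    rewrite (eq_int mu (g := fun x => - (x * derive1 e0 x))).
      by rewrite intN ?E ?opprK//; exact: (tm _ (test_derive1 te0)).2.
    by move=> x; rewrite /e1; ring.
  by move=> x; rewrite derive1_id mul1r.
exists (\int[mu]_x (f x * e0 x)), (\int[mu]_x (f x * e1 x)).
set b := \int[mu]_x (f x * e0 x); set d := \int[mu]_x (f x * e1 x).
pose F x := f x - (b + d * x).
have lF : locally_integrable setT F.
  apply: locally_integrableB => //; apply: continuous_locally_integrable => x.
  have : derat x (fun x => b + d * x) (0 + (0 * x + d * 1)) by der.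
  exact: der_cont.
suff : {ae mu, forall x, F x = 0}.
  apply: (@filterS _ _ (ae_filter_ringOfSetsType mu)) => x.
  by move/eqP; rewrite subr_eq0 => /eqP.
apply: fundamental_lemma => // phi tphi.
have [pi yi] := tm _ tphi; have [i0 yi0] := tm _ te0; have [i1 yi1] := tm _ te1.
pose p := \int[mu]_x phi x; pose q := \int[mu]_x (x * phi x).
pose psi x := phi x + ((- p) * e0 x + (- q) * e1 x).
have tpsi : test_function psi := testD tphi (testD (testZ _ te0) (testZ _ te1)).
have psi0 : \int[mu]_x psi x = 0.
  rewrite /psi (intD pi (L1D (L1Z _ i0) (L1Z _ i1))) (intD (L1Z _ i0) (L1Z _ i1)).
  by rewrite (intZ _ i0) (intZ _ i1) ie0 ie1 -/p; ring.
have psi1 : \int[mu]_x (x * psi x) = 0.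
  rewrite (eq_int mu (g := fun x => x * phi x + (- p * (x * e0 x) + - q * (x * e1 x)))).
    rewrite (intD yi (L1D (L1Z _ yi0) (L1Z _ yi1))) (intD (L1Z _ yi0) (L1Z _ yi1)).
    by rewrite (intZ _ yi0) (intZ _ yi1) ye0 ye1 -/q; ring.
  by move=> x; rewrite /psi; ring.
have [G tG dG] := test_primitive tpsi psi0.
have G0 : \int[mu]_x G x = 0.
  have := test_ibp tG smooth_id.
  rewrite (eq_int mu (g := fun x => x * psi x)); last by move=> x; rewrite (der_derive1 (dG x)).
  rewrite psi1 (eq_int mu (g := G)); last by move=> x; rewrite derive1_id mul1r.
  lra.
have [g tg dg] := test_primitive tG G0.
have := h g tg.
have -> : derive1 g = G by apply/funext => x; exact: der_derive1.
have -> : derive1 G = psi by apply/funext => x; exact: der_derive1.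
have fpi := locally_integrableM lf tphi.
have f0i := locally_integrableM lf te0.
have f1i := locally_integrableM lf te1.
rewrite (eq_int mu (g := fun x => f x * phi x + (- p * (f x * e0 x) + - q * (f x * e1 x)))); last first.
  by move=> x; rewrite /psi; ring.
rewrite (intD fpi (L1D (L1Z _ f0i) (L1Z _ f1i))) (intD (L1Z _ f0i) (L1Z _ f1i)).
rewrite (intZ _ f0i) (intZ _ f1i) -/b -/d => E.
rewrite (eq_int mu (g := fun x => f x * phi x - (b * phi x + d * (x * phi x)))); last first.
  by move=> x; rewrite /F; ring.
rewrite (intB fpi (L1D (L1Z _ pi) (L1Z _ yi))) (intD (L1Z _ pi) (L1Z _ yi)).
rewrite (intZ _ pi) (intZ _ yi) -/p -/q -[RHS]E; ring.
Qed.

End du_bois_reymond.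

(** * The fractional Laplacian of powers *)

Lemma powR_inv_opp (R : realType) (x p : R) : 0 < x -> x^-1 `^ (- p) = x `^ p.
Proof. by move=> x0; rewrite -(powR_inv1 (ltW x0)) -powRrM mulrNN mul1r. Qed.

Section fractional_decay.
Context (R : realType) (a : R) (a0 : 0 < a) (a1 : a < 1).
Notation mu := (@lebesgue_measure R).
Notation kern := (@frac_kern R a).
Notation fracD := (@frac_op R a).
Implicit Types (f g m phi : R -> R) (x y h r c B K : R).

Ltac alra := pose proof a0; pose proof a1; lra.

(** The bound is on the absolute integral rather than on the value of the operator, since exchanging
    the operator with a convolution requires it. *)
Definition D_bounded f x K := L1 mu (fun h => diff2 f x h * kern h) /\
  \int[mu]_h `|diff2 f x h * kern h| <= K.

Lemma fracD_le f x K : D_bounded f x K -> `|fracD f x| <= 2^-1 * K.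
Proof.
move=> [i iK]; rewrite /fracD normrM ger0_norm ?invr_ge0// ler_wpM2l ?invr_ge0//.
exact: le_trans (int_abs_le i) iK.
Qed.

Lemma kern_scale r h : r != 0 -> kern h = `|r| `^ (- (2 + a)) * kern (r^-1 * h).
Proof.
move=> r0; rewrite /kern normrM -powRM// normfV mulVKf// normr_eq0//.
Qed.

Lemma measurable_diff2 f x : measurable_fun setT f -> measurable_fun setT (diff2 f x).
Proof.
move=> mf; rewrite /diff2.
have m1 : measurable_fun setT (fun h => f (x + h)) by apply: (mfun_comp mf); mfun.
have m2 : measurable_fun setT (fun h => f (x - h)) by apply: (mfun_comp mf); mfun.
by mfun.
Qed.

(** r may be negative. For an odd homogeneous function, r = x then reduces every x != 0 to the
    single point 1. *)
Lemma D_bounded_scale r c f x K : r != 0 -> D_bounded f (r^-1 * x) K ->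
  D_bounded (fun z => c * f (r^-1 * z)) x (`|c| * `|r| `^ (- (1 + a)) * K) /\
  fracD (fun z => c * f (r^-1 * z)) x = c * `|r| `^ (- (1 + a)) * fracD f (r^-1 * x).
Proof.
move=> r0 [i iK].
have rp : 0 < `|r| by rewrite normr_gt0.
have rE : `|r| `^ (- (2 + a)) * `|r| = `|r| `^ (- (1 + a)).
  rewrite -[X in _ * X]powRr1// -powRD; last by rewrite (gt_eqF rp) implybT.
  by congr (_ `^ _); ring.
have E h : diff2 (fun z => c * f (r^-1 * z)) x h * kern h =
    c * `|r| `^ (- (2 + a)) * (diff2 f (r^-1 * x) (r^-1 * h + 0) * kern (r^-1 * h + 0)).
  by rewrite (kern_scale h r0) /diff2 addr0 mulrDr mulrBr; ring.
have rV : r^-1 != 0 by rewrite invr_eq0.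
have i' := L1_affine 0 rV i.
split; first split.
- by apply: (eq_L1 _ (L1Z (c * `|r| `^ (- (2 + a))) i')) => h; rewrite E.
- rewrite (eq_int mu (g := fun h => `|c| * `|r| `^ (- (2 + a)) *
    `|diff2 f (r^-1 * x) (r^-1 * h + 0) * kern (r^-1 * h + 0)|)); last first.
    by move=> h; rewrite E 2!normrM (ger0_norm (powR_ge0 _ _)).
  rewrite (intZ _ (L1_abs i')) (int_affine 0 rV (L1_abs i)) normfV invrK.
  rewrite -rE !mulrA -(mulrA _ _ K) -(mulrA _ _ (\int[mu]_h _)).
  by apply: ler_wpM2l; rewrite ?mulr_ge0 ?powR_ge0// ler_wpM2l.
- rewrite /fracD (eq_int mu E) (intZ _ i') (int_affine 0 rV i) normfV invrK -rE; ring.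
Qed.

(** The increments are split at [r = (1 + |x|) / 2]. If [|h| <= r], all points z involved satisfy
    [1 + |z| >= r], and the decay of m'' controls the second difference. If [|h| > r], the kernel is
    at most [r^-(2 + a)], and the L1 norm of m controls the shifted terms. *)
Lemma fracD_decay m m' m'' B : 0 <= B -> L1 mu m -> (forall x, derat x m (m' x)) ->
  (forall x, derat x m' (m'' x)) -> (forall x, `|m x| <= B / (1 + `|x|)) ->
  (forall x, `|m'' x| <= B / (1 + `|x|) ^+ 3) ->
  exists2 K, 0 <= K & forall x, D_bounded m x (K * (1 + `|x|) `^ (- (2 + a))).
Proof.
move=> B0 mi dm dm' mB m''B.
have p0 := kern_major_ge0 a.
have Pi := L1_kern_major a0 a1.
have N0 : 0 <= \int[mu]_h `|m h| by exact: int_ge0.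
have P0 : 0 <= \int[mu]_h (kern_major a h) by exact: int_ge0.
exists (2 `^ (2 + a) * (2 * B * \int[mu]_h (kern_major a h) + 2 * \int[mu]_h `|m h|)).
  by rewrite mulr_ge0 ?powR_ge0// addr_ge0// !mulr_ge0.
move=> x; pose r : R := (1 + `|x|) / 2.
have x0 := normr_ge0 x; have r0 : 0 < r by rewrite /r; lra.
have rV : r^-1 != 0 by rewrite invr_eq0 gt_eqF.
pose G h := r `^ (- (2 + a)) * (2 * B / r * kern_major a (r^-1 * h + 0) +
  (`|m (x + h)| + `|m (x - h)|)).
have Gi1 := L1Z (2 * B / r) (L1_affine 0 rV Pi).
have mi2 : L1 mu (fun h => `|m (x + h)|).
  by apply: (eq_L1 _ (L1_abs (L1_shift x mi))) => h; rewrite addrC.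
have mi3 := L1_abs (L1_refl x mi).
have Gi : L1 mu G by apply: L1Z; exact: (L1D Gi1 (L1D mi2 mi3)).
have mm : measurable_fun setT m := L1_measurable mi.
have bound h : `|diff2 m x h * kern h| <= G h.
  have r0' : r != 0 by rewrite gt_eqF.
  rewrite (kern_scale h r0') (gtr0_norm r0) /G addr0 mulrCA normrM (ger0_norm (powR_ge0 _ _)).
  rewrite ler_wpM2l ?powR_ge0//; set t := r^-1 * h.
  have th : h = r * t by rewrite /t mulVKf.
  have A0 : 0 <= 2 * B / r by rewrite divr_ge0 ?mulr_ge0// ltW.
  have [hr|hr] := leP `|h| r.
    have d2 : `|diff2 m x h| <= 2 * B / r * t ^+ 2.
      have -> : 2 * B / r * t ^+ 2 = 2 * (B / r ^+ 3) * h ^+ 2 by rewrite th; field.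
      apply: (diff2_bound2 dm) => z hz; first exact: dm'.
      apply: (le_trans (m''B z)); rewrite ler_wpM2l//.
      have z1 : r <= 1 + `|z|.
        have := ler_normB z (z - x); rewrite subKr; rewrite /r; move: hz hr; rewrite /r; lra.
      have z2 : 0 < 1 + `|z| by lra.
      by rewrite lef_pV2 ?posrE ?exprn_gt0// lerXn2r ?nnegrE ?(ltW r0) ?(ltW z2).
    have t1 : t ^+ 2 <= 1.
      have : `|t| <= 1 by rewrite /t normrM (gtr0_norm (_ : 0 < r^-1)) ?invr_gt0// mulrC ler_pdivrMr// mul1r.
      by move=> ?; rewrite -real_normK ?num_real// expr_le1.
    have d1 : `|diff2 m x h| <= 2 * B / r.
      apply: (le_trans d2); rewrite -[leRHS]mulr1 ler_wpM2l//.
    by have := kern_majorP a0 a1 A0 d1 d2; have := normr_ge0 (m (x + h)); have := normr_ge0 (m (x - h)); lra.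
  have t1 : 1 < `|t|.
    by rewrite /t normrM (gtr0_norm (_ : 0 < r^-1)) ?invr_gt0// mulrC ltr_pdivlMr// mul1r.
  have k1 : kern t <= 1.
    rewrite /frac_kern powRN invf_le1 ?powR_gt0//; last by lra.
    rewrite -[leLHS](powRr0 `|t|); apply: ler_powR; [by lra|by alra].
  have d1 : `|2 * m x| <= 2 * B / r.
    rewrite normrM normr_nat -mulrA ler_wpM2l//; apply: (le_trans (mB x)).
    rewrite ler_wpM2l// lef_pV2 ?posrE//; rewrite /r; lra.
  have d2 : `|2 * m x| <= 2 * B / r * t ^+ 2.
    apply: (le_trans d1); rewrite -[leLHS]mulr1 ler_wpM2l// -real_normK ?num_real//.
    exact: exprn_ege1 (ltW t1).
  have := kern_majorP a0 a1 A0 d1 d2; rewrite !normrM.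
  rewrite (ger0_norm (kern_ge0 _ _)) => e1.
  have e2 : `|diff2 m x h| <= `|2 * m x| + (`|m (x + h)| + `|m (x - h)|).
    rewrite /diff2; apply: (le_trans (ler_normB _ _)); rewrite addrA lerD2r.
    exact: ler_normB.
  apply: (le_trans (ler_wpM2r (kern_ge0 a t) e2)); rewrite mulrDl normrM lerD//.
  by rewrite ler_piMr// addr_ge0.
have Di : L1 mu (fun h => diff2 m x h * kern h).
  apply: (L1_le Gi) => //; have := measurable_kern a; have := measurable_diff2 x mm.
  by move=> ? ?; mfun.
split=> //; apply: (le_trans (int_le (L1_abs Di) Gi bound)).
rewrite /G (intZ _ (L1D Gi1 (L1D mi2 mi3))) (intD Gi1 (L1D mi2 mi3)) (intD mi2 mi3).
rewrite (intZ _ (L1_affine 0 rV Pi)) (int_affine 0 rV Pi) normfV invrK (gtr0_norm r0).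
rewrite (eq_int mu (f := fun h => `|m (x + h)|) (g := fun h => `|m (h + x)|)); last first.
  by move=> h; rewrite addrC.
rewrite (int_shift x (L1_abs mi)) (int_refl x (L1_abs mi)).
have -> : r `^ (- (2 + a)) = 2 `^ (2 + a) * (1 + `|x|) `^ (- (2 + a)).
  rewrite /r powRM ?invr_ge0//.
  by rewrite powR_inv_opp// mulrC.
rewrite le_eqVlt; apply/orP; left; apply/eqP; field; exact: lt0r_neq0.
Qed.

Lemma test_decay n phi : test_function phi ->
  exists2 B, 0 <= B & forall x, `|phi x| <= B / (1 + `|x|) ^+ n.
Proof.
move=> tp; have [B B0 hB] := test_bounded tp.
move/test_functionP : tp => [_ [T T0 hT]].
exists (B * (1 + T) ^+ n) => [|x].
  by rewrite mulr_ge0 ?exprn_ge0 ?addr_ge0// ltW.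
have x0 := normr_ge0 x; have x1 : 0 < 1 + `|x| by lra.
have [xT|xT] := ltP T `|x|.
  rewrite hT// normr0 divr_ge0 ?exprn_ge0 ?(ltW x1)//.
  by rewrite mulr_ge0 ?(ltW B0)// exprn_ge0// addr_ge0.
rewrite ler_pdivlMr ?exprn_gt0//; apply: ler_pM => //.
by rewrite lerXn2r ?nnegrE ?addr_ge0// lerD2l.
Qed.

Lemma test_fracD_decay phi : test_function phi ->
  exists2 K, 0 <= K & forall x, D_bounded phi x (K * (1 + `|x|) `^ (- (2 + a))).
Proof.
move=> tp; have t1 := test_derive1 tp; have t2 := test_derive1 t1.
have [B B0 hB] := test_decay 1 tp; have [C C0 hC] := test_decay 3 t2.
apply: (@fracD_decay phi _ _ (B + C) _ (test_L1 tp)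
  (fun x => smooth_der x tp.1) (fun x => smooth_der x t1.1)) => [|x|x].
- exact: addr_ge0.
- apply: (le_trans (hB x)); rewrite expr1 ler_wpM2r ?invr_ge0 ?addr_ge0//; lra.
- apply: (le_trans (hC x)); rewrite ler_wpM2r ?invr_ge0 ?exprn_ge0 ?addr_ge0//; lra.
Qed.

(** In contrast to [convol], whose first factor is integrable, f is here a continuous and possibly
    unbounded function and g a test function. *)
Definition tconv f g x := \int[mu]_y (f (x - y) * g y).

Lemma diff2Z c f x h : diff2 (fun z => c * f z) x h = c * diff2 f x h.
Proof. by rewrite /diff2; ring. Qed.

Lemma continuous_reflect f x : continuous f -> continuous (fun y => f (x - y)).
Proof.
move=> cf y; apply: (@continuous_comp _ _ _ (fun y => x - y) f); last exact: cf.
have : derat y (fun y => x - y) (0 - 1) by der.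
exact: der_cont.
Qed.

Lemma L1_tconv f g x : continuous f -> test_function g -> L1 mu (fun y => f (x - y) * g y).
Proof.
move=> cf tg; have cg := test_continuous tg.
move/test_functionP : tg => [_ [T _ hT]].
apply: (@L1_compact _ _ T) => [y|y yT]; last by rewrite hT ?mulr0.
by apply: cvgM; [exact: continuous_reflect|exact: cg].
Qed.

Lemma diff2_tconv f g x h : continuous f -> test_function g ->
  L1 mu (fun y => diff2 f (x - y) h * g y) /\
  diff2 (tconv f g) x h = \int[mu]_y (diff2 f (x - y) h * g y).
Proof.
move=> cf tg; have i z := L1_tconv z cf tg.
have E y : diff2 f (x - y) h * g y = 2 * (f (x - y) * g y)
    - f (x + h - y) * g y - f (x - h - y) * g y.
  by rewrite /diff2 (addrAC x (- y) h) (addrAC x (- y) (- h)); ring.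
have i2 := L1B (L1Z 2 (i x)) (i (x + h)).
split; first by apply: (eq_L1 _ (L1B i2 (i (x - h)))) => y; rewrite E.
rewrite (eq_int mu E) (intB i2 (i (x - h))) (intB (L1Z 2 (i x)) (i (x + h))).
by rewrite (intZ _ (i x)).
Qed.

Lemma fracD_tconv f g K x : continuous f -> (forall z, D_bounded f z K) ->
  test_function g ->
  [/\ L1 mu (fun h => diff2 (tconv f g) x h * kern h),
      L1 mu (fun y => fracD f (x - y) * g y) &
      fracD (tconv f g) x = \int[mu]_y (fracD f (x - y) * g y)].
Proof.
move=> cf fK tg; have gi := test_L1 tg.
pose F y h := diff2 f (x - y) h * kern h * g y.
have mf : measurable_fun setT f := continuous_measurable_fun cf.
have mg : measurable_fun setT g := L1_measurable gi.
have Fi : L1prod mu mu F.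
  apply: (@L1prodP _ _ _ _ _ mu mu F (fun y => K * `|g y|)).
  - rewrite /F /diff2 /frac_kern.
    have m1 : measurable_fun setT (fun z : R * R => f (x - z.1)) by apply: (mfun_comp mf); mfun.
    have m2 : measurable_fun setT (fun z : R * R => f (x - z.1 + z.2)) by apply: (mfun_comp mf); mfun.
    have m3 : measurable_fun setT (fun z : R * R => f (x - z.1 - z.2)) by apply: (mfun_comp mf); mfun.
    have m4 : measurable_fun setT (fun z : R * R => g z.1) by apply: (mfun_comp mg); mfun.
    by mfun.
  - by move=> y; exact: L1Zr (fK (x - y)).1.
  - move=> y; have [i iK] := fK (x - y).
    rewrite (eq_int mu (g := fun h => `|diff2 f (x - y) h * kern h| * `|g y|)); last first.
      by move=> h; rewrite /F normrM.
    by rewrite (intZr _ (L1_abs i)) ler_wpM2r.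
  - exact: L1Z (L1_abs gi).
have E h : \int[mu]_y F y h = diff2 (tconv f g) x h * kern h.
  have [i ->] := diff2_tconv x h cf tg; rewrite -(intZr _ i); apply: eq_int => y.
  by rewrite /F mulrAC.
have [i _] := L1prod_int1 Fi.
have E2 y : 2^-1 * (\int[mu]_h F y h) = fracD f (x - y) * g y.
  by rewrite /F (intZr _ (fK (x - y)).1) mulrA.
split.
- by have [i2 _] := L1prod_int1 (L1prod_swap Fi); apply: (eq_L1 _ i2) => h; exact: E.
- by apply: (eq_L1 _ (L1Z 2^-1 i)) => y; exact: E2.
- by rewrite /fracD -(eq_int mu E) -(int_exchange mu mu F Fi) -(intZ _ i); apply: eq_int => y; exact: E2.
Qed.

End fractional_decay.

(** * Calculus of powers of the absolute value *)

Section signed_powers.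
Context (R : realType).
Notation mu := (@lebesgue_measure R).
Implicit Types (p x y h r : R).

Lemma normr_powR_sqr p x : x != 0 -> x ^+ 2 * `|x| `^ (p - 2) = `|x| `^ p.
Proof.
move=> x0; have xp : 0 < `|x| by rewrite normr_gt0.
rewrite -(real_normK (num_real x)) -(powR_mulrn 2 (ltW xp)) -powRD; last first.
  by rewrite (gt_eqF xp) implybT.
by congr (_ `^ _); ring.
Qed.

Lemma der_abs_powR p x : x != 0 ->
  derat x (fun y => `|y| `^ p) (p * (x * `|x| `^ (p - 2))).
Proof.
move=> x0; have xp : 0 < `|x| by rewrite normr_gt0.
pose c := x / `|x|.
have cx : c * x = `|x|.
  by rewrite /c mulrAC -expr2 -(real_normK (num_real x)) expr2 mulfK// gt_eqF.
have d : derat x (fun y => (c * y) `^ p) ((0 * x + c * 1) * (p * (c * x) `^ (p - 1))).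
  by apply: der_powR; [der|rewrite cx].
apply: (der_near (der_val d _)).
  rewrite cx mul0r add0r mulr1 mulrCA; congr (_ * _).
  rewrite /c -mulrA; congr (_ * _).
  rewrite -(powR_inv1 (ltW xp)) -powRD; last by rewrite (gt_eqF xp) implybT.
  by congr (_ `^ _); ring.
have cy : {for x, continuous (fun y => c * y)}.
  have : derat x (fun y => c * y) (0 * x + c * 1) by der.
  exact: der_cont.
have n1 : \forall y \near x, 0 < c * y.
  by move/cvgr_gt : cy; apply; rewrite cx.
near=> y.
have cy0 : 0 < c * y by near: y.
have c1 : `|c| = 1 by rewrite /c normrM normfV normr_id divff// gt_eqF.
by rewrite -(gtr0_norm cy0) normrM c1 mul1r.
Unshelve. all: end_near. Qed.

Lemma der_sgn_powR p x : x != 0 ->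
  derat x (fun y => y * `|y| `^ p) ((1 + p) * `|x| `^ p).
Proof.
move=> x0; apply: (der_val (derM (der_id x) (der_abs_powR p x0))).
by rewrite -(normr_powR_sqr p x0); ring.
Qed.

Lemma powR_small p (e : R) : 0 < p -> 0 < e -> exists2 d : R, 0 < d &
  forall y, `|y| <= d -> `|y| `^ p <= e.
Proof.
move=> p0 e0; exists (e `^ p^-1); first exact: powR_gt0.
move=> y yd; have -> : e = (e `^ p^-1) `^ p.
  by rewrite -powRrM mulVf ?gt_eqF// powRr1// ltW.
by apply: ge0_ler_powR; rewrite ?nnegrE ?powR_ge0// ltW.
Qed.

Lemma continuous_abs_powR p : 0 < p -> continuous (fun y : R => `|y| `^ p).
Proof.
move=> p0 x; have [->|x0] := eqVneq x 0; last exact: der_cont (der_abs_powR p x0).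
apply/cvgrPdist_le => e e0.
have [d d0 hd] := powR_small p0 e0.
near=> y; rewrite normr0 powR0 ?gt_eqF// sub0r normrN ger0_norm ?powR_ge0//.
apply: hd; rewrite -(subr0 y) distrC; near: y.
by exists d => // z /ltW.
Unshelve. all: end_near. Qed.

Lemma der_sgn_powR0 p x : 0 < p -> derat x (fun y => y * `|y| `^ p) ((1 + p) * `|x| `^ p).
Proof.
move=> p0; have [->|x0] := eqVneq x 0; last exact: der_sgn_powR.
apply: der_cvg; rewrite normr0 powR0 ?gt_eqF// mulr0.
apply/cvgrPdist_le => e e0.
have [d d0 hd] := powR_small p0 e0.
near=> h; rewrite addr0 mulr0 subr0.
have h0 : h != 0 by near: h; exact: nbhs_dnbhs_neq.
rewrite mulKf// sub0r normrN ger0_norm ?powR_ge0//; apply: hd.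
by near: h; exact: dnbhs0_le.
Unshelve. all: end_near. Qed.

(** The fractions [x / (x + y)] and [y / (x + y)] have sum 1, and each is at most its own p-th
    power. *)
Lemma powR_subadd p x y : 0 < p -> p <= 1 -> 0 <= x -> 0 <= y ->
  (x + y) `^ p <= x `^ p + y `^ p.
Proof.
move=> p0 p1 x0 y0; have [xy|xy] := eqVneq (x + y) 0.
  by rewrite xy powR0 ?gt_eqF// addr_ge0 ?powR_ge0.
have s0 : 0 < x + y by rewrite lt_def xy addr_ge0.
have key z : 0 <= z -> z <= x + y -> z / (x + y) <= (z / (x + y)) `^ p.
  move=> z0 zs; have t0 : 0 <= z / (x + y) by rewrite divr_ge0// ltW.
  have [->|tn] := eqVneq (z / (x + y)) 0; first exact: powR_ge0.
  rewrite -[leLHS](powRr1 t0); apply: ger_powR => //.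
  by rewrite lt_def tn t0 ler_pdivrMr// mul1r.
have h z : 0 <= z -> z <= x + y -> z / (x + y) * (x + y) `^ p <= z `^ p.
  move=> z0 zs; apply: (le_trans (ler_wpM2r (powR_ge0 _ _) (key z z0 zs))).
  by rewrite -powRM ?divr_ge0 ?(ltW s0)// divfK.
have -> : (x + y) `^ p = x / (x + y) * (x + y) `^ p + y / (x + y) * (x + y) `^ p.
  by rewrite -mulrDl -mulrDl divff// mul1r.
by apply: lerD; apply: h => //; rewrite ?lerDl ?lerDr.
Qed.

Lemma abs_powR_sub p x y : 0 < p -> p <= 1 ->
  `| `|x - y| `^ p - `|x| `^ p | <= `|y| `^ p.
Proof.
move=> p0 p1.
have main (u v : R) : `|u| `^ p <= `|v| `^ p + `|u - v| `^ p.
  apply: le_trans (powR_subadd p0 p1 (normr_ge0 _) (normr_ge0 _)).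
  apply: ge0_ler_powR; rewrite ?nnegrE ?addr_ge0 ?(ltW p0)//.
  by have := ler_normD v (u - v); rewrite addrC subrK.
have h1 := main (x - y) x; have h2 := main x (x - y).
have e1 : x - y - x = - y by ring.
have e2 : x - (x - y) = y by ring.
move: h1 h2; rewrite e1 e2 normrN ler_norml => h1 h2; apply/andP; split; lra.
Qed.

End signed_powers.

(** * The fundamental solution through its primitive *)

Section fractional_laplacian_of_powers.
Context (R : realType) (a : R) (a0 : 0 < a) (a1 : a < 1).
Notation mu := (@lebesgue_measure R).
Notation kern := (@frac_kern R a).
Notation fracD := (@frac_op R a).
Notation D_bounded := (@D_bounded R a).
Notation tconv := (@tconv R).
Implicit Types (f g phi : R -> R) (x y h r : R).

Ltac alra := pose proof a0; pose proof a1; lra.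

(** The image of [|x|^a] would be a point mass. Its primitive is, up to a factor, the odd function
    A, homogeneous of degree [1 + a], which is the order of the operator; the image of A is
    therefore a bounded function, and the point mass is recovered by moving one derivative. *)
Let A x : R := x * `|x| `^ a.

Let dA x : derat x A ((1 + a) * `|x| `^ a). Proof. exact: der_sgn_powR0. Qed.

Let A_odd x : A (- x) = - A x. Proof. by rewrite /A normrN mulNr. Qed.

Let cA : continuous A. Proof. by move=> x; exact: der_cont (dA x). Qed.

(** A grows like [|h|^(1 + a)], too fast for the kernel alone. By oddness the second difference at 1
    is [2 + A (h - 1) - A (h + 1)], which is only of order [|h|^a]. Near h = 0 the point 1 stays
    away from the singularity of A'' at 0. *)
Let A1_bounded : L1 mu (fun h => diff2 A 1 h * kern h).
Proof.
have i1 : L1 mu (fun h : R => \1_`[-1, 1] h * `|h| `^ (- a)).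
  by apply: L1_powR_near0; apply/andP; split; alra.
have i2 := @L1_powR_infty R 2 ltac:(lra).
apply: (L1_le (L1D (L1Z 8 i1) (L1Z 162 i2))).
  have := measurable_diff2 1 (continuous_measurable_fun cA).
  by have := measurable_kern a => ? ?; mfun.
move=> h; rewrite normrM (ger0_norm (kern_ge0 _ _)).
have [h1|h1] := leP `|h| 2^-1.
  rewrite indic_in; last by rewrite /= in_itv/= -ler_norml; lra.
  rewrite mul1r ler_wpDr ?mulr_ge0 ?powR_ge0//.
  have zb z : `|z - 1| <= `|h| -> 2^-1 <= `|z| /\ z != 0.
    move=> hz; have zz : 2^-1 <= `|z|.
      by have := ler_normB z (z - 1); rewrite subKr normr1; lra.
    by split=> //; rewrite -normr_gt0; lra.
  apply: (@le_trans _ _ (2 * 4 * h ^+ 2 * kern h)).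
    apply: ler_wpM2r; first exact: kern_ge0.
    apply: (@diff2_bound2 _ A (fun x => (1 + a) * `|x| `^ a)
      (fun z => (1 + a) * (a * (z * `|z| `^ (a - 2)))) _ _ 4 dA) => z /zb[z1 z0].
      apply: (der_val (derM (der_cst z (1 + a)) (der_abs_powR a z0))).
      by rewrite mul0r add0r.
    have zp : 0 < `|z| by rewrite normr_gt0.
    rewrite !normrM (ger0_norm (powR_ge0 _ _)) (gtr0_norm a0) (gtr0_norm (_ : 0 < 1 + a)); last by alra.
    have -> : `|z| * `|z| `^ (a - 2) = `|z| `^ (a - 1).
      rewrite -[X in X * _]powRr1 ?(ltW zp)// -powRD; last by rewrite (gt_eqF zp) implybT.
      by congr (_ `^ _); ring.
    have p2 : `|z| `^ (a - 1) <= 2.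
      apply: (@le_trans _ _ (2^-1 `^ (a - 1))).
        rewrite -(opprB 1 a) !powRN lef_pV2 ?posrE ?powR_gt0//.
        by apply: ge0_ler_powR; rewrite ?nnegrE//; alra.
      rewrite -[leRHS]invrK -(powR_inv1 (_ : 0 <= 2^-1)); last by lra.
      by apply: ger_powR; [lra|alra].
    have := powR_ge0 `|z| (a - 1); pose proof a0; pose proof a1; nra.
  by have := kern_sqr a h; lra.
rewrite ler_wpDl ?mulr_ge0 ?powR_ge0 ?indicE//.
have hp : 0 < `|h| by lra.
have kt : kern h <= 27 * (1 + `|h|) `^ (- (2 + a)).
  rewrite /frac_kern; apply: (@le_trans _ _ ((3^-1 * (1 + `|h|)) `^ (- (2 + a)))).
    have q0 : 0 < 3^-1 * (1 + `|h|) by lra.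
    rewrite !powRN lef_pV2 ?posrE ?powR_gt0//.
    by apply: ge0_ler_powR; rewrite ?nnegrE//; alra.
  rewrite powRM ?invr_ge0//.
  apply: ler_wpM2r; first exact: powR_ge0.
  rewrite powR_inv_opp//.
  apply: (@le_trans _ _ (3 `^ 3)); last by rewrite powR_mulrn//; lra.
  by apply: ler_powR; [lra|alra].
have d : `|diff2 A 1 h| <= 6 * (1 + `|h|) `^ a.
  have -> : diff2 A 1 h = 2 + (A (h - 1) - A (h + 1)).
    by rewrite /diff2 -(opprB h 1) A_odd {1}/A normr1 powR1 (addrC 1 h); ring.
  have p1 : 1 <= (1 + `|h|) `^ a.
    by rewrite -[leLHS](powRr0 (1 + `|h|)); apply: ler_powR; [lra|alra].
  apply: (le_trans (ler_normD _ _)); rewrite normr_nat.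
  have : `|A (h - 1) - A (h + 1)| <= (1 + a) * (1 + `|h|) `^ a * `|h - 1 - (h + 1)|.
    have -> : A (h - 1) - A (h + 1) = (A (h - 1) - A h) - (A (h + 1) - A h) by ring.
    have B w : `|w - h| <= 1 -> `|A w - A h| <= (1 + a) * (1 + `|h|) `^ a * `|w - h|.
      move=> wh; apply: (mvt_bound (fun z _ => dA z)) => z zh.
      rewrite normrM (ger0_norm (powR_ge0 _ _)) gtr0_norm; last by alra.
      apply: ler_wpM2l; first by alra.
      apply: ge0_ler_powR; rewrite ?nnegrE//; first by alra.
      by have := ler_normD (z - h) h; rewrite subrK; lra.
    have := B (h - 1); have := B (h + 1).
    have -> : h - 1 - h = - 1 by ring.
    have -> : h + 1 - h = 1 by ring.
    rewrite normrN normr1 mulr1 => /(_ (lexx _)) b1 /(_ (lexx _)) b2.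
    apply: (le_trans (ler_normB _ _)).
    have -> : h - 1 - (h + 1) = - 2 by ring.
    by rewrite normrN normr_nat; lra.
  have -> : h - 1 - (h + 1) = - 2 by ring.
  by rewrite normrN normr_nat; pose proof a1; nra.
apply: (@le_trans _ _ (6 * (1 + `|h|) `^ a * (27 * (1 + `|h|) `^ (- (2 + a))))).
  by apply: ler_pM => //; exact: kern_ge0.
have -> : (1 + `|h|) `^ (- (2 + a)) = (1 + `|h|) `^ (- a) * (1 + `|h|) `^ (- 2).
  rewrite -powRD; last by rewrite implybE; apply/orP; right; rewrite gt_eqF//; lra.
  by congr (_ `^ _); ring.
have e1 : (1 + `|h|) `^ a * (1 + `|h|) `^ (- a) = 1.
  by rewrite powRN divff// gt_eqF// powR_gt0; lra.
rewrite le_eqVlt; apply/orP; left; apply/eqP.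
transitivity ((1 + `|h|) `^ a * (1 + `|h|) `^ (- a) * (162 * (1 + `|h|) `^ (- 2))).
  by ring.
by rewrite e1 mul1r.
Qed.

(* With A(x) = x |x|^a, scaling and oddness give D A = sgn * riesz_slope. *)
Definition riesz_slope : R := fracD (fun x => x * `|x| `^ a) 1.

Let KA : R := \int[mu]_h `|diff2 A 1 h * kern h|.

Let A_scaled x : x != 0 ->
  D_bounded A x (`|A x| * `|x| `^ (- (1 + a)) * KA) /\
  fracD A x = A x * `|x| `^ (- (1 + a)) * fracD A 1.
Proof.
move=> x0; have e : x^-1 * x = 1 by rewrite mulVf.
have b1 : D_bounded A (x^-1 * x) KA.
  by rewrite e; split; [exact: A1_bounded|exact: lexx].
have := D_bounded_scale (A x) x0 b1; rewrite e.
have -> : (fun z => A x * A (x^-1 * z)) = A.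
  by apply/funext => z; rewrite /A mulrACA -powRM// -normrM mulVKf.
exact: id.
Qed.

Let powR_cancel x : x != 0 -> `|x| * `|x| `^ a * `|x| `^ (- (1 + a)) = 1.
Proof.
move=> x0; have xp : 0 < `|x| by rewrite normr_gt0.
rewrite -[X in X * _ * _](powRr1 (ltW xp)) -!powRD.
  by rewrite subrr powRr0.
all: by rewrite (gt_eqF xp) implybT.
Qed.

Let A_bounded x : D_bounded A x KA.
Proof.
have [->|x0] := eqVneq x 0.
  have E h : diff2 A 0 h * kern h = 0.
    by rewrite /diff2 add0r sub0r A_odd {1}/A mul0r; ring.
  split; first by apply: (eq_L1 _ (@L10 _ _ _ mu)) => h; rewrite E.
  rewrite (eq_int mu (g := fun=> 0)); first by rewrite int0; exact: int_ge0.
  by move=> h; rewrite E normr0.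
have xp : 0 < `|x| by rewrite normr_gt0.
have [+ _] := A_scaled x0.
have -> : `|A x| * `|x| `^ (- (1 + a)) * KA = KA.
  by rewrite normrM (ger0_norm (powR_ge0 _ _)) (powR_cancel x0) mul1r.
exact: id.
Qed.

Let fracD_A x : fracD A x = Num.sg x * riesz_slope.
Proof.
have [->|x0] := eqVneq x 0.
  rewrite sgr0 mul0r /frac_op (eq_int mu (g := fun=> 0)) ?int0 ?mulr0// => h.
  by rewrite /diff2 add0r sub0r A_odd {1}/A mul0r; ring.
have xp : 0 < `|x| by rewrite normr_gt0.
have [_] := A_scaled x0.
move=> ->; rewrite -/riesz_slope; congr (_ * _).
have -> : A x = Num.sg x * (`|x| * `|x| `^ a) by rewrite mulrA -numEsg.
by rewrite -mulrA powR_cancel// mulr1.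
Qed.

Lemma tconv_ibp f f' g x : (forall y, derat y f (f' y)) -> continuous f' ->
  test_function g -> tconv f (derive1 g) x = tconv f' g x.
Proof.
move=> df cf' tg; have tg' := test_derive1 tg.
have cf : continuous f by move=> y; exact: der_cont (df y).
have i1 := L1_tconv x cf tg'; have i2 := L1_tconv x cf' tg.
apply/eqP; rewrite -subr_eq0 -(intB i1 i2); apply/eqP.
move/test_functionP : (tg) => [sg [T T0 hT]].
have hT' := support_derive1 hT.
have [] // := @int_der_compact R (fun y => f (x - y) * g y)
  (fun y => f (x - y) * derive1 g y - f' (x - y) * g y) T T0.
- move=> y; apply: der_val.
    by apply: derM; [apply: der_comp; [|exact: df]; der|exact: smooth_der].
  by rewrite /=; ring.
- move=> y; apply: cvgB; apply: cvgM.
  + exact: continuous_reflect.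
  + exact: test_continuous.
  + exact: continuous_reflect.
  + exact: test_continuous.
- by move=> y yT; rewrite hT ?mulr0.
- by move=> y yT; rewrite hT ?hT'// !mulr0 subrr.
Qed.

Lemma tconv_sgn g x : test_function g -> tconv Num.sg (derive1 g) x = 2 * g x.
Proof.
move=> tg; have tg' := test_derive1 tg.
move/test_functionP : (tg) => [sg [T T0 hT]].
pose b := T + `|x| + 1.
have xb : - b <= x <= b.
  by rewrite -ler_norml /b; lra.
have bT : T < b by have := normr_ge0 x; rewrite /b; lra.
case/andP: xb => xb1 xb2.
have dg y : derat y g (derive1 g y) by exact: smooth_der.
have cg := test_continuous tg'.
have [i1 e1] := @ftc_itv R g _ (- b) x xb1 (fun y _ => dg y) (fun y _ => cg y).
have [i2 e2] := @ftc_itv R g _ x b xb2 (fun y _ => dg y) (fun y _ => cg y).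
have b0 : 0 < b by lra.
have gb : g b = 0 by apply: hT; rewrite gtr0_norm.
have gb' : g (- b) = 0 by apply: hT; rewrite normrN gtr0_norm.
have -> : 2 * g x = (g x - g (- b)) - (g b - g x) by rewrite gb gb'; ring.
rewrite -e1 -e2 -(intB i1 i2); apply: eq_int => y.
have [yb|yb] := ltP b `|y|.
  have -> : derive1 g y = 0 by apply: (support_derive1 hT); lra.
  by rewrite !mulr0 subrr.
move: yb; rewrite ler_norml => /andP[y1 y2].
have [yx|yx|yx] := ltgtP y x.
- rewrite gtr0_sg ?subr_gt0// indic_in; last by rewrite /= in_itv/= y1 ltW.
  by rewrite indic_out ?mul0r ?subr0// /= in_itv/= y2 andbT leNgt yx.
- rewrite ltr0_sg ?subr_lt0// indic_out; last by rewrite /= in_itv/= y1/= leNgt yx.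
  by rewrite indic_in ?mul0r ?sub0r ?mulN1r ?mul1r// /= in_itv/= y2 ltW.
- rewrite yx subrr sgr0 mul0r !indic_in ?subrr// /= in_itv/= lexx ?xb2 ?andbT//.
Qed.

(** One derivative is moved: [|y|^a] convolved with g'' is [(1 + a)^-1] times A convolved with g'''.
    The operator turns A into a multiple of sgn, and sgn convolved with g''' is 2 g''. *)
Lemma fracD_tconv_powR g x : test_function g ->
  L1 mu (fun h => diff2 (tconv (fun y => `|y| `^ a) (derive1 (derive1 g))) x h * kern h) /\
  fracD (tconv (fun y => `|y| `^ a) (derive1 (derive1 g))) x =
    2 * riesz_slope / (1 + a) * derive1 (derive1 g) x.
Proof.
move=> tg; have t1 := test_derive1 tg; have t2 := test_derive1 t1; have t3 := test_derive1 t2.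
set g2 := derive1 (derive1 g) in t2 t3 *.
have a2 : 1 + a != 0 by rewrite gt_eqF//; alra.
have E : tconv (fun y => `|y| `^ a) g2 = (fun z => (1 + a)^-1 * tconv A (derive1 g2) z).
  apply/funext => z; rewrite (tconv_ibp _ dA _ t2); last first.
    move=> y; apply: cvgMl_tmp; exact: continuous_abs_powR.
  have i := L1_tconv z (continuous_abs_powR a0) t2.
  rewrite -(intZ _ ); last first.
    by apply: (eq_L1 _ (L1Z (1 + a) i)) => y; rewrite mulrA.
  by apply: eq_int => y; rewrite !mulrA mulVf// mul1r.
have [i _ e] := fracD_tconv x cA A_bounded t3.
have dE h : diff2 (fun z => (1 + a)^-1 * tconv A (derive1 g2) z) x h * kern h =
    (1 + a)^-1 * (diff2 (tconv A (derive1 g2)) x h * kern h).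
  by rewrite diff2Z mulrA.
rewrite E; split; first by apply: (eq_L1 _ (L1Z (1 + a)^-1 i)) => h; rewrite dE.
rewrite /frac_op (eq_int mu dE) (intZ _ i) mulrCA -/(frac_op a _ _) e.
rewrite (eq_int mu (g := fun y => riesz_slope * (Num.sg (x - y) * derive1 g2 y))); last first.
  by move=> y; rewrite fracD_A; ring.
rewrite intZ.
  by rewrite -/(tconv Num.sg (derive1 g2) x) (tconv_sgn x t2); ring.
have := @L1_bounded _ _ _ mu 1 (fun y => Num.sg (x - y)) _ _ _ (test_L1 t3); apply.
  by move=> y; rewrite normr_sg; case: (_ != _).
have -> : (fun y => Num.sg (x - y)) = (fun y => \1_[set y | y < x] y - \1_[set y | x < y] y).
  apply/funext => y; have [yx|yx|yx] := ltgtP y x.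
  - by rewrite gtr0_sg ?subr_gt0// indic_in// indic_out ?subr0//= ltNge ltW.
  - by rewrite ltr0_sg ?subr_lt0// indic_out ?sub0r ?indic_in//= ltNge ltW.
  - by rewrite yx subrr sgr0 !indic_out/= ?ltxx ?subrr.
by mfun.
Qed.

End fractional_laplacian_of_powers.

(** * The far part of the power and approximate test functions *)

Section outer_power.
Context (R : realType) (a : R) (a0 : 0 < a) (a1 : a < 1).
Notation mu := (@lebesgue_measure R).
Notation kern := (@frac_kern R a).
Notation fracD := (@frac_op R a).
Notation D_bounded := (@D_bounded R a).
Notation tconv := (@tconv R).
Implicit Types (f g phi : R -> R) (x y h r : R).

Ltac alra := pose proof a0; pose proof a1; lra.

Lemma diff2_sub (F f g : R -> R) x h : (forall z, F z = f z - g z) ->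
  diff2 F x h = diff2 f x h - diff2 g x h.
Proof. by move=> E; rewrite /diff2 !E; ring. Qed.

(** On [|x| <= 2] the function coincides with its product by [cutoff (x / 2)], which is continuous
    with compact support, hence bounded. *)
Lemma decay_extend f (p C : R) : continuous f -> 0 <= p -> 0 <= C ->
  (forall x, 2 < `|x| -> `|f x| <= C * `|x| `^ (- p)) ->
  exists2 B, 0 <= B & forall x, `|f x| <= B * (1 + `|x|) `^ (- p).
Proof.
move=> cf p0 C0 hf.
have cc : continuous (fun x => f x * @cutoff R (2^-1 * x)).
  move=> x; have d : derat x (fun x => 2^-1 * x) (0 * x + 2^-1 * 1) by der.
  have c := der_cont (der_comp d (smooth_der _ (@smooth_cutoff R))).
  by apply: cvgM; [exact: cf|exact: c].
have z4 x : 4 < `|x| -> f x * @cutoff R (2^-1 * x) = 0.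
  by move=> x4; rewrite (@cutoff0 R (2^-1 * x)) ?mulr0// normrM ger0_norm ?invr_ge0//; lra.
have [B B0 hB] := bounded_compact cc z4.
exists (B * 3 `^ p + C * 2 `^ p) => [|x].
  by rewrite addr_ge0// mulr_ge0 ?powR_ge0 ?(ltW B0).
have x0 := normr_ge0 x; have x1 : 0 < 1 + `|x| by lra.
have [x2|x2] := leP `|x| 2.
  have -> : f x = f x * @cutoff R (2^-1 * x).
    by rewrite cutoff1 ?mulr1// normrM ger0_norm ?invr_ge0//; lra.
  apply: (le_trans (hB x)); rewrite powRN ler_pdivlMr ?powR_gt0//.
  rewrite ler_wpDr ?mulr_ge0 ?powR_ge0// ler_wpM2l ?(ltW B0)//.
  by apply: ge0_ler_powR; rewrite ?nnegrE//; lra.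
apply: (le_trans (hf x x2)).
rewrite mulrDl ler_wpDl ?mulr_ge0 ?powR_ge0 ?(ltW B0)// -mulrA ler_wpM2l//.
rewrite -(@powR_inv_opp _ 2)// -powRM ?invr_ge0// !powRN.
have q0 : 0 < 2^-1 * (1 + `|x|) by lra.
rewrite lef_pV2 ?posrE ?powR_gt0//; last by lra.
by apply: ge0_ler_powR; rewrite ?nnegrE//; lra.
Qed.

(** The power [|x|^a] with its singularity removed: smooth, with a second derivative of order
    [|x|^(a - 2)], integrable because a < 1. *)
Definition outer_powR x : R := `|x| `^ a * (1 - cutoff x).

Notation k1 := outer_powR.

Lemma smooth_outer_powR : smooth k1.
Proof.
(* The base [x^2 + cutoff (2 x)] is positive everywhere and equals [x^2] for [|x| >= 1], while the
   second factor vanishes for [|x| <= 1]; so the power is that of a positive smooth function. *)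
have E : k1 = fun x => (x ^+ 2 + @cutoff R (2 * x + 0)) `^ (a / 2) * (1 + - cutoff x).
  apply/funext => x; rewrite /k1 addr0; have [x1|x1] := leP `|x| 1.
    by rewrite cutoff1// subrr !mulr0.
  rewrite (@cutoff0 R (2 * x)) ?addr0; last by rewrite normrM ger0_norm//; lra.
  rewrite -(real_normK (num_real x)) -powR_mulrn// -powRrM; congr (_ `^ _ * _).
  by field.
rewrite E; apply/smoothP => n; apply: ndiffM; last first.
  by apply: ndiffD; [exact: ndiff_cst|apply: ndiffN; exact: ndiff_cutoff].
apply: ndiff_powR => [x|].
  rewrite addr0; have [x1|x1] := leP `|x| 2^-1.
    by rewrite cutoff1 ?ltr_wpDl ?sqr_ge0// normrM ger0_norm//; lra.
  by rewrite ltr_pwDl ?cutoff_ge0// exprn_even_gt0//= -normr_gt0; lra.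
apply: ndiffD; last by apply: ndiff_affine; exact: ndiff_cutoff.
have -> : (fun x : R => x ^+ 2) = (fun x => x * x) by apply/funext => x; rewrite expr2.
by apply: ndiffM; exact: ndiff_id.
Qed.

Let far_der f g g' : (forall x, 2 < `|x| -> f x = g x) ->
  (forall x, x != 0 -> derat x g (g' x)) -> forall x, 2 < `|x| -> derive1 f x = g' x.
Proof.
move=> fg dg x x2; apply: der_derive1.
have x0 : x != 0 by rewrite -normr_gt0; lra.
apply: (der_near (dg x x0)).
near=> y; rewrite fg//; near: y.
apply: (cvgr_gt `|x|) => //; exact: norm_continuous.
Unshelve. all: end_near. Qed.

Let m := derive1 (derive1 k1).

Let smooth_m : smooth m.
Proof. by do 2 apply: smooth_derive1; exact: smooth_outer_powR. Qed.

Let k1_far x : 2 < `|x| -> k1 x = `|x| `^ a.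
Proof. by move=> x2; rewrite /k1 cutoff0 ?subr0 ?mulr1// ltW. Qed.

Let k1'_far x : 2 < `|x| -> derive1 k1 x = a * (x * `|x| `^ (a - 2)).
Proof. by move=> x2; apply: (far_der (g' := fun x => a * (x * `|x| `^ (a - 2))) k1_far) => // y; exact: der_abs_powR. Qed.

Let m_far x : 2 < `|x| -> m x = a * (a - 1) * `|x| `^ (a - 2).
Proof.
move=> x2; rewrite /m (far_der k1'_far (fun y yn => derM (der_cst y a) (der_sgn_powR (a - 2) yn)))//.
by rewrite mul0r add0r mulrA; congr (_ * _); ring.
Qed.

Let m'_far x : 2 < `|x| ->
  derive1 m x = a * (a - 1) * (a - 2) * (x * `|x| `^ (a - 4)).
Proof.
move=> x2; rewrite (far_der m_far (fun y yn => derM (der_cst y (a * (a - 1))) (der_abs_powR (a - 2) yn)))//.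
by rewrite mul0r add0r mulrA; congr (_ * (_ * _ `^ _)); ring.
Qed.

Let m''_far x : 2 < `|x| ->
  derive1 (derive1 m) x = a * (a - 1) * (a - 2) * (a - 3) * `|x| `^ (a - 4).
Proof.
move=> x2; rewrite (far_der m'_far (fun y yn => derM (der_cst y (a * (a - 1) * (a - 2))) (der_sgn_powR (a - 4) yn)))//.
by rewrite mul0r add0r mulrA; congr (_ * _); ring.
Qed.

Lemma outer_powR_decay : exists B : R, [/\ 0 <= B, L1 mu m,
  forall x, `|m x| <= B &
  forall x, D_bounded m x (B * (1 + `|x|) `^ (- (2 + a)))].
Proof.
have [B B0 hB] : exists2 B, 0 <= B & forall x, `|m x| <= B * (1 + `|x|) `^ (- (2 - a)).
  apply: (@decay_extend m (2 - a) 1) => //; first exact: smooth_continuous smooth_m.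
    by alra.
  move=> x x2; rewrite m_far// normrM opprB (ger0_norm (powR_ge0 _ _)) ler_wpM2r ?powR_ge0//.
  by rewrite normrM (gtr0_norm a0) ltr0_norm; [pose proof a0; pose proof a1; nra|alra].
have [C C0 hC] : exists2 B, 0 <= B & forall x, `|derive1 (derive1 m) x| <= B * (1 + `|x|) `^ (- (4 - a)).
  apply: (@decay_extend _ (4 - a) 6); [|by alra|exact: ler0n|].
    by apply: smooth_continuous; do 2 apply: smooth_derive1.
  move=> x x2; rewrite m''_far// normrM opprB (ger0_norm (powR_ge0 _ _)) ler_wpM2r ?powR_ge0//.
  rewrite 3!normrM (gtr0_norm a0) !ltr0_norm; [|alra|alra|alra].
  have h1 : 0 <= a * - (a - 1) <= 1 by pose proof a0; pose proof a1; apply/andP; split; nra.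
  have h2 : 0 <= - (a - 2) * - (a - 3) <= 6 by pose proof a0; pose proof a1; apply/andP; split; nra.
  rewrite -mulrA; case/andP: h1 => h1 h1'; case/andP: h2 => h2 h2'.
  by rewrite -[leRHS]mul1r; apply: ler_pM.
have mi : L1 mu m.
  apply: (L1_le (L1Z B (@L1_powR_infty R (2 - a) ltac:(alra)))) => //.
  exact: continuous_measurable_fun (smooth_continuous smooth_m).
have w1 x : (1 <= 1 + `|x| :> R) by rewrite lerDl.
have mB x : `|m x| <= (B + C) / (1 + `|x|).
  apply: (le_trans (hB x)); apply: ler_pM => //; first by lra.
  have x1 : 0 <= 1 + `|x| by have := w1 x; lra.
  rewrite -(powR_inv1 x1); apply: ler_powR => //; alra.
have mC x : `|derive1 (derive1 m) x| <= (B + C) / (1 + `|x|) ^+ 3.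
  apply: (le_trans (hC x)); apply: ler_pM => //; first by lra.
  have x1 : 0 <= 1 + `|x| by have := w1 x; lra.
  rewrite -(powR_invn 3 x1); apply: ler_powR => //; alra.
have [K K0 hK] := @fracD_decay R a a0 a1 m _ _ (B + C) (addr_ge0 B0 C0) mi
  (fun x => smooth_der x smooth_m) (fun x => smooth_der x (smooth_derive1 smooth_m)) mB mC.
exists (B + C + K); split; [by rewrite !addr_ge0|exact: mi| |].
  move=> x; apply: (le_trans (mB x)); rewrite ler_pdivrMr; last by have := w1 x; lra.
  by have := w1 x; nra.
move=> x; have [i iK] := hK x; split=> //; apply: (le_trans iK).
by rewrite ler_wpM2r ?powR_ge0//; lra.
Qed.

Lemma weight_shift x y (T p : R) : 0 <= T -> `|y| <= T -> 0 <= p ->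
  (1 + `|x - y|) `^ (- p) <= (1 + T) `^ p * (1 + `|x|) `^ (- p).
Proof.
move=> T0 yT p0; have x0 := normr_ge0 x; have xy0 := normr_ge0 (x - y).
have T1 : 0 < 1 + T by lra.
rewrite -(powR_inv_opp _ T1) -powRM ?invr_ge0 ?(ltW T1)//.
have q0 : 0 < (1 + T)^-1 * (1 + `|x|) by rewrite mulr_gt0 ?invr_gt0//; lra.
have q1 : (1 + T)^-1 * (1 + `|x|) <= 1 + `|x - y|.
  rewrite ler_pdivrMl//; have := ler_normD (x - y) y; rewrite subrK; nra.
have q2 : 0 < 1 + `|x - y| by lra.
rewrite !powRN lef_pV2 ?posrE ?powR_gt0//.
by apply: ge0_ler_powR; rewrite ?nnegrE ?(ltW q0) ?(ltW q2).
Qed.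

(* phi = (|x|^a - r^a k1(x / r)) * g'': the subtracted far part contributes an
   error that vanishes as r grows, because k1'' decays. *)
Lemma approx_test g : test_function g -> exists2 C : R, 0 <= C & forall r, 1 <= r ->
  exists phi, [/\ test_function phi,
    forall x, `|fracD phi x - 2 * riesz_slope a / (1 + a) * derive1 (derive1 g) x| <=
      C * r `^ (a - 1) * (1 + `|x|) `^ (- (2 + a)) &
    forall x, `|phi x - tconv (fun y => `|y| `^ a) (derive1 (derive1 g)) x| <= C * r `^ (a - 1)].
Proof.
move=> tg; have t1 := test_derive1 tg; have t2 := test_derive1 t1.
have [B [B0 mi mB mD]] := outer_powR_decay.
have gi := test_L1 tg; pose N := \int[mu]_y `|g y|.
have N0 : 0 <= N by exact: int_ge0.
move/test_functionP : (tg) => [sg [T T0 hT]].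
pose C := B * (1 + T) `^ (2 + a) * N + B * N.
have C0 : 0 <= C by rewrite addr_ge0// !mulr_ge0 ?powR_ge0.
exists C => // r r1; have r0 : 0 < r by lra.
have rn : r != 0 by rewrite gt_eqF.
pose mr (z : R) : R := r `^ (a - 2) * m (r^-1 * z).
pose kr (z : R) : R := r `^ a * k1 (r^-1 * z).
pose psi (z : R) : R := `|z| `^ a * @cutoff R (r^-1 * z).
have krE z : kr z = `|z| `^ a - psi z.
  rewrite /kr /k1 /psi mulrA -powRM ?(ltW r0)// -[X in X * `|_|](gtr0_norm r0) -normrM.
  by rewrite mulVKf//; ring.
have cG : continuous (fun z : R => `|z| `^ a) by exact: continuous_abs_powR.
have aff z : derat z (fun z => r^-1 * z) r^-1.
  by apply: der_val; [der|rewrite mul0r add0r mulr1].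
have cmr : continuous mr.
  move=> z; apply: der_cont; apply: (derM (der_cst z _)).
  exact: (der_comp (aff z) (smooth_der _ smooth_m)).
have dk z : derat z kr (r `^ (a - 1) * derive1 k1 (r^-1 * z)).
  apply: der_val.
    apply: (derM (der_cst z _)); exact: (der_comp (aff z) (smooth_der _ smooth_outer_powR)).
  rewrite mul0r add0r mulrA; congr (_ * _).
  rewrite powRD; last by rewrite rn implybT.
  by rewrite powR_inv1// ltW.
have dk' z : derat z (fun z => r `^ (a - 1) * derive1 k1 (r^-1 * z)) (mr z).
  apply: der_val.
    apply: (derM (der_cst z _)); apply: (der_comp (aff z) (smooth_der _ _)).
    exact: smooth_derive1 smooth_outer_powR.
  rewrite mul0r add0r mulrA; congr (_ * _).
  have -> : a - 2 = (a - 1) - 1 by ring.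
  rewrite [RHS]powRD; last by rewrite rn implybT.
  by rewrite powR_inv1// ltW.
have ck z : {for z, continuous kr} := der_cont (dk z).
have ck' : continuous (fun z => r `^ (a - 1) * derive1 k1 (r^-1 * z)).
  by move=> z; exact: der_cont (dk' z).
(* Both derivatives move from g to the far part, whose second derivative [mr] carries the small
   factor [r^(a - 2)]. *)
have tk x : tconv kr (derive1 (derive1 g)) x = tconv mr g x.
  by rewrite (tconv_ibp x dk ck' t1) (tconv_ibp x dk' cmr tg).
have cpsi : continuous psi.
  have -> : psi = fun z => `|z| `^ a - kr z by apply/funext => z; rewrite krE; ring.
  by move=> z; apply: cvgB; [exact: cG|exact: ck].
have psi0 z : 2 * r < `|z| -> psi z = 0.
  move=> z2; rewrite /psi cutoff0 ?mulr0// normrM normfV (gtr0_norm r0) mulrC.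
  by rewrite ler_pdivlMr// ltW.
have psii : L1 mu psi := L1_compact cpsi psi0.
have E x : convol psi (derive1 (derive1 g)) x =
    tconv (fun y => `|y| `^ a) (derive1 (derive1 g)) x - tconv mr g x.
  have [B2 B20 hB2] := test_bounded t2.
  rewrite convolC; last exact: L1_convol psii (continuous_measurable_fun (test_continuous t2)) hB2.
  rewrite -tk /tconv -(intB (L1_tconv x cG t2) (L1_tconv x ck t2)); apply: eq_int => y.
  by rewrite krE; ring.
have rp : r `^ (a - 2) * r `^ (- (1 + a)) * r `^ (2 + a) = r `^ (a - 1).
  rewrite -!powRD; [|by rewrite rn implybT|by rewrite rn implybT].
  by congr (_ `^ _); ring.
have mrD x : D_bounded mr x (B * r `^ (a - 1) * (1 + `|x|) `^ (- (2 + a))).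
  have [[i iK] _] := D_bounded_scale (r `^ (a - 2)) rn (mD (r^-1 * x)).
  split=> //; apply: (le_trans iK).
  rewrite (ger0_norm (powR_ge0 _ _)) (gtr0_norm r0) -rp.
  have x0 := normr_ge0 x.
  have h : (1 + `|r^-1 * x|) `^ (- (2 + a)) <= r `^ (2 + a) * (1 + `|x|) `^ (- (2 + a)).
    rewrite -(powR_inv_opp _ r0) -powRM ?invr_ge0 ?(ltW r0)//.
    have q0 : 0 < r^-1 * (1 + `|x|) by rewrite mulr_gt0 ?invr_gt0//; lra.
    have q1 : r^-1 * (1 + `|x|) <= 1 + `|r^-1 * x|.
      rewrite normrM normfV (gtr0_norm r0) mulrDr mulr1 lerD2r invf_le1//.
    have q2 : 0 < 1 + `|r^-1 * x| by lra.
    rewrite !powRN lef_pV2 ?posrE ?powR_gt0//.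
    by apply: ge0_ler_powR; rewrite ?nnegrE ?(ltW q0) ?(ltW q2)//; alra.
  have := ler_wpM2l (mulr_ge0 (mulr_ge0 (powR_ge0 r (a - 2)) (powR_ge0 r (- (1 + a)))) B0) h.
  by rewrite !mulrA => /le_trans; apply; rewrite le_eqVlt; apply/orP; left; apply/eqP; ring.
have mrD' x : D_bounded mr x (B * r `^ (a - 1)).
  have [i iK] := mrD x; split=> //; apply: (le_trans iK).
  rewrite ler_piMr ?mulr_ge0 ?powR_ge0//.
  rewrite powRN invf_le1 ?powR_gt0//.
  rewrite -[leLHS](powRr0 (1 + `|x|)); apply: ler_powR; first by rewrite lerDl.
  by alra.
exists (convol psi (derive1 (derive1 g))); split.
- by apply: test_convol psii _ psi0 t2; rewrite mulr_ge0// ltW.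
- move=> x; have [i1 e1] := fracD_tconv_powR a0 a1 x tg.
  have [i2 i3 e2] := fracD_tconv x cmr mrD' tg.
  have -> : fracD (convol psi (derive1 (derive1 g))) x =
      2 * riesz_slope a / (1 + a) * derive1 (derive1 g) x - fracD (tconv mr g) x.
    rewrite -e1 /frac_op -mulrBr -(intB i1 i2); congr (_ * _); apply: eq_int => h.
    exact: etrans (congr1 (fun t => t * kern h) (diff2_sub x h E)) (mulrBl _ _ _).
  rewrite addrAC addrN add0r normrN e2.
  apply: (le_trans (_ : _ <= \int[mu]_y (B * (1 + T) `^ (2 + a) * r `^ (a - 1) * (1 + `|x|) `^ (- (2 + a)) * `|g y|))); last first.
    rewrite (intZ _ (L1_abs gi)) -/N mulrAC (mulrAC _ _ N) ler_wpM2r ?powR_ge0//.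
    by rewrite ler_wpM2r ?powR_ge0// /C lerDl mulr_ge0.
  apply: int_abs_le_bound (L1Z _ (L1_abs gi)) _; first exact: i3.
  move=> y; rewrite normrM; have [yT|yT] := ltP T `|y|; first by rewrite hT// normr0 !mulr0.
  rewrite ler_wpM2r//; have := fracD_le (mrD (x - y)).
  have p0 : 0 <= 2 + a by rewrite addr_ge0 ?(ltW a0).
  have h := weight_shift x T0 yT p0.
  move=> h2; apply: (le_trans h2); have q : 0 <= B * r `^ (a - 1) by rewrite mulr_ge0 ?powR_ge0.
  have u1 := mulr_ge0 q (powR_ge0 (1 + `|x - y|) (- (2 + a))).
  rewrite (mulrAC B (_ `^ (2 + a))) -[leRHS]mulrA; apply: le_trans (ler_wpM2l q h).
  by rewrite ler_piMl// invf_le1// ler1n.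
- move=> x; rewrite E addrAC addrN add0r normrN.
  apply: (le_trans (_ : _ <= \int[mu]_y (B * r `^ (a - 1) * `|g y|))); last first.
    rewrite (intZ _ (L1_abs gi)) -/N mulrAC ler_wpM2r ?powR_ge0// /C lerDr.
    by rewrite !mulr_ge0 ?powR_ge0.
  apply: int_abs_le_bound (L1Z _ (L1_abs gi)) _; first exact: L1_tconv.
  move=> y; rewrite normrM ler_wpM2r// /mr normrM (ger0_norm (powR_ge0 _ _)) mulrC.
  apply: ler_pM => //; first exact: powR_ge0.
  by apply: ler_powR => //; lra.
Qed.

End outer_power.

(** * Integral representation of solutions *)

Section potentials.
Context (R : realType) (a : R) (a0 : 0 < a) (a1 : a < 1).
Notation mu := (@lebesgue_measure R).
Notation tconv := (@tconv R).
Implicit Types (f g rho v : R -> R) (x y z h r : R).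

Ltac alra := pose proof a0; pose proof a1; lra.

(* Subtracting |x|^a makes the potential of every integrable density finite. *)
Definition riesz x y : R := `|x - y| `^ a - `|x| `^ a.

Definition potential rho y : R := \int[mu]_x (rho x * riesz x y).

Lemma riesz_le x y : `|riesz x y| <= `|y| `^ a.
Proof. exact: abs_powR_sub a0 (ltW a1). Qed.

Lemma riesz_sub x y z : `|riesz x y - riesz x z| <= `|y - z| `^ a.
Proof.
have -> : riesz x y - riesz x z = `|(x - z) - (y - z)| `^ a - `|x - z| `^ a.
  by rewrite /riesz; have -> : x - z - (y - z) = x - y; ring.
exact: abs_powR_sub a0 (ltW a1).
Qed.

Lemma measurable_riesz y : measurable_fun setT (riesz ^~ y).
Proof. by rewrite /riesz; mfun. Qed.

Lemma L1_riesz rho y : L1 mu rho -> L1 mu (fun x => rho x * riesz x y).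
Proof.
move=> ri; have := @L1_bounded _ _ _ mu (`|y| `^ a) (riesz ^~ y) rho
  (fun x => riesz_le x y) (measurable_riesz y) ri.
by apply: eq_L1 => x; rewrite mulrC.
Qed.

Lemma potential_sub rho y z : L1 mu rho ->
  `|potential rho y - potential rho z| <= `|y - z| `^ a * \int[mu]_x `|rho x|.
Proof.
move=> ri; have iy := L1_riesz y ri; have iz := L1_riesz z ri.
rewrite /potential -(intB iy iz) -(intZ _ (L1_abs ri)).
apply: int_abs_le_bound (L1B iy iz) (L1Z _ (L1_abs ri)) _ => x.
by rewrite -mulrBr normrM mulrC ler_wpM2r// riesz_sub.
Qed.

Lemma continuous_potential rho : L1 mu rho -> continuous (potential rho).
Proof.
move=> ri x; apply/cvgrPdist_le => e e0; set M := \int[mu]_x `|rho x|.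
have M0 : 0 <= M by exact: int_ge0.
have e1 : 0 < e / (M + 1) by rewrite divr_gt0//; lra.
have [d d0 hd] := powR_small a0 e1.
near=> y; apply: (le_trans (potential_sub x y ri)); rewrite -/M.
have h : `|x - y| `^ a <= e / (M + 1).
  by apply: hd; near: y; exists d => // z /ltW.
apply: (le_trans (ler_wpM2r M0 h)); rewrite mulrAC ler_pdivrMr; last by lra.
by rewrite ler_wpM2l ?(ltW e0)//; lra.
Unshelve. all: end_near. Qed.

Lemma potential_le rho y : L1 mu rho ->
  `|potential rho y| <= `|y| `^ a * \int[mu]_x `|rho x|.
Proof.
move=> ri; rewrite -(intZ _ (L1_abs ri)).
apply: int_abs_le_bound (L1_riesz y ri) (L1Z _ (L1_abs ri)) _ => x.
by rewrite normrM mulrC ler_wpM2r// riesz_le.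
Qed.

(** The mass M outside [|x| <= n] is below M / 4, and there the kernel is at least [- |y|^a].
    Inside, the kernel is at least [|y|^a - 2 n^a]. The coefficient of [|y|^a] is thus at least
    [M - 2 (M / 4)]. *)
Lemma potential_ge rho : L1 mu rho -> (forall x, 0 <= rho x) -> 0 < \int[mu]_x rho x ->
  exists C : R, forall y, (\int[mu]_x rho x) / 2 * `|y| `^ a - C <= potential rho y.
Proof.
move=> ri r0 M0; set M := \int[mu]_x rho x in M0 *.
have M4 : 0 < M / 4 by lra.
have [n hn] := int_tail ri M4.
pose I x : R := \1_[set y : R | n%:R < `|y|] x.
have Ii : L1 mu (fun x => I x * `|rho x|).
  by apply: L1_indicM; [mfun|exact: L1_abs].
exists (2 * n%:R `^ a * M) => y; set Y := `|y| `^ a.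
have Y0 : 0 <= Y by exact: powR_ge0.
apply: (@le_trans _ _ (\int[mu]_x (Y * rho x - 2 * Y * (I x * `|rho x|) - 2 * n%:R `^ a * rho x))).
  rewrite (intB (L1B (L1Z Y ri) (L1Z (2 * Y) Ii)) (L1Z (2 * n%:R `^ a) ri)).
  rewrite (intB (L1Z Y ri) (L1Z (2 * Y) Ii)) (intZ _ ri) (intZ _ Ii) (intZ _ ri) -/M.
  have := ler_wpM2l Y0 (ltW hn); set J := \int[mu]_x _; move=> h.
  lra.
apply: int_le (L1_riesz y ri) _.
  exact: L1B (L1B (L1Z Y ri) (L1Z (2 * Y) Ii)) (L1Z (2 * n%:R `^ a) ri).
move=> x; rewrite (ger0_norm (r0 x)).
have -> : Y * rho x - 2 * Y * (I x * rho x) - 2 * n%:R `^ a * rho x =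
  rho x * (Y - 2 * Y * I x - 2 * n%:R `^ a) by ring.
apply: ler_wpM2l => //; have na := powR_ge0 (n%:R : R) a.
have [xn|xn] := ltP n%:R `|x|.
  rewrite /I indic_in//; have := riesz_le x y; rewrite -/Y ler_norml => /andP[h _]; lra.
rewrite /I indic_out/=; last by rewrite /= ltNge xn.
have h1 : `|x| `^ a <= n%:R `^ a.
  by apply: ge0_ler_powR; rewrite ?nnegrE//; alra.
have h2 : Y <= `|x - y| `^ a + `|x| `^ a.
  have := abs_powR_sub (x - y) (- y) a0 (ltW a1).
  have := abs_powR_sub (- y) (- x) a0 (ltW a1).
  rewrite !normrN; have -> : - y - - x = x - y by ring.
  by rewrite -/Y ler_norml => /andP[h3 h4] _; lra.
rewrite /riesz; lra.
Qed.

Lemma test_int_derive1 g : test_function g -> \int[mu]_x (derive1 g x) = 0.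
Proof.
move=> tg; have t' := test_derive1 tg.
move/test_functionP : (tg) => [sg [T T0 hT]].
have [] // := @int_der_compact R g (derive1 g) T T0 (fun x => smooth_der x sg).
- exact: test_continuous.
- exact: support_derive1.
Qed.

(** The subtracted [|x|^a] does not depend on y and drops out, because [derive1 g] has integral
    0. *)
Lemma potential_pairing rho g : L1 mu rho -> test_function g ->
  L1 mu (fun x => rho x * tconv (fun y => `|y| `^ a) (derive1 g) x) /\
  \int[mu]_x (rho x * tconv (fun y => `|y| `^ a) (derive1 g) x) =
  \int[mu]_y (potential rho y * derive1 g y).
Proof.
move=> ri tg; have t' := test_derive1 tg; have gi := test_L1 t'.
have ca := @continuous_abs_powR R a a0.
have wi : L1 mu (fun y => `|y| `^ a * `|derive1 g y|).
  move/test_functionP : (t') => [sg [T T0 hT]].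
  apply: (@L1_compact _ _ T) => [y|y yT]; last by rewrite hT// normr0 mulr0.
  apply: cvgM; first exact: ca.
  by apply: cvg_norm; exact: test_continuous t' _.
have mr := L1_measurable ri; have mg := L1_measurable gi.
pose F x y := rho x * (riesz x y * derive1 g y).
have Fyi x : L1 mu (fun y => riesz x y * derive1 g y).
  apply: (L1_le wi); first by rewrite /riesz; mfun.
  by move=> y; rewrite normrM ler_wpM2r// riesz_le.
have Fi : L1prod mu mu F.
  apply: (@L1prodP _ _ _ _ _ mu mu F (fun x => `|rho x| * \int[mu]_y (`|y| `^ a * `|derive1 g y|))).
  - rewrite /F /riesz.
    have m1 : measurable_fun setT (fun z : R * R => rho z.1) by apply: (mfun_comp mr); mfun.
    have m2 : measurable_fun setT (fun z : R * R => derive1 g z.2) by apply: (mfun_comp mg); mfun.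
    by mfun.
  - by move=> x; exact: L1Z (Fyi x).
  - move=> x; rewrite (eq_int mu (f := fun y => `|F x y|) (g := fun y => `|rho x| * `|riesz x y * derive1 g y|)); last first.
      by move=> y; rewrite /F normrM.
    rewrite (intZ _ (L1_abs (Fyi x))) ler_wpM2l//.
    by apply: int_le (L1_abs (Fyi x)) wi _ => y; rewrite normrM ler_wpM2r// riesz_le.
  - exact: L1Zr (L1_abs ri).
have E x : \int[mu]_y F x y = rho x * tconv (fun y => `|y| `^ a) (derive1 g) x.
  rewrite /F (intZ _ (Fyi x)); congr (_ * _).
  have i1 := L1_tconv x ca t'.
  rewrite (eq_int mu (g := fun y => `|x - y| `^ a * derive1 g y - `|x| `^ a * derive1 g y)); last first.
    by move=> y; rewrite /riesz mulrBl.
  by rewrite (intB i1 (L1Z _ gi)) (intZ _ gi) (test_int_derive1 tg) mulr0 subr0.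
have [i e] := L1prod_int1 Fi; split.
  by apply: (eq_L1 _ i) => x; exact: E.
rewrite -(eq_int mu E) (int_exchange mu mu F Fi); apply: eq_int => y.
rewrite /potential -(intZr _ (L1_riesz y ri)); apply: eq_int => x.
by rewrite /F mulrA.
Qed.

End potentials.

(** * Continuous representatives and growth of powers *)

Section almost_everywhere_and_growth.
Context (R : realType).
Notation mu := (@lebesgue_measure R).
Implicit Types (f g v : R -> R) (x y p A B : R).

Lemma continuous_ae_eq f g : continuous f -> continuous g ->
  {ae mu, forall x, f x = g x} -> f = g.
Proof.
move=> cf cg fg; apply/funext => x0; apply/eqP; rewrite -subr_eq0; apply: contraT => n0.
pose h x := (f x - g x) ^+ 2 * @cutoff R (1 * x + (- x0)).
have t1 := @test_affine R _ 1 (- x0) (oner_neq0 _) (test_cutoff R).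
have ch : continuous h.
  move=> x; have c1 : (f y - g y) @[y --> x] --> f x - g x.
    by apply: cvgB; [exact: cf|exact: cg].
  apply: cvgM; last exact: test_continuous t1 x.
  exact: (cvgM c1 c1).
have hi : L1 mu h.
  move/test_functionP : t1 => [_ [T T0 hT]].
  by apply: (@L1_compact _ h T ch) => x xT; rewrite /h (hT x xT) mulr0.
have h0 x : 0 <= h x by rewrite mulr_ge0 ?sqr_ge0 ?cutoff_ge0.
have hx0 : 0 < h x0.
  by rewrite /h mul1r subrr cutoff1 ?normr0// mulr1 exprn_even_gt0.
have := int_gt0 hi h0 (ch x0) hx0.
have -> : \int[mu]_x h x = 0.
  rewrite -[RHS](@int0 _ _ _ mu); apply: ae_eq_int; first exact: L1_measurable hi.
    exact: measurable_cst.
  apply: (@filterS _ _ (ae_filter_ringOfSetsType mu)) fg => x; rewrite /h => ->.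
  by rewrite subrr expr0n mul0r.
by rewrite ltxx.
Qed.

Lemma locally_integrableZ (k : R) f : locally_integrable setT f ->
  locally_integrable setT (fun x => k * f x).
Proof.
move=> [mf oT h]; split=> //; first by mfun.
move=> K KT cK; have mK : measurable K := compact_measurable cK.
have /integrableP[_] // : mu.-integrable K (EFin \o (fun x => k * f x)).
rewrite (_ : EFin \o _ = (fun x => (k%:E * (f x)%:E)%E)) //.
apply: integrableZl => //; apply/integrableP; split; last exact: h.
by apply/measurable_EFinP; exact: measurable_funS mf.
Qed.

Lemma powR_growth p A B : 0 < p -> 0 < A -> exists2 N : R, 1 <= N &
  forall x, N <= x -> B <= A * x `^ p.
Proof.
move=> p0 A0; pose C := `|B| / A.
have C0 : 0 <= C by rewrite divr_ge0// ltW.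
exists (1 + C `^ p^-1) => [|x xN]; first by rewrite lerDl powR_ge0.
apply: (le_trans (ler_norm B)); rewrite mulrC -ler_pdivrMr// -/C.
have {1}-> : C = (C `^ p^-1) `^ p by rewrite -powRrM mulVf ?gt_eqF// powRr1.
have h := powR_ge0 C p^-1.
by apply: ge0_ler_powR; rewrite ?nnegrE ?(ltW p0)//; lra.
Qed.

(** k is 1 or -1, which covers both half-lines. If e^v >= 1 on an interval of length M + 1, its
    integral cannot be M. *)
Lemma expR_not_L1 v (k : R) : `|k| = 1 -> L1 mu (fun x => expR (v x)) ->
  ~ exists N : R, forall x, N <= x -> 0 <= v (k * x).
Proof.
move=> k1 vi [N hN].
have k0 : k != 0 by rewrite -normr_gt0 k1.
have i := L1_affine 0 k0 vi; have := int_affine 0 k0 vi.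
rewrite k1 invr1 mul1r; set M := \int[mu]_x expR (v x) => E.
have M0 : 0 <= M by apply: int_ge0 => x; exact: expR_ge0.
have NM : N <= N + (M + 1) by lra.
have [i2 e2] := int_indic_itv NM.
have : \int[mu]_x \1_`[N, N + (M + 1)] x <= M.
  rewrite -[leRHS]E; apply: int_le; [exact: i2|exact: i|] => x.
  have [xI|xI] := pselect (`[N, N + (M + 1)]%classic x); last by rewrite indic_out// expR_ge0.
  rewrite indic_in// addr0 -expR0 ler_expR; apply: hN.
  by move: xI; rewrite /= in_itv/= => /andP[].
rewrite e2; lra.
Qed.

End almost_everywhere_and_growth.

(** * From the weak equation to the integral equation *)

Section representation.
Context (R : realType) (s : R) (s0 : 2^-1 < s) (s1 : s < 1).
Notation mu := (@lebesgue_measure R).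
Notation a := (2 * s - 1).
Notation fracD := (@frac_op R a).
Notation tconv := (@tconv R).
Notation riesz := (@riesz R a).
Notation potential := (@potential R a).
Implicit Types (u v phi g : R -> R) (x y r : R).

Let a0 : 0 < a. Proof. by pose proof s0; lra. Qed.
Let a1 : a < 1. Proof. by pose proof s1; lra. Qed.

Ltac alra := pose proof a0; pose proof a1; lra.

Let Cs : R := frac_lap_const s.
Let Cs0 : 0 < Cs. Proof. exact: frac_lap_const_gt0. Qed.

Lemma L_s_weight u : L_s s u -> L1 mu (fun x => `|u x| * (1 + `|x|) `^ (- (2 + a))).
Proof.
move=> [[mf _ _] fin].
pose p := 1 + 2 * s; have pE : 2 + a = p by rewrite /p; ring.
have p0 : 0 <= p by rewrite /p; pose proof s0; lra.
have i : L1 mu (fun x => `|u x| / (1 + `|x| `^ p)).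
  have m1 : measurable_fun setT (fun x => `|u x| / (1 + `|x| `^ p)) by mfun.
  have pos x : 0 <= `|u x| / (1 + `|x| `^ p) by rewrite divr_ge0// addr_ge0// powR_ge0.
  exact: (@L1_ge0P _ _ _ mu _ m1 pos).2 fin.
apply: (L1_le (L1Z 2 i)); first by mfun.
move=> x; rewrite normrM normr_id (ger0_norm (powR_ge0 _ _)) mulrCA ler_wpM2l// pE.
have x0 := normr_ge0 x; have q0 := powR_ge0 `|x| p.
have h1 : 1 <= (1 + `|x|) `^ p.
  by rewrite -[leLHS](powRr0 (1 + `|x|)); apply: ler_powR => //; lra.
have h2 : `|x| `^ p <= (1 + `|x|) `^ p.
  by apply: ge0_ler_powR; rewrite ?nnegrE//; lra.
rewrite powRN ler_pdivlMr; last by lra.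
by rewrite mulrC ler_pdivrMr; lra.
Qed.

(** The decay of the operator on test functions is exactly the weight that defines [L_s]. *)
Lemma L_s_fracD u phi : L_s s u -> test_function phi -> L1 mu (fun x => u x * fracD phi x).
Proof.
move=> Lu tp; have [K K0 hK] := test_fracD_decay a0 a1 tp.
have wi := L_s_weight Lu; have [[mf _ _] _] := Lu.
have mp := continuous_measurable_fun (test_continuous tp).
pose F x h := u x * (diff2 phi x h * frac_kern a h).
have Fi : L1prod mu mu F.
  apply: (@L1prodP _ _ _ _ _ mu mu F (fun x => K * (`|u x| * (1 + `|x|) `^ (- (2 + a))))).
  - rewrite /F /diff2 /frac_kern.
    have m1 : measurable_fun setT (fun z : R * R => u z.1) by apply: (mfun_comp mf); mfun.
    have m2 : measurable_fun setT (fun z : R * R => phi z.1) by apply: (mfun_comp mp); mfun.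
    have m3 : measurable_fun setT (fun z : R * R => phi (z.1 + z.2)) by apply: (mfun_comp mp); mfun.
    have m4 : measurable_fun setT (fun z : R * R => phi (z.1 - z.2)) by apply: (mfun_comp mp); mfun.
    by mfun.
  - by move=> x; exact: L1Z (hK x).1.
  - move=> x; have [i iK] := hK x.
    rewrite (eq_int mu (f := fun y => `|F x y|) (g := fun h => `|u x| * `|diff2 phi x h * frac_kern a h|)); last first.
      by move=> h; rewrite /F normrM.
    by rewrite (intZ _ (L1_abs i)) mulrCA ler_wpM2l.
  - exact: L1Z wi.
have [i _] := L1prod_int1 Fi; apply: (eq_L1 _ (L1Z 2^-1 i)) => x.
by rewrite /F (intZ _ (hK x).1) mulrCA.
Qed.

Lemma solution_fracD u phi : solution s u -> test_function phi ->
  Cs * \int[mu]_x (u x * fracD phi x) = \int[mu]_x (expR (u x) * phi x).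
Proof.
move=> [Lu _ hu] tp; rewrite -(hu phi tp) -(intZ _ (L_s_fracD Lu tp)).
by apply: eq_int => x; rewrite (test_frac_lapE a0 a1 x erefl tp) mulrCA.
Qed.

Let p0 : R := Cs * (2 * riesz_slope a / (1 + a)).

Let small r (e : R) : 0 < e -> exists2 r : R, 1 <= r & r `^ (a - 1) <= e.
Proof.
move=> e0; have q0 : 0 < 1 - a by alra.
have [N N1 hN] := powR_growth e^-1 q0 ltr01; exists N => //.
have Np : 0 < N by lra.
rewrite -(opprB 1 a) powRN -[leRHS]invrK lef_pV2 ?posrE ?powR_gt0 ?invr_gt0//.
by have := hN N (lexx _); rewrite mul1r.
Qed.

(** The functions of [approx_test] are admissible in the equation. Their errors are weighted on one
    side by the [L_s] integral of u, on the other by the mass of e^u, and both carry the factor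
    [r^(a - 1)], which tends to 0 because a < 1. *)
Lemma second_order_identity u g : solution s u -> L1 mu (fun x => expR (u x)) ->
  test_function g ->
  p0 * \int[mu]_x (u x * derive1 (derive1 g) x) =
  \int[mu]_x (potential (fun x => expR (u x)) x * derive1 (derive1 g) x).
Proof.
move=> sol ui tg; have t1 := test_derive1 tg; have t2 := test_derive1 t1.
have [Lu _ _] := sol; have wi := L_s_weight Lu; have [lu _] := Lu.
have [pi <-] := potential_pairing a0 a1 ui t1.
have [C C0 hC] := approx_test a0 a1 tg.
have ugi := locally_integrableM lu t2.
set g2 := derive1 (derive1 g) in t2 hC pi ugi *.
set G := tconv _ _ in hC pi *.
set X := p0 * _; set Y := \int[mu]_x _.
pose N := \int[mu]_x (`|u x| * (1 + `|x|) `^ (- (2 + a))).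
pose M := \int[mu]_x expR (u x).
have N0 : 0 <= N by apply: int_ge0 => x; rewrite mulr_ge0 ?powR_ge0.
have M0 : 0 <= M by apply: int_ge0 => x; exact: expR_ge0.
have key r : 1 <= r -> `|X - Y| <= (Cs * (C * N) + C * M) * r `^ (a - 1).
  move=> r1; have [phi [tp h1 h2]] := hC r r1.
  have fi := L_s_fracD Lu tp.
  have e1 := solution_fracD sol tp.
  have ri : L1 mu (fun x => expR (u x) * phi x).
    have [B _ hB] := test_bounded tp.
    have := @L1_bounded _ _ _ mu B phi _ hB (L1_measurable (test_L1 tp)) ui.
    by apply: eq_L1 => x; rewrite mulrC.
  set q := 2 * riesz_slope a / (1 + a) in h1.
  have d1 : `|Cs * \int[mu]_x (u x * fracD phi x) - X| <= Cs * (C * N) * r `^ (a - 1).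
    have -> : X = Cs * \int[mu]_x (q * (u x * g2 x)).
      by rewrite (intZ _ ugi) /X /p0 -/q mulrA.
    rewrite -mulrBr -(intB fi (L1Z q ugi)) normrM (gtr0_norm Cs0) -mulrA ler_wpM2l ?(ltW Cs0)//.
    rewrite mulrAC -(intZ _ wi).
    apply: int_abs_le_bound (L1B fi (L1Z q ugi)) (L1Z _ wi) _ => x.
    rewrite (_ : u x * fracD phi x - q * (u x * g2 x) = u x * (fracD phi x - q * g2 x)); last by ring.
    by rewrite normrM mulrCA ler_wpM2l.
  have d2 : `|\int[mu]_x (expR (u x) * phi x) - Y| <= C * M * r `^ (a - 1).
    rewrite -(intB ri pi) mulrAC -(intZ _ ui).
    apply: int_abs_le_bound (L1B ri pi) (L1Z _ ui) _ => x.
    by rewrite -mulrBr normrM (gtr0_norm (expR_gt0 _)) mulrC ler_wpM2r ?expR_ge0.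
  rewrite -e1 in d2; rewrite mulrDl.
  have -> : X - Y = (Cs * \int[mu]_x (u x * fracD phi x) - Y) - (Cs * \int[mu]_x (u x * fracD phi x) - X) by ring.
  by apply: (le_trans (ler_normB _ _)); rewrite addrC lerD.
apply/eqP; rewrite -subr_eq0 -normr_le0; apply/ler_addgt0Pr => e e0; rewrite add0r.
set D := Cs * (C * N) + C * M in key.
have D0 : 0 <= D by exact: addr_ge0 (mulr_ge0 (ltW Cs0) (mulr_ge0 C0 N0)) (mulr_ge0 C0 M0).
have e1 : 0 < e / (D + 1) by rewrite divr_gt0//; lra.
have [r r1 hr] := small 0 e1.
apply: (le_trans (key r r1)); apply: (le_trans (ler_wpM2l D0 hr)).
rewrite mulrA ler_pdivrMr; last by lra.
by rewrite mulrC ler_wpM2l ?(ltW e0)//; lra.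
Qed.

(* - 1 / p0, where p0 g'' is the image of the convolution of |x|^a and g''
   under the fractional Laplacian *)
Definition riesz_const : R := - p0^-1.

Lemma representation u : solution s u -> L1 mu (fun x => expR (u x)) ->
  exists v (b : R), [/\ continuous v, {ae mu, forall x, u x = v x},
    L1 mu (fun x => expR (v x)), 0 < riesz_const &
    forall y, v y = b - riesz_const * potential (fun x => expR (v x)) y].
Proof.
move=> sol ui; have [Lu _ _] := sol; have [lu _] := Lu.
pose rho x := expR (u x); pose V := potential rho.
have cV : continuous V := continuous_potential a0 a1 ui.
pose M := \int[mu]_x rho x.
have M0 : 0 < M.
  by apply: (@int_gt0_itv R rho 0 1) => // x; rewrite ?expR_ge0 ?expR_gt0.
have rho0 x : 0 <= rho x by exact: expR_ge0.
have [C hC] := potential_ge a0 a1 ui rho0 M0.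
have hV y : V y <= M * `|y| `^ a.
  have := potential_le a0 a1 y ui; rewrite (eq_int mu (g := rho)); last first.
    by move=> x; rewrite ger0_norm.
  by move=> h; rewrite mulrC; exact: le_trans (ler_norm _) h.
have lF : locally_integrable setT (fun x => p0 * u x - V x).
  apply: locally_integrableB; last exact: continuous_locally_integrable.
  exact: locally_integrableZ.
have [|b [k hF]] := du_bois_reymond2 lF.
  move=> g tg; have t2 := test_derive1 (test_derive1 tg).
  have i1 := locally_integrableM lu t2.
  have i2 := locally_integrableM (continuous_locally_integrable cV) t2.
  rewrite (eq_int mu (g := fun x => p0 * (u x * derive1 (derive1 g) x) - V x * derive1 (derive1 g) x)); last first.
    by move=> x; ring.
  by rewrite (intB (L1Z _ i1) i2) (intZ _ i1) (second_order_identity sol ui tg) subrr.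
pose F y := V y + b + k * y.
have cF : continuous F.
  move=> y; apply: cvgD; first by apply: cvgD; [exact: cV|exact: cvg_cst].
  by apply: cvgM; [exact: cvg_cst|exact: cvg_id].
have uF : {ae mu, forall x, p0 * u x = F x}.
  apply: (@filterS _ _ (ae_filter_ringOfSetsType mu)) hF => x h.
  by rewrite /F -addrA -h addrC subrK.
(* On the half-line where [k y] is nonnegative, the lower bound on V alone makes F grow. *)
have big : exists2 t : R, `|t| = 1 & exists N : R, forall x, N <= x -> 1 <= F (t * x).
  have [t t1 tk] : exists2 t : R, `|t| = 1 & 0 <= k * t.
    have [k0|k0] := leP 0 k; first by exists 1; rewrite ?normr1 ?mulr1.
    by exists (- 1); rewrite ?normrN ?normr1// mulrN1 oppr_ge0 ltW.
  exists t => //; have M2 : 0 < M / 2 by lra.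
  have [N N1 hN] := powR_growth (1 + C - b) a0 M2; exists N => x xN.
  have x0 : 0 <= x by lra.
  have h1 := hN x xN; have := hC (t * x); rewrite normrM t1 mul1r (ger0_norm x0) -/M => h2.
  by have h3 := mulr_ge0 tk x0; rewrite /F /V mulrA; lra.
have pn : p0 != 0.
  apply/eqP => p00; have F0 : F = fun=> 0.
    apply: continuous_ae_eq => //; first by move=> x; exact: cvg_cst.
    apply: (@filterS _ _ (ae_filter_ringOfSetsType mu)) uF => x <-.
    by rewrite p00 mul0r.
  have [t _ [N /(_ N (lexx _))]] := big; rewrite F0; lra.
pose v y := p0^-1 * F y.
have uv : {ae mu, forall x, u x = v x}.
  by apply: (@filterS _ _ (ae_filter_ringOfSetsType mu)) uF => x h; rewrite /v -h mulKf.
have cv : continuous v.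
  by move=> x; apply: cvgM; [exact: cvg_cst|exact: cF].
have mv : measurable_fun setT (fun x => expR (v x)).
  by have := continuous_measurable_fun cv => ?; mfun.
have ruv : {ae mu, forall x, rho x = expR (v x)}.
  by apply: (@filterS _ _ (ae_filter_ringOfSetsType mu)) uv => x h; rewrite /rho h.
have vi := @ae_L1 _ _ _ mu _ _ mv ruv ui.
have pneg : p0 < 0.
  rewrite lt_neqAle pn /= leNgt; apply/negP => pp.
  have [t t1 [N hN]] := big.
  apply: (expR_not_L1 t1 vi); exists N => x /hN h.
  by rewrite /v mulr_ge0 ?invr_ge0 ?(ltW pp)//; lra.
(* If k were nonzero, then on the half-line where [k y] is negative the linear term would outweigh
   [V <= M |y|^a], because a < 1. There F would become nonpositive and, p0 being negative, v
   nonnegative, against the integrability of e^v. *)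
have k0 : k = 0.
  apply/eqP; apply: contraT => kn.
  have kp : 0 < `|k| by rewrite normr_gt0.
  pose t := - (k / `|k|).
  have t1 : `|t| = 1 by rewrite normrN normrM normfV normr_id divff// gt_eqF.
  have tk : k * t = - `|k|.
    by rewrite /t mulrN mulrA -expr2 -(real_normK (num_real k)) expr2 mulfK// gt_eqF.
  exfalso; apply: (expR_not_L1 t1 vi).
  have q0 : 0 < 1 - a by alra.
  have [N N1 hN] := powR_growth (M + `|b|) q0 kp; exists N => x xN.
  have x0 : 0 < x by lra.
  have x1 : 1 <= x `^ a.
    by rewrite -[leLHS](powRr0 x); apply: ler_powR; [lra|exact: ltW a0].
  have xE : x `^ (1 - a) * x `^ a = x.
    rewrite -powRD; last by rewrite (gt_eqF x0) implybT.
    by rewrite subrK powRr1// ltW.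
  have h1 := ler_wpM2r (powR_ge0 x a) (hN x xN).
  rewrite -mulrA xE in h1.
  have h2 := hV (t * x); rewrite normrM t1 mul1r (gtr0_norm x0) in h2.
  have h3 : b <= `|b| * x `^ a.
    by apply: (le_trans (ler_norm b)); rewrite ler_peMr.
  rewrite /v mulr_le0 ?invr_le0 ?(ltW pneg)// /F mulrA tk.
  lra.
exists v, (p0^-1 * b); split=> //.
  by rewrite /riesz_const oppr_gt0 invr_lt0.
move=> y; rewrite /riesz_const mulNr opprK.
have -> : potential (fun x => expR (v x)) y = V y.
  apply: ae_eq_int; first exact: L1_measurable (L1_riesz a0 a1 y vi).
    exact: L1_measurable (L1_riesz a0 a1 y ui).
  by apply: (@filterS _ _ (ae_filter_ringOfSetsType mu)) ruv => x ->.
by rewrite /v /F k0 mul0r addr0 mulrDr addrC.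
Qed.

End representation.

(** * Regularity *)

Section bounded_smooth.
Context (R : realType).
Notation mu := (@lebesgue_measure R).
Implicit Types (f g : R -> R) (x y z : R).

(** Boundedness of the derivatives is included because it is what convolution with an integrable
    function preserves; the bootstrap rests on this. *)
Fixpoint nbdd n f : Prop := [/\ continuous f, exists B : R, forall x, `|f x| <= B &
  match n with 0%N => True | n'.+1 => (forall x, derivable f x 1) /\ nbdd n' (derive1 f) end].

Lemma nbdd0 n f : nbdd n f -> nbdd 0 f.
Proof. by case: n => [|n] [cf bf _]. Qed.

Lemma nbddS n f f' : (exists B : R, forall x, `|f x| <= B) ->
  (forall x, derat x f (f' x)) -> nbdd n f' -> nbdd n.+1 f.
Proof.
move=> bf df nf'; have cf : continuous f by move=> x; exact: der_cont (df x).
split => //; split; first by move=> x; have [] := df x.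
by have -> : derive1 f = f' by apply/funext => x; exact: der_derive1.
Qed.

Lemma nbddW n f : nbdd n.+1 f -> nbdd n f.
Proof.
elim: n f => [|n ih] f [cf bf [df nf]]; first by split.
by split => //; split => //; exact: ih.
Qed.

Lemma nbdd_der n f x : nbdd n.+1 f -> derat x f (derive1 f x).
Proof. by move=> [_ _ [df _]]; exact: derivable_der. Qed.

Lemma nbddD n f g : nbdd n f -> nbdd n g -> nbdd n (fun x => f x + g x).
Proof.
elim: n f g => [|n ih] f g nf ng; have [cf [B hB] nf'] := nf; have [cg [C hC] ng'] := ng.
all: have bd : exists D : R, forall x, `|f x + g x| <= D
  by exists (B + C) => x; apply: (le_trans (ler_normD _ _)); rewrite lerD.
  by split => // x; apply: cvgD; [exact: cf|exact: cg].
apply: (nbddS bd (fun x => derD (nbdd_der x nf) (nbdd_der x ng))).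
by apply: ih; [case: nf'|case: ng'].
Qed.

Lemma nbddM n f g : nbdd n f -> nbdd n g -> nbdd n (fun x => f x * g x).
Proof.
elim: n f g => [|n ih] f g nf ng; have [cf [B hB] nf'] := nf; have [cg [C hC] ng'] := ng.
all: have bd : exists D : R, forall x, `|f x * g x| <= D
  by exists (B * C) => x; rewrite normrM ler_pM.
  by split => // x; apply: cvgM; [exact: cf|exact: cg].
apply: (nbddS bd (fun x => derM (nbdd_der x nf) (nbdd_der x ng))).
by apply: nbddD; apply: ih; [case: nf'|exact: nbddW|exact: nbddW|case: ng'].
Qed.

Lemma nbdd_cst n (k : R) : nbdd n (fun=> k).
Proof.
elim: n k => [|n ih] k.
  by split => //; [move=> x; exact: cvg_cst|exists `|k|].
by apply: (nbddS _ (fun x => der_cst x k)) => //; exists `|k|.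
Qed.

Lemma nbdd_ndiff n f : nbdd n f -> ndiff n f.
Proof. by elim: n f => [//|n ih] f [_ _ [df nf]]; split => //; exact: ih. Qed.

Lemma nbdd_convol n f g : L1 mu f -> nbdd n g -> nbdd n (convol f g).
Proof.
elim: n g => [|n ih] g fi ng; have [cg [B hB] ng'] := ng.
all: have mg := continuous_measurable_fun cg.
all: have i x := L1_convol x fi mg hB.
all: have bd : exists D : R, forall x, `|convol f g x| <= D
  by exists (\int[mu]_y (`|f y| * B)) => x; apply: int_abs_le_bound (i x) (L1Zr _ (L1_abs fi)) _ => y;
     rewrite normrM ler_wpM2l.
  split => //.
  apply: (@continuous_int R (fun t y => f y * g (t - y)) (fun y => `|f y| * B)).
  - by move=> t; exact: L1_measurable (i t).
  - move=> y t; apply: cvgM; first exact: cvg_cst.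
    apply: (@continuous_comp _ _ _ (fun t => t - y) g); last exact: cg.
    by apply: cvgB; [exact: cvg_id|exact: cvg_cst].
  - exact: L1Zr (L1_abs fi).
  - by move=> t y; rewrite normrM ler_wpM2l.
case: ng' => dg ng'; have nd : nbdd n (derive1 g) by exact: ng'.
have [_ [C hC] _] := nbdd0 nd.
apply: (nbddS bd (fun x => der_convol x fi (fun y => nbdd_der y ng) hB hC)).
exact: ih.
Qed.

End bounded_smooth.

(** * Inner and outer parts of the Riesz kernel *)

Section riesz_kernel.
Context (R : realType) (a : R) (a0 : 0 < a) (a1 : a < 1).
Notation mu := (@lebesgue_measure R).
Notation k1 := (@outer_powR R a).
Implicit Types (f g : R -> R) (x y z : R).

Ltac alra := pose proof a0; pose proof a1; lra.

(** The combination of an even and an odd power is stable under differentiation, which exchanges the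
    roles of C and D and lowers p by 1. *)
Lemma far_powR_nbdd n f (p : R) : smooth f -> p <= 0 ->
  (exists C D : R, forall x, 2 < `|x| -> f x = C * `|x| `^ p + D * (x * `|x| `^ (p - 1))) ->
  nbdd n f.
Proof.
elim: n f p => [|n ih] f p sf p0 [C [D hf]].
all: have bd : exists B : R, forall x, `|f x| <= B.
1,3: have cf := smooth_continuous sf.
1,2: have CD0 : 0 <= `|C| + `|D| by rewrite addr_ge0.
1,2: have hb x : 2 < `|x| -> `|f x| <= (`|C| + `|D|) * `|x| `^ (- 0).
1,3: move=> x2; rewrite hf// oppr0 powRr0 mulr1; have x0 : 0 < `|x| by lra.
1,2: have xE : `|x| * `|x| `^ (p - 1) = `|x| `^ p
  by rewrite -[X in X * _](powRr1 (ltW x0)) -powRD; [congr (_ `^ _); ring|rewrite (gt_eqF x0) implybT].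
1,2: have x1 : `|x| `^ p <= 1
  by rewrite -[leRHS](powRr0 `|x|); apply: ler_powR => //; lra.
1,2: apply: (le_trans (ler_normD _ _)); rewrite !normrM !(ger0_norm (powR_ge0 _ _)) xE;
  by apply: lerD; rewrite ler_piMr.
1,2: have [B B0 hB] := @decay_extend _ f 0 _ cf (lexx _) CD0 hb;
  by exists B => x; have := hB x; rewrite oppr0 powRr0 mulr1.
  by split => //; exact: smooth_continuous.
apply: (nbddS bd (fun x => smooth_der x sf)).
apply: (ih _ (p - 1)); [exact: smooth_derive1|lra|].
exists (D * p), (C * p) => x x2; apply: der_derive1.
have x0 : x != 0 by rewrite -normr_gt0; lra.
apply: (@der_near _ (fun x => C * `|x| `^ p + D * (x * `|x| `^ (p - 1)))).
  apply: der_val.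
    apply: derD; apply: derM; [exact: der_cst|exact: der_abs_powR|exact: der_cst|exact: der_sgn_powR].
  have -> : p - 1 - 1 = p - 2 by ring.
  by ring.
near=> y; rewrite hf//; near: y.
apply: (cvgr_gt `|x|) => //; exact: norm_continuous.
Unshelve. all: end_near. Qed.

(** The derivative of [|z|^a] for z != 0, with value 0 at the singular point. *)
Definition dpowR z : R := a * (z * `|z| `^ (a - 2)).

Lemma dpowR0 : dpowR 0 = 0. Proof. by rewrite /dpowR mul0r mulr0. Qed.

Lemma dpowRN z : dpowR (- z) = - dpowR z.
Proof. by rewrite /dpowR normrN; ring. Qed.

Lemma dpowR_norm z : z != 0 -> `|dpowR z| = a * `|z| `^ (a - 1).
Proof.
move=> z0; have zp : 0 < `|z| by rewrite normr_gt0.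
rewrite /dpowR !normrM (gtr0_norm a0) (ger0_norm (powR_ge0 _ _)); congr (_ * _).
rewrite -[X in X * _](powRr1 (ltW zp)) -powRD; last by rewrite (gt_eqF zp) implybT.
by congr (_ `^ _); ring.
Qed.

Lemma outer_powR_far x : 2 < `|x| -> derive1 k1 x = dpowR x.
Proof.
move=> x2; have x0 : x != 0 by rewrite -normr_gt0; lra.
apply: der_derive1; apply: (der_near (der_abs_powR a x0)).
near=> y; rewrite /outer_powR cutoff0 ?subr0 ?mulr1//; apply: ltW; near: y.
apply: (cvgr_gt `|x|) => //; exact: norm_continuous.
Unshelve. all: end_near. Qed.

Lemma nbdd_outer n : nbdd n (derive1 k1).
Proof.
apply: (@far_powR_nbdd n _ (a - 1)); [exact: smooth_derive1 (@smooth_outer_powR R a)|alra|].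
exists 0, a => x x2; rewrite outer_powR_far// /dpowR mul0r add0r.
by have -> : a - 1 - 1 = a - 2 by ring.
Qed.

Lemma outer_powR_eq0 x : `|x| <= 1 -> k1 x = 0.
Proof. by move=> x1; rewrite /outer_powR cutoff1// subrr mulr0. Qed.

(** Away from 0 this is the derivative of [|z|^a * cutoff z]: singular at 0, but integrable with
    bounded support. The remaining part [derive1 k1] of [dpowR] is smooth and bounded, so each part
    can be convolved with a bounded integrable density. *)
Definition inner_dpowR z : R := dpowR z - derive1 k1 z.

Notation theta := inner_dpowR.

Lemma inner_dpowR_far z : 2 < `|z| -> theta z = 0.
Proof. by move=> z2; rewrite /inner_dpowR outer_powR_far// subrr. Qed.

Lemma measurable_dpowR : measurable_fun setT dpowR.
Proof. by rewrite /dpowR; mfun. Qed.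

Lemma L1_inner_dpowR : L1 mu theta.
Proof.
have b0 : 0 < 1 - a < 1 by apply/andP; split; alra.
have i1 := L1_powR_near0 b0.
have [_ [B hB] _] := nbdd_outer 0.
have [i2 _] := @int_indic_itv R (-2) 2 ltac:(lra).
have mk := continuous_measurable_fun (smooth_continuous (smooth_derive1 (@smooth_outer_powR R a))).
have md := measurable_dpowR.
have B0 : 0 <= B := le_trans (normr_ge0 _) (hB 0).
apply: (L1_le (L1D i1 (L1Z (1 + B) i2))); first by rewrite /inner_dpowR; mfun.
move=> z; have [z2|z2] := leP `|z| 2; last first.
  by rewrite inner_dpowR_far// normr0 addr_ge0// mulr_ge0 ?powR_ge0 ?indicE//; lra.
rewrite (@indic_in _ `[(-2), 2]%classic) ?mulr1; last by rewrite /= in_itv/= -ler_norml.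
apply: (le_trans (ler_normB _ _)); rewrite addrA lerD//.
have [->|z0] := eqVneq z 0; first by rewrite dpowR0 normr0 addr_ge0// mulr_ge0 ?powR_ge0 ?indicE.
have zp : 0 < `|z| by rewrite normr_gt0.
rewrite dpowR_norm//; have [z1|z1] := leP `|z| 1.
  rewrite indic_in; last by rewrite /= in_itv/= -ler_norml.
  rewrite opprB mul1r ler_wpDr// ler_piMl ?powR_ge0//; exact: ltW a1.
rewrite indic_out ?mul0r ?add0r; last by rewrite /= in_itv/= -ler_norml leNgt z1.
have h : `|z| `^ (a - 1) <= 1.
  by rewrite -[leRHS](powRr0 `|z|); apply: ler_powR; [exact: ltW|alra].
by have := powR_ge0 `|z| (a - 1); pose proof a0; pose proof a1; nra.
Qed.

Lemma int_inner_dpowR : \int[mu]_z theta z = 0.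
Proof.
have i := L1_inner_dpowR.
have E : \int[mu]_z theta (0 - z) = \int[mu]_z (- theta z).
  apply: eq_int => z; rewrite sub0r /inner_dpowR dpowRN opprD opprK; congr (_ + _).
  have d : derat z (fun z => k1 (- z)) (- 1 * derive1 k1 (- z)).
    by apply: der_comp; [der|apply: smooth_der; exact: smooth_outer_powR].
  have := der_derive1 d.
  have -> : (fun z => k1 (- z)) = k1.
    apply/funext => y; rewrite /outer_powR normrN; congr (_ * (1 - _)).
    by rewrite /cutoff opprK mulrC.
  by rewrite mulN1r => ->.
have := etrans (esym E) (int_refl 0 i); rewrite (intN i).
by move: (\int[mu]_z theta z) => J ?; lra.
Qed.

(* W(y) (P(x - y) - P(x)), with W the inner part of |y|^a, is differentiable
   even at y = 0. *)
Lemma inner_convol_ibp rho P (B : R) x : continuous rho -> (forall y, `|rho y| <= B) ->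
  (forall y, derat y P (rho y)) ->
  \int[mu]_y (theta y * (P (x - y) - P x)) = \int[mu]_y (`|y| `^ a * cutoff y * rho (x - y)).
Proof.
move=> cr rB dP.
pose F y := `|y| `^ a * cutoff y * (P (x - y) - P x).
pose W y : R := `|y| `^ a * cutoff y.
pose f y := theta y * (P (x - y) - P x) - W y * rho (x - y).
have W_ y : W y = `|y| `^ a - k1 y by rewrite /W /outer_powR; ring.
have PB y : `|P (x - y) - P x| <= B * `|y|.
  have := @mvt_bound R P rho x (x - y) B (fun z _ => dP z) (fun z _ => rB z).
  by rewrite addrAC subrr add0r normrN.
have cP : continuous P by move=> y; exact: der_cont (dP y).
have B0 : 0 <= B := le_trans (normr_ge0 _) (rB 0).
have cW : continuous W by move=> y; apply: cvgM; [exact: continuous_abs_powR|exact: test_continuous (test_cutoff R) _].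
have cPx y : {for y, continuous (fun y => P (x - y) - P x)}.
  by apply: cvgB; [exact: continuous_reflect|exact: cvg_cst].
have crx : continuous (fun y => rho (x - y)) by exact: continuous_reflect.
have dF y : derat y F (f y).
  have [->|y0] := eqVneq y 0.
    have -> : f 0 = 0.
      by rewrite /f /W subr0 subrr mulr0 normr0 powR0 ?gt_eqF// !mul0r subr0.
    apply: der_cvg; apply/cvgrPdist_le => e e0.
    have e1 : 0 < e / (B + 1) by rewrite divr_gt0//; lra.
    have [d d0 hd] := powR_small a0 e1.
    near=> h; rewrite addr0 /F normr0 powR0 ?gt_eqF// !mul0r subr0 sub0r normrN.
    have h0 : h != 0 by near: h; exact: nbhs_dnbhs_neq.
    have hp : 0 < `|h| by rewrite normr_gt0.
    have hh : `|h| `^ a <= e / (B + 1).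
      by apply: hd; near: h; exact: dnbhs0_le.
    have w0 : 0 <= `|h| `^ a * @cutoff R h by rewrite mulr_ge0 ?powR_ge0 ?cutoff_ge0.
    rewrite normrM normfV normrM (ger0_norm w0).
    rewrite ler_pdivrMl//.
    apply: (@le_trans _ _ (`|h| `^ a * 1 * (B * `|h|))).
      apply: ler_pM => //.
      by rewrite ler_wpM2l ?powR_ge0 ?cutoff_le1.
    rewrite mulr1 mulrA mulrC ler_wpM2l//.
    apply: (le_trans (ler_wpM2r B0 hh)); rewrite mulrAC ler_pdivrMr; last by lra.
    by rewrite ler_wpM2l ?(ltW e0)//; lra.
  have dW : derat y W (theta y).
    by apply: (der_eq (derD (der_abs_powR a y0) (derN (smooth_der y (@smooth_outer_powR R a))))) => //.
  apply: der_val.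
    apply: (derM dW); apply: derD; last exact: der_cst.
    by apply: der_comp; [der|exact: dP].
  by rewrite /f /W; ring.
have cf : continuous f.
  move=> y; have [->|y0] := eqVneq y 0; last first.
    have ct : {for y, continuous theta}.
      apply: cvgB; last exact: smooth_continuous (smooth_derive1 (@smooth_outer_powR R a)) y.
      exact: der_cont (derM (der_cst y a) (der_sgn_powR (a - 2) y0)).
    by apply: cvgB; apply: cvgM; [exact: ct|exact: cPx|exact: cW|exact: crx].
  have f00 : f 0 = 0.
    by rewrite /f /W subr0 subrr mulr0 normr0 powR0 ?gt_eqF// !mul0r subr0.
  rewrite /continuous_at f00; apply/cvgrPdist_le => e e0.
  have e1 : 0 < e / (2 * B + 1) by rewrite divr_gt0//; lra.
  have [d d0 hd] := powR_small a0 e1.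
  near=> y'; rewrite sub0r normrN.
  have y1 : `|y'| < 1 by near: y'; exists 1 => [|z] /=; [exact: ltr01|rewrite sub0r normrN].
  have hy : `|y'| `^ a <= e / (2 * B + 1).
    by apply: hd; near: y'; exists d => // z /=; rewrite sub0r normrN => /ltW.
  apply: (@le_trans _ _ (2 * B * `|y'| `^ a)); last first.
    have B2 : 0 <= 2 * B by rewrite mulr_ge0.
    apply: (le_trans (ler_wpM2l B2 hy)).
    by rewrite mulrA ler_pdivrMr; [rewrite mulrC ler_wpM2l ?(ltW e0)//; lra|lra].
  have k0 : derive1 k1 y' = 0.
    apply: der_derive1; apply: (der_near (der_cst y' 0)).
    near=> z; rewrite outer_powR_eq0//; apply: ltW; near: z.
    by apply: (cvgr_lt `|y'|) => //; exact: norm_continuous.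
  have q : `|theta y' * (P (x - y') - P x)| <= B * `|y'| `^ a.
    rewrite /inner_dpowR k0 subr0; have [->|yn] := eqVneq y' 0.
      by rewrite dpowR0 mul0r normr0 mulr_ge0 ?powR_ge0.
    have yp : 0 < `|y'| by rewrite normr_gt0.
    rewrite normrM dpowR_norm//.
    apply: (@le_trans _ _ (1 * `|y'| `^ (a - 1) * (B * `|y'|))).
      apply: ler_pM => //; first by rewrite mulr_ge0 ?powR_ge0 ?(ltW a0).
      by rewrite ler_wpM2r ?powR_ge0 ?(ltW a1).
    rewrite mul1r mulrCA ler_wpM2l// -[X in _ * X](powRr1 (ltW yp)) -powRD; last first.
      by rewrite (gt_eqF yp) implybT.
    by rewrite subrK.
  have q2 : `|W y' * rho (x - y')| <= B * `|y'| `^ a.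
    rewrite normrM mulrC; apply: ler_pM => //.
    rewrite normrM (ger0_norm (powR_ge0 _ _)) (ger0_norm (cutoff_ge0 y')).
    by rewrite ler_piMr ?powR_ge0 ?cutoff_le1.
  by apply: (le_trans (ler_normB _ _)); lra.
have F0 y : 2 < `|y| -> F y = 0 by move=> y2; rewrite /F cutoff0 ?mulr0 ?mul0r// ltW.
have f0 y : 2 < `|y| -> f y = 0.
  by move=> y2; rewrite /f inner_dpowR_far// /W cutoff0 ?mulr0 ?mul0r ?subrr// ltW.
have [_ e] := @int_der_compact R F f 2 ltac:(lra) dF cf F0 f0.
have i2 : L1 mu (fun y => W y * rho (x - y)).
  apply: (@L1_compact _ _ 2) => [y|y y2]; first by apply: cvgM; [exact: cW|exact: crx].
  by rewrite /W cutoff0 ?mulr0 ?mul0r// ltW.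
have i1 : L1 mu (fun y => theta y * (P (x - y) - P x)).
  have i := L1_compact cf f0; apply: (eq_L1 _ (L1D i i2)) => y.
  by rewrite /f subrK.
by apply/eqP; rewrite -subr_eq0 -(intB i1 i2) e.
Unshelve. all: end_near. Qed.

End riesz_kernel.

(** All that regularity, symmetry and uniqueness use about a solution of finite mass, taken in its
    continuous representative. *)
Definition riesz_eq (R : realType) (a c : R) (v : R -> R) : Prop :=
  L1 (@lebesgue_measure R) (fun x => expR (v x)) /\
  exists b : R, forall y, v y = b - c * potential a (fun x => expR (v x)) y.

(** * Decay and smoothness from the integral equation *)

Section integral_equation.
Context (R : realType) (a c : R) (a0 : 0 < a) (a1 : a < 1) (c0 : 0 < c).
Context (v : R -> R) (hv : riesz_eq a c v).
Notation mu := (@lebesgue_measure R).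
Notation k1 := (@outer_powR R a).
Notation theta := (@inner_dpowR R a).
Implicit Types (x y z p : R).

Ltac alra := pose proof a0; pose proof a1; lra.

Let rho x := expR (v x).

Lemma riesz_eq_L1 : L1 mu (fun x => expR (v x)). Proof. by case: hv. Qed.

Let ri : L1 mu rho. Proof. exact: riesz_eq_L1. Qed.

Lemma riesz_eq_mass_gt0 : 0 < \int[mu]_x expR (v x).
Proof. by apply: (@int_gt0_itv R rho 0 1) => // x; rewrite ?expR_ge0 ?expR_gt0. Qed.

Lemma riesz_eq_continuous : continuous v.
Proof.
have [_ [b vE]] := hv.
have -> : v = fun y => b - c * potential a rho y by apply/funext => y; exact: vE.
move=> y; apply: cvgB; first exact: cvg_cst.
by apply: cvgM; [exact: cvg_cst|exact: continuous_potential].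
Qed.

Let cv := riesz_eq_continuous.

Let crho : continuous rho.
Proof.
move=> x; apply: (@continuous_comp _ _ _ v (@expR R)); first exact: cv.
exact: continuous_expR.
Qed.

Lemma riesz_eq_upper : exists (k C : R), 0 < k /\ forall y, v y <= C - k * `|y| `^ a.
Proof.
have [_ [b vE]] := hv; have M0 := riesz_eq_mass_gt0.
have [C hC] := potential_ge a0 a1 ri (fun x => expR_ge0 _) M0.
set M := \int[mu]_x _ in M0 hC.
exists (c * (M / 2)), (b + c * C); split; first by rewrite mulr_gt0//; lra.
by move=> y; rewrite vE; have := ler_wpM2l (ltW c0) (hC y); rewrite /rho; lra.
Qed.

Lemma riesz_eq_bounded_above : exists B : R, forall x, v x <= B.
Proof.
have [k [C [k0 h]]] := riesz_eq_upper; exists C => x; apply: (le_trans (h x)).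
by rewrite gerBl mulr_ge0 ?powR_ge0 ?(ltW k0).
Qed.

Lemma riesz_eq_growth : exists C A : R, forall x, A <= `|x| -> `|v x| <= C * `|x| `^ a.
Proof.
have [_ [b vE]] := hv; set M := \int[mu]_x `|rho x|.
exists (`|b| + c * M), 1 => x x1.
have p1 : 1 <= `|x| `^ a.
  by rewrite -[leLHS](powRr0 `|x|); apply: ler_powR => //; exact: ltW.
rewrite vE; apply: (le_trans (ler_normB _ _)); rewrite mulrDl; apply: lerD.
  by rewrite ler_peMr.
rewrite normrM (gtr0_norm c0) -mulrA ler_wpM2l ?(ltW c0)// mulrC.
exact: potential_le.
Qed.

(** With [X = |x|^a], the bound [v <= C - k X] is combined with [exp (k X / m) >= 1 + k X / m >= q
    (1 + X)], raised to a power [m >= p / a]; finally [1 + X] dominates [(1 + |x|)^a]. *)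
Lemma riesz_eq_decay p : 0 <= p -> exists2 B : R, 0 <= B &
  forall x, expR (v x) <= B * (1 + `|x|) `^ (- p).
Proof.
move=> p0; have [k [C [k0 h]]] := riesz_eq_upper.
pose m := (Num.truncn (p / a)).+1.
have m0 : 0 < m%:R :> R by rewrite ltr0n.
have pm : p <= a * m%:R.
  rewrite mulrC -ler_pdivrMr//; have /andP[_ +] := truncn_itv (divr_ge0 p0 (ltW a0)).
  exact: ltW.
pose q := Num.min 1 (k / m%:R).
have q0 : 0 < q by rewrite lt_min ltr01 divr_gt0.
have q1 : q <= 1 by rewrite ge_min lexx.
have q2 : q <= k / m%:R by rewrite ge_min lexx orbT.
exists (expR C / q ^+ m) => [|x].
  by rewrite divr_ge0 ?expR_ge0 ?exprn_ge0 ?(ltW q0).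
have x0 := normr_ge0 x; have X0 : 0 <= `|x| `^ a by exact: powR_ge0.
have w1 : 1 <= 1 + `|x| by lra.
apply: (@le_trans _ _ (expR (C - k * `|x| `^ a))); first by rewrite ler_expR.
rewrite expRD -mulrA ler_wpM2l ?expR_ge0// expRN powRN -invfM.
have W0 : 0 < q ^+ m * (1 + `|x|) `^ p.
  by rewrite mulr_gt0 ?exprn_gt0 ?powR_gt0//; lra.
rewrite lef_pV2 ?posrE ?expR_gt0//.
have -> : k * `|x| `^ a = m%:R * (k * `|x| `^ a / m%:R) by field; rewrite gt_eqF.
rewrite expRM_natl.
apply: (@le_trans _ _ ((q * (1 + `|x|) `^ a) ^+ m)).
  rewrite exprMn ler_wpM2l ?exprn_ge0 ?(ltW q0)//.
  rewrite -powR_mulrn ?powR_ge0// -powRrM; apply: ler_powR => //.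
rewrite lerXn2r ?nnegrE ?mulr_ge0 ?powR_ge0 ?expR_ge0 ?(ltW q0)//.
apply: le_trans (expR_ge1Dx _).
apply: (@le_trans _ _ (q * (1 + `|x| `^ a))).
  rewrite ler_wpM2l ?(ltW q0)//; have := powR_subadd a0 (ltW a1) ler01 x0.
  by rewrite powR1.
have := ler_wpM2r X0 q2; rewrite mulrDr mulr1 => h2.
rewrite mulrAC; lra.
Qed.

Lemma riesz_eq_moment p : 0 <= p -> L1 mu (fun x => expR (v x) * (1 + `|x|) `^ p).
Proof.
move=> p0; have p2 : 0 <= p + 2 by lra.
have [B B0 hB] := riesz_eq_decay p2.
have i := @L1_powR_infty R 2 ltac:(lra).
have mr := L1_measurable ri; rewrite /rho in mr.
apply: (L1_le (L1Z B i)); first by mfun.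
move=> x; rewrite ger0_norm ?mulr_ge0 ?expR_ge0 ?powR_ge0//.
apply: (le_trans (ler_wpM2r (powR_ge0 _ _) (hB x))).
rewrite -mulrA ler_wpM2l// -powRD; last first.
  by rewrite implybE; apply/orP; right; rewrite gt_eqF// ltr_pwDl.
by rewrite opprD addrAC addNr add0r.
Qed.

Lemma riesz_eq_weighted : L1 mu (fun x => expR (v x) * `|x| `^ a).
Proof.
have i := riesz_eq_moment (ltW a0); have mr := L1_measurable ri; rewrite /rho in mr.
apply: (L1_le i); first by mfun.
move=> x; rewrite ger0_norm ?mulr_ge0 ?expR_ge0 ?powR_ge0// ler_wpM2l ?expR_ge0//.
apply: ge0_ler_powR; rewrite ?nnegrE ?addr_ge0 ?(ltW a0)//.
by rewrite lerDr.
Qed.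

Lemma riesz_eq_L1_dist y : L1 mu (fun x => expR (v x) * `|x - y| `^ a).
Proof.
apply: (eq_L1 _ (L1D (L1_riesz a0 a1 y ri) riesz_eq_weighted)) => x.
by rewrite /rho /riesz mulrBr subrK.
Qed.

(** Once e^v has a finite moment of order a, the subtraction of [|x|^a] in [riesz] is undone and
    absorbed into b. *)
Lemma riesz_eq_dist : exists b : R,
  forall y, v y = b - c * \int[mu]_x (expR (v x) * `|x - y| `^ a).
Proof.
have [_ [b vE]] := hv; exists (b + c * \int[mu]_x (expR (v x) * `|x| `^ a)) => y.
rewrite {1}vE.
have -> : potential a (fun x => expR (v x)) y = \int[mu]_x (expR (v x) * `|x - y| `^ a) -
    \int[mu]_x (expR (v x) * `|x| `^ a).
  rewrite -(intB (riesz_eq_L1_dist y) riesz_eq_weighted); apply: eq_int => x.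
  by rewrite /riesz mulrBr.
by move: (\int[mu]_x _) (\int[mu]_x _) => I J; ring.
Qed.

Let Z y := convol theta rho y + convol rho (derive1 k1) y.

Let rho_bounded : exists B : R, forall x, `|rho x| <= B.
Proof.
have [B hB] := riesz_eq_bounded_above; exists (expR B) => x.
by rewrite ger0_norm ?expR_ge0// ler_expR.
Qed.

Let thi := L1_inner_dpowR a0 a1.

(** The outer part of the kernel is differentiated under the integral. The inner part is singular
    while rho is so far only continuous; [inner_convol_ibp] rewrites it as the convolution of
    [theta] with the primitive P of rho, up to a term killed by the zero integral of [theta], and
    the derivative then falls on P. *)
Let derv y : derat y v (- c * Z y).
Proof.
have [b vE] := riesz_eq_dist; have [B rB] := rho_bounded.
pose P y := \int[mu]_x (\1_`]-oo, y] x * rho x).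
have dP z : derat z P (rho z) by exact: der_primitive.
have PB z : `|P z| <= \int[mu]_x `|rho x|.
  apply: int_abs_le_bound (L1_indicM (measurable_itv _) ri) (L1_abs ri) _ => x.
  by rewrite normrM ler_piMl// indicE; case: (_ \in _); rewrite ?normr1 ?normr0.
have mP : measurable_fun setT P.
  by apply: continuous_measurable_fun => z; exact: der_cont (dP z).
have mr := L1_measurable ri.
have [_ [K hK] _] := nbdd_outer a0 a1 0.
have sk := @smooth_outer_powR R a.
have mk := continuous_measurable_fun (smooth_continuous sk).
have Fi t : L1 mu (fun x => rho x * k1 (t - x)).
  apply: (L1_le (riesz_eq_L1_dist t)).
    have : measurable_fun setT (fun x => k1 (t - x)) by apply: (mfun_comp mk); mfun.
    by move=> ?; mfun.
  move=> x; rewrite normrM (gtr0_norm (expR_gt0 _)) ler_wpM2l ?expR_ge0//.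
  rewrite /outer_powR normrM (ger0_norm (powR_ge0 _ _)) distrC ler_piMr ?powR_ge0//.
  by rewrite ger0_norm ?subr_ge0 ?cutoff_le1// gerBl cutoff_ge0.
have d1 : derat y (fun t => \int[mu]_x (rho x * k1 (t - x))) (convol rho (derive1 k1) y).
  apply: (@der_int R (fun t x => rho x * k1 (t - x)) (fun t x => rho x * derive1 k1 (t - x))
    (fun x => `|rho x| * K)) => [//|t x||t x].
  - apply: der_val.
      by apply: derM; [exact: der_cst|apply: der_comp; [|exact: smooth_der]; der].
    by rewrite mul0r add0r addr0 mul1r.
  - exact: L1Zr (L1_abs ri).
  - by rewrite normrM ler_wpM2l.
have d2 := der_convol y thi dP PB rB.
have E t : v t = b - c * (convol theta P t + \int[mu]_x (rho x * k1 (t - x))).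
  rewrite vE; congr (_ - c * _).
  have iW x : expR (v x) * `|x - t| `^ a - rho x * k1 (t - x) =
      `|t - x| `^ a * cutoff (t - x) * rho x.
    by rewrite /outer_powR distrC /rho; ring.
  rewrite -[LHS](subrK (\int[mu]_x (rho x * k1 (t - x)))); congr (_ + _).
  rewrite -(intB (riesz_eq_L1_dist t) (Fi t)) (eq_int mu iW).
  have i2 : L1 mu (fun z => `|z| `^ a * cutoff z * rho (t - z)).
    have := L1_refl t (L1B (riesz_eq_L1_dist t) (Fi t)); apply: eq_L1 => z.
    by rewrite iW subKr.
  have e2 := int_refl t i2.
  rewrite (eq_int mu (g := fun x => `|t - x| `^ a * cutoff (t - x) * rho (t - (t - x)))); last first.
    by move=> x; rewrite subKr.
  rewrite e2 -(inner_convol_ibp a0 a1 t crho rB dP).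
  have i3 := L1_convol t thi mP PB.
  rewrite (eq_int mu (g := fun z => theta z * P (t - z) - theta z * P t)); last first.
    by move=> z; rewrite mulrBr.
  by rewrite (intB i3 (L1Zr _ thi)) (intZr _ thi) int_inner_dpowR// mul0r subr0.
apply: (der_eq (derD (der_cst y b) (derN (derM (der_cst y c) (derD d2 d1))))) => [t|].
  by rewrite E.
by rewrite /Z; ring.
Qed.

Lemma riesz_eq_L1_dpowR y : L1 mu (fun x => expR (v x) * dpowR a (y - x)).
Proof.
have [B rB] := rho_bounded; have [_ [K hK] _] := nbdd_outer a0 a1 0.
have mr := L1_measurable ri.
have mk := continuous_measurable_fun (smooth_continuous (smooth_derive1 (@smooth_outer_powR R a))).
have i1 := L1_refl y (L1_convol y thi mr rB).
have i2 := L1_convol y ri mk hK.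
apply: (eq_L1 _ (L1D i1 i2)) => x.
by rewrite subKr /rho /inner_dpowR; ring.
Qed.

Lemma riesz_eq_der y : derat y v (- c * \int[mu]_x (expR (v x) * dpowR a (y - x))).
Proof.
apply: (der_val (derv y)); congr (_ * _); rewrite /Z.
have [B rB] := rho_bounded; have [_ [K hK] _] := nbdd_outer a0 a1 0.
have mr := L1_measurable ri.
have mk := continuous_measurable_fun (smooth_continuous (smooth_derive1 (@smooth_outer_powR R a))).
have i1 := L1_convol y thi mr rB.
have i2 := L1_convol y ri mk hK.
rewrite /convol -(int_refl y i1) -(intD (L1_refl y i1) i2); apply: eq_int => x.
by rewrite subKr /rho /inner_dpowR; ring.
Qed.

(** Bootstrap: [rho' = - c Z rho], and Z inherits the bounded derivatives of rho and of the outer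
    kernel. *)
Let nbdd_rho n : nbdd n rho.
Proof.
elim: n => [|n ih]; first by split.
have dr y : derat y rho (- c * Z y * rho y) by exact: der_expR (derv y).
apply: (nbddS rho_bounded dr); apply: nbddM => //; apply: nbddM; first exact: nbdd_cst.
by apply: nbddD; apply: nbdd_convol => //; exact: nbdd_outer.
Qed.

Lemma riesz_eq_smooth : smooth v.
Proof.
apply/smoothP => -[//|n]; apply: (ndiffS derv); apply: ndiffM; first exact: ndiff_cst.
apply: nbdd_ndiff; apply: nbddD; apply: nbdd_convol => //; exact: nbdd_outer.
Qed.

End integral_equation.

(** * Symmetry *)

Section moving_planes.
Context (R : realType) (a c : R) (a0 : 0 < a) (a1 : a < 1) (c0 : 0 < c).
Context (v : R -> R) (hv : riesz_eq a c v).
Notation mu := (@lebesgue_measure R).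
Implicit Types (x y z l S : R).

Ltac alra := pose proof a0; pose proof a1; lra.

Let rho x := expR (v x).
Let ri : L1 mu rho. Proof. by case: hv. Qed.
Let cv := riesz_eq_continuous a0 a1 hv.
Let mv : measurable_fun setT v. Proof. exact: continuous_measurable_fun. Qed.

Let D l x y : R := `|y - (2 * l - x)| `^ a - `|y - x| `^ a.

Let D_refl l x y : D l x (2 * l - y) = - D l x y.
Proof.
rewrite /D.
have -> : `|2 * l - y - (2 * l - x)| = `|y - x| by rewrite -normrN; congr `|_|; ring.
have -> : `|2 * l - y - x| = `|y - (2 * l - x)| by rewrite -normrN; congr `|_|; ring.
by ring.
Qed.

Let D_ge0 l x y : l <= x -> l <= y -> 0 <= D l x y.
Proof.
move=> lx ly; rewrite subr_ge0; apply: ge0_ler_powR; rewrite ?nnegrE ?(ltW a0)//.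
by rewrite (ger0_norm (_ : 0 <= y - (2 * l - x))) ?ler_norml; [apply/andP; split; lra|lra].
Qed.

Let D_gt0 l x y : l < x -> l < y -> 0 < D l x y.
Proof.
move=> lx ly; rewrite subr_gt0; apply: gt0_ltr_powR; rewrite ?nnegrE//.
by rewrite (ger0_norm (_ : 0 <= y - (2 * l - x))) ?ltr_norml; [apply/andP; split; lra|lra].
Qed.

Let D_le l x y : D l x y <= `|2 * (y - l)| `^ a.
Proof.
have := abs_powR_sub (x - y) (- (2 * (y - l))) a0 (ltW a1); rewrite normrN ler_norml.
have -> : x - y - - (2 * (y - l)) = y - (2 * l - x) by ring.
by rewrite (distrC x y) => /andP[].
Qed.

Let refl_L1 l f : L1 mu f -> L1 mu (fun y => f (2 * l - y)).
Proof. exact: L1_refl. Qed.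

(** The kernel difference D changes sign under the reflection y -> 2 l - y, so averaging the
    equation with its reflection replaces rho by its odd part about l. *)
Let vdiff l x : L1 mu (fun y => (rho y - rho (2 * l - y)) * D l x y) /\
  v x - v (2 * l - x) = c / 2 * \int[mu]_y ((rho y - rho (2 * l - y)) * D l x y).
Proof.
have [b vE] := riesz_eq_dist a0 a1 c0 hv.
have i1 := riesz_eq_L1_dist a0 a1 c0 hv x.
have i2 := riesz_eq_L1_dist a0 a1 c0 hv (2 * l - x).
have i : L1 mu (fun y => rho y * D l x y).
  by apply: (eq_L1 _ (L1B i2 i1)) => y; rewrite /rho /D mulrBr.
have i' := refl_L1 l i.
have E y : rho y * D l x y + rho (2 * l - y) * D l x (2 * l - y) = (rho y - rho (2 * l - y)) * D l x y.
  by rewrite D_refl; ring.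
split; first by apply: (eq_L1 _ (L1D i i')) => y; rewrite E.
rewrite -(eq_int mu E) (intD i i') (int_refl (2 * l) i) !vE.
have -> : \int[mu]_y (rho y * D l x y) = \int[mu]_y (expR (v y) * `|y - (2 * l - x)| `^ a) -
    \int[mu]_y (expR (v y) * `|y - x| `^ a).
  by rewrite -(intB i2 i1); apply: eq_int => y; rewrite /rho /D mulrBr.
by move: (\int[mu]_y _) (\int[mu]_y _) => I J; field.
Qed.

Let good l := forall x, l < x -> v x <= v (2 * l - x).

Let bad l : set R := [set y | l < y] `&` [set y | v (2 * l - y) < v y].

(** The last factor is the bound [D_le] on the kernel difference, uniform in x. *)
Let weight l y : R := \1_(bad l) y * rho y * `|2 * (y - l)| `^ a.

Let mvl l : measurable_fun setT (fun y => v (2 * l - y)).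
Proof. by apply: (mfun_comp mv); mfun. Qed.

Let mbad l : measurable (bad l).
Proof. by have := mvl l => ?; apply: measurableI; mfun. Qed.

Let mrho : measurable_fun setT rho. Proof. exact: L1_measurable ri. Qed.

Let mweight l : measurable_fun setT (weight l).
Proof. by have := mbad l => ?; rewrite /weight; mfun. Qed.

Let weight_ge0 l y : 0 <= weight l y.
Proof. by rewrite /weight !mulr_ge0 ?powR_ge0 ?expR_ge0// indicE. Qed.

Let weight_major l y (T : R) : `|l| <= T ->
  weight l y <= (2 * (1 + T)) `^ a * (rho y * (1 + `|y|) `^ a).
Proof.
move=> lT; have l0 := normr_ge0 l; have y0 := normr_ge0 y.
apply: (@le_trans _ _ (rho y * `|2 * (y - l)| `^ a)).
  rewrite /weight ler_wpM2r ?powR_ge0// ler_piMl ?expR_ge0// indicE; case: (_ \in _) => //=.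
rewrite mulrCA ler_wpM2l ?expR_ge0// -powRM; [|lra|lra].
apply: ge0_ler_powR; rewrite ?nnegrE ?(ltW a0)//; first by rewrite mulr_ge0//; lra.
by rewrite normrM normr_nat; have := ler_normB y l; nra.
Qed.

Let L1_weight l : L1 mu (weight l).
Proof.
have i := riesz_eq_moment a0 a1 c0 hv (ltW a0).
apply: (L1_le (L1Z ((2 * (1 + `|l|)) `^ a) i)); first exact: mweight.
by move=> y; rewrite (ger0_norm (weight_ge0 l y)); exact: weight_major.
Qed.

(* The largest excess v x - v (2 l - x) over x > l is at most c J times itself,
   J being the integral of weight l. *)
Let criterion l : c * \int[mu]_y weight l y < 1 -> good l.
Proof.
move=> cJ x lx; rewrite leNgt; apply/negP => vx.
set J := \int[mu]_y weight l y in cJ.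
have J0 : 0 <= J by exact: int_ge0.
(* Used twice: S = 1 shows that the set of excesses is bounded, and S equal to their supremum gives
   [S <= c J S]. *)
have step S : 0 <= S -> (forall y, bad l y -> rho y - rho (2 * l - y) <= S * rho y) ->
    forall z, l < z -> v z - v (2 * l - z) <= c * J * S.
  move=> S0 hS z lz; have [i ->] := vdiff l z.
  pose H y := S * weight l y.
  have iH : L1 mu H := L1Z S (L1_weight l).
  have H0 y : 0 <= H y by rewrite mulr_ge0.
  have half y : l <= y -> (rho y - rho (2 * l - y)) * D l z y <= H y.
    move=> ly; have [by_|nby] := pselect (bad l y).
      rewrite /H /weight indic_in// mul1r mulrA.
      apply: ler_pM; [|exact: D_ge0 (ltW lz) ly|exact: hS|exact: D_le].
      by case: by_ => _ /=; rewrite subr_ge0 ler_expR => /ltW.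
    apply: le_trans (H0 y).
    move: ly; rewrite le_eqVlt => /orP[/eqP <-|ly].
      have -> : 2 * l - l = l by ring.
      by rewrite subrr mul0r.
    apply: mulr_le0_ge0; last exact: D_ge0 (ltW lz) (ltW ly).
    rewrite subr_le0 ler_expR leNgt; apply/negP => h; exact: nby.
  have iH' := refl_L1 l iH.
  have -> : c * J * S = c / 2 * \int[mu]_y (H y + H (2 * l - y)).
    by rewrite (intD iH iH') (int_refl (2 * l) iH) /H (intZ _ (L1_weight l)) -/J; field.
  rewrite ler_wpM2l ?divr_ge0 ?(ltW c0)//.
  apply: int_le i (L1D iH iH') _ => y.
  have [ly|ly] := leP l y; first by apply: (le_trans (half y ly)); rewrite lerDl.
  have ly' : l <= 2 * l - y by lra.
  have := half _ ly'; rewrite D_refl subKr => h.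
  apply: (@le_trans _ _ (H (2 * l - y))); last by rewrite lerDr.
  by apply: le_trans h; rewrite mulrN -mulNr opprB.
pose A := [set w | exists2 y, bad l y & w = v y - v (2 * l - y)].
have bx : bad l x by [].
have A0 : A (v x - v (2 * l - x)) by exists x.
have ubA : ubound A (c * J * 1).
  move=> _ [y [ly _] ->]; apply: step => // z _.
  by rewrite mul1r gerBl expR_ge0.
have hsA : has_sup A by split; [exists (v x - v (2 * l - x))|exists (c * J * 1)].
pose S := sup A.
have Sx : v x - v (2 * l - x) <= S by exact: sup_upper_bound.
have Sp : 0 < S by apply: lt_le_trans Sx; rewrite subr_gt0.
have : S <= c * J * S.
  apply: ge_sup; first by exists (v x - v (2 * l - x)).
  move=> _ [y [ly _] ->]; apply: step => //; first exact: ltW.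
  move=> z bz; have hz : v z - v (2 * l - z) <= S by apply: sup_upper_bound => //; exists z.
  have -> : rho (2 * l - z) = rho z * expR (- (v z - v (2 * l - z))).
    by rewrite /rho -expRD; congr expR; ring.
  rewrite -[X in X - _]mulr1 -mulrBr mulrC ler_wpM2r ?expR_ge0//.
  by have := expR_ge1Dx (- (v z - v (2 * l - z))); lra.
by nra.
Qed.

(** For [l >= n] the bad set lies in [y > n], where [2 (y - l) <= 2 (1 + y)]; the weight is then
    bounded by the tail of a finite moment. *)
Let good_far : exists T : R, forall l, T <= l -> good l.
Proof.
have i := riesz_eq_moment a0 a1 c0 hv (ltW a0).
have e0 : 0 < (c * 2 `^ a)^-1 by rewrite invr_gt0 mulr_gt0 ?powR_gt0.
have [n hn] := int_tail i e0; exists n%:R => l nl; apply: criterion.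
have n0 : 0 <= n%:R :> R by exact: ler0n.
have iI : L1 mu (fun x => \1_[set y : R | n%:R < `|y|] x * `|expR (v x) * (1 + `|x|) `^ a|).
  by apply: L1_indicM; [mfun|exact: L1_abs].
rewrite mulrC -ltr_pdivlMr// mul1r.
apply: (@le_lt_trans _ _ (2 `^ a * \int[mu]_x (\1_[set y : R | n%:R < `|y|] x * `|expR (v x) * (1 + `|x|) `^ a|))).
  rewrite -(intZ _ iI); apply: int_le (L1_weight l) (L1Z _ iI) _ => y.
  rewrite /weight; have [by_|nby] := pselect (bad l y); last first.
    by rewrite (indic_out nby) !mul0r !mulr_ge0 ?powR_ge0 ?indicE.
  have ly : l < y by case: by_.
  have yn : n%:R < `|y| by rewrite gtr0_norm; lra.
  rewrite (indic_in by_) indic_in// !mul1r (ger0_norm (mulr_ge0 (expR_ge0 _) (powR_ge0 _ _))).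
  rewrite mulrCA ler_wpM2l ?expR_ge0// -powRM; [|lra|by rewrite addr_ge0].
  apply: ge0_ler_powR; rewrite ?nnegrE ?(ltW a0)//.
  by rewrite normrM normr_nat !gtr0_norm; lra.
by move: hn; rewrite invfM -(ltr_pM2l (powR_gt0 a (ltr0n R 2))) mulrCA divff ?mulr1// gt_eqF// powR_gt0.
Qed.

(** A strong maximum principle. Equality at one point x makes the integral of the nonnegative
    continuous function G vanish; D is positive on the half-line y > l, so the density agrees with
    its reflection. *)
Let dichotomy l : good l -> (forall x, l < x -> v x < v (2 * l - x)) \/
  (forall x, v x = v (2 * l - x)).
Proof.
move=> gl; have [h|] := pselect (forall x, l < x -> v x < v (2 * l - x)); [by left|].
move=> /existsNP[x /not_implyP[lx /negP]]; rewrite -leNgt => vx; right.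
have vE : v x - v (2 * l - x) = 0 by apply/eqP; rewrite subr_eq0 eq_le gl.
have [i] := vdiff l x; rewrite vE => /esym/eqP.
rewrite mulf_eq0 gt_eqF ?divr_gt0//= => /eqP I0.
pose G y := (rho (2 * l - y) - rho y) * D l x y.
have Gi : L1 mu G by apply: (eq_L1 _ (L1N i)) => y; rewrite /G; ring.
have IG : \int[mu]_y G y = 0.
  have := intN i; rewrite I0 oppr0 => <-; apply: eq_int => y; rewrite /G; ring.
have half y : l <= y -> 0 <= G y.
  move=> ly; apply: mulr_ge0; last exact: D_ge0 (ltW lx) ly.
  rewrite subr_ge0 ler_expR; move: ly; rewrite le_eqVlt => /orP[/eqP <-|]; last exact: gl.
  by have -> : 2 * l - l = l by ring.
have G0 y : 0 <= G y.
  have [ly|ly] := leP l y; first exact: half.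
  have ly' : l <= 2 * l - y by lra.
  have := half _ ly'; rewrite /G D_refl subKr; have -> // : (rho y - rho (2 * l - y)) * - D l x y =
    (rho (2 * l - y) - rho y) * D l x y by ring.
have cr : continuous rho.
  by move=> y; apply: (@continuous_comp _ _ _ v (@expR R)); [exact: cv|exact: continuous_expR].
have cD z : continuous (fun y : R => `|y - z| `^ a).
  move=> y; apply: (@continuous_comp _ _ _ (fun y => y - z) (fun y => `|y| `^ a)).
    by apply: cvgB; [exact: cvg_id|exact: cvg_cst].
  exact: continuous_abs_powR.
have cG : continuous G.
  move=> y; apply: cvgM; first by apply: cvgB; [exact: continuous_reflect|exact: cr].
  by apply: cvgB; exact: cD.
have Gz := int_le0_eq0 Gi G0 cG; rewrite IG lexx in Gz.
have eq y : l < y -> v (2 * l - y) = v y.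
  move=> ly; have /eqP := Gz isT y; rewrite mulf_eq0 (gt_eqF (D_gt0 lx ly)) orbF.
  by rewrite subr_eq0 => /eqP/expR_inj.
move=> y; have [yl|yl|->] := ltgtP y l.
- have h := eq (2 * l - y) ltac:(lra); by rewrite subKr in h.
- by rewrite eq.
- by have -> : 2 * l - l = l by ring.
Qed.

(** Two reflections compose to a translation, and a periodic v contradicts its divergence to minus
    infinity. *)
Let not_two l l' : l < l' -> (forall x, v x = v (2 * l - x)) ->
  (forall x, v x = v (2 * l' - x)) -> False.
Proof.
move=> ll h h'; pose d := 2 * (l' - l); have d0 : 0 < d by rewrite /d; lra.
have per x : v (x + d) = v x.
  by rewrite (h x) (h' (2 * l - x)); congr v; rewrite /d; ring.
have pern n : v (n%:R * d) = v 0.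
  elim: n => [|n ih]; first by rewrite mul0r.
  by rewrite -natr1 mulrDl mul1r per.
have [k [C [k0 hk]]] := riesz_eq_upper a0 a1 c0 hv.
have [N N1 hN] := powR_growth (C - v 0 + 1) a0 k0.
pose n := (Num.truncn (N / d)).+1.
have nd : N <= n%:R * d.
  have Nd : 0 <= N / d by rewrite divr_ge0 ?(ltW d0)//; lra.
  by rewrite -ler_pdivrMr//; have /andP[_ /ltW] := truncn_itv Nd.
have := hk (n%:R * d); rewrite pern ger0_norm; last by lra.
by have := hN _ nd; lra.
Qed.

Let E : set R := [set l | forall l', l <= l' -> good l'].

Let E_bounded : exists T : R, lbound E T.
Proof.
have [k [C [k0 hk]]] := riesz_eq_upper a0 a1 c0 hv.
have [N N1 hN] := powR_growth (C - v 0 + 1) a0 k0.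
exists (- N) => l El; rewrite leNgt; apply/negP => lN.
have l0 : l < 0 by lra.
have := El l (lexx _) 0 l0; rewrite subr0.
have := hk (2 * l); have n2 : N <= `|2 * l| by rewrite ltr0_norm; lra.
by have := hN _ n2; lra.
Qed.

(** Otherwise planes [s n] that are not good tend to l0 from the left. By strictness every y > l0
    eventually leaves the bad set, every y < l0 lies left of the plane, and at y = l0 the factor of
    the weight tends to 0. The integrals of the weights thus tend to 0 and [criterion] applies. *)
Let open_strict l0 : (forall x, l0 < x -> v x < v (2 * l0 - x)) ->
  exists2 l1, l1 < l0 & forall l, l1 <= l -> l <= l0 -> good l.
Proof.
move=> st; apply: contrapT => nex.
have ex (n : nat) : exists l, [/\ l0 - n.+1%:R^-1 <= l, l <= l0 & ~ good l].
  apply: contrapT => nl; apply: nex; exists (l0 - n.+1%:R^-1).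
    by rewrite gtrBl invr_gt0.
  by move=> l h1 h2; apply: contrapT => ng; apply: nl; exists l.
have /choice[s hs] := ex.
have s_cvg : s n @[n --> \oo] --> l0.
  have c1 : (l0 - n.+1%:R^-1) @[n --> \oo] --> l0.
    rewrite -[X in _ --> X]subr0; apply: cvgB; [exact: cvg_cst|exact: cvg_harmonic].
  apply: (squeeze_cvgr _ c1 (cvg_cst l0)); apply: nearW => n.
  by have [h1 h2 _] := hs n; rewrite h1 h2.
pose T : R := `|l0| + 1.
have sT n : `|s n| <= T.
  have [h1 h2 _] := hs n.
  have n1 : l0 - 1 <= s n.
    by apply: le_trans h1; rewrite lerD2l lerN2 invf_le1// ler1n.
  have := ler_norm l0; have := ler_norm (- l0); rewrite normrN /T ler_norml => h3 h4.
  by apply/andP; split; lra.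
have i := riesz_eq_moment a0 a1 c0 hv (ltW a0).
have cw y : weight (s n) y @[n --> \oo] --> (0 : R).
  have zero : (\forall n \near \oo, ~ bad (s n) y) -> weight (s n) y @[n --> \oo] --> (0 : R).
    move=> nb; apply: cvg_near_cst; near=> n.
    by rewrite /weight indic_out ?mul0r//; near: n.
  have [yl|yl|->] := ltgtP y l0.
  - have ev : \forall n \near \oo, y < s n by move/cvgr_gt : s_cvg; apply.
    apply: zero; near=> n => -[/= syn _].
    by have ysn : y < s n; [near: n|move: (lt_trans ysn syn); rewrite ltxx].
  - apply: zero.
    have c1 : v (2 * s n - y) @[n --> \oo] --> v (2 * l0 - y).
      apply: continuous_cvg; first exact: cv.
      by apply: cvgB; [apply: cvgMl_tmp; exact: s_cvg|exact: cvg_cst].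
    have ev : \forall n \near \oo, v y < v (2 * s n - y).
      by move/cvgr_gt : c1; apply; exact: st.
    near=> n => -[_ /= h'].
    by have h : v y < v (2 * s n - y); [near: n|move: (lt_trans h h'); rewrite ltxx].
  - have c1 : rho l0 * `|2 * (l0 - s n)| `^ a @[n --> \oo] --> rho l0 * 0.
      apply: cvgMl_tmp; have -> : 0 = `|2 * (l0 - l0)| `^ a.
        by rewrite subrr mulr0 normr0 powR0// gt_eqF.
      have := @continuous_cvg _ _ _ _ _ (fun n => 2 * (l0 - s n)) (fun y : R => `|y| `^ a)
        (2 * (l0 - l0)) (@continuous_abs_powR R a a0 _); apply.
      by apply: cvgMl_tmp; apply: cvgB; [exact: cvg_cst|exact: s_cvg].
    rewrite mulr0 in c1.
    apply: (squeeze_cvgr _ (cvg_cst 0) c1); apply: nearW => n; rewrite weight_ge0 /=.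
    by rewrite /weight ler_wpM2r ?powR_ge0// ler_piMl ?expR_ge0// indicE.
have wT n y : `|weight (s n) y| <= (2 * (1 + T)) `^ a * (rho y * (1 + `|y|) `^ a).
  by rewrite (ger0_norm (weight_ge0 _ _)); exact: weight_major.
have [_] := @dct_all _ _ _ mu (fun n => weight (s n)) (fun=> 0)
  (fun y => (2 * (1 + T)) `^ a * (rho y * (1 + `|y|) `^ a))
  (fun n => mweight _) (@measurable_cst _ _ _ _ _ (0 : R)) cw (L1Z _ i)
  wT.
rewrite int0 => /cvgrPdist_lt/(_ c^-1).
rewrite invr_gt0 => /(_ c0)[n _ /(_ n (leqnn n))].
rewrite sub0r normrN ger0_norm; last exact: int_ge0.
rewrite -[X in _ < X]mul1r ltr_pdivlMr// mulrC => /criterion.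
by have [] := hs n.
Unshelve. all: end_near. Qed.

Lemma riesz_eq_symmetric : exists (x0 : R) (u0 : R -> R),
  (forall r t, 0 <= r -> r < t -> u0 t < u0 r) /\ forall x, v x = u0 `|x - x0|.
Proof.
have [T hT] := good_far; have [B hB] := E_bounded.
have ET : E T by move=> l' /hT.
have hi : has_inf E by split; [exists T|exists B].
pose l0 := inf E.
have above l : l0 < l -> good l.
  by move=> l0l; have [e Ee el] := inf_lt hi.1 l0l; exact: Ee _ (ltW el).
(* The inequality passes to the infimum: a failure at l0 would persist, by continuity in l, for
   slightly larger planes. *)
have g0 : good l0.
  move=> x lx; rewrite leNgt; apply/negP => h.
  have c1 : {for l0, continuous (fun l => v (2 * l - x))}.
    apply: (@continuous_comp _ _ _ (fun l => 2 * l - x) v); last exact: cv.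
    have : derat l0 (fun l => 2 * l - x) (0 * l0 + 2 * 1 - 0).
      by apply: derD; [der|apply: derN; exact: der_cst].
    exact: der_cont.
  have n1 : \forall l \near l0, v (2 * l - x) < v x by move/cvgr_lt : c1; apply.
  have n2 : \forall l \near l0, l < x by exact: lt_nbhsl.
  have [d /= d0 hd] := filterI n1 n2.
  have hl : `|l0 - (l0 + d / 2)| < d.
    by rewrite opprD addNKr normrN gtr0_norm; lra.
  have [q1 q2] := hd _ hl.
  have := above (l0 + d / 2) ltac:(lra) x q2; lra.
have sym : forall x, v x = v (2 * l0 - x).
  have [st|//] := dichotomy g0.
  have [l1 l1l hl1] := open_strict st.
  have : E l1.
    move=> l ll; have [h|h] := leP l l0; [exact: hl1|exact: above].
  by move=> /(ge_inf hi.2); rewrite -/l0 leNgt l1l.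
(* Beyond l0 a second axis of symmetry is excluded. The reflection about the midpoint of l0 + r and
   l0 + t then compares these two values, which yields strict decrease. *)
have strict l : l0 < l -> forall x, l < x -> v x < v (2 * l - x).
  move=> ll; have [//|sl] := dichotomy (above l ll).
  by have := not_two ll sym sl.
exists l0, (fun r => v (l0 + r)); split => [r t r0 rt|x].
  pose l := l0 + (r + t) / 2.
  have h := strict l ltac:(rewrite /l; lra) (l0 + t) ltac:(rewrite /l; lra).
  by have -> : l0 + r = 2 * l - (l0 + t) by rewrite /l; field.
have [h|h] := leP 0 (x - l0); first by rewrite ger0_norm// addrC subrK.
by rewrite ltr0_norm// sym; congr v; ring.
Qed.

End moving_planes.

(** * Uniqueness *)

Section monotone_transport.
Context (R : realType).
Notation mu := (@lebesgue_measure R).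
Implicit Types (f g F G T rho : R -> R) (x y z p : R).

Lemma der_mvt F f x y : (forall z, derat z F (f z)) -> x <= y ->
  exists z, F y - F x = f z * (y - x).
Proof.
move=> dF xy; have [] := @MVT_segment R F f x y xy.
- by move=> z _; exact: dF.
- by apply: continuous_subspaceT => z; exact: der_cont (dF z).
- by move=> z _ ->; exists z.
Qed.

Lemma der_nondecreasing F f x y : (forall z, derat z F (f z)) -> (forall z, 0 <= f z) ->
  x <= y -> F x <= F y.
Proof.
move=> dF f0 xy; have [z e] := der_mvt dF xy.
by rewrite -subr_ge0 e mulr_ge0// subr_ge0.
Qed.

Lemma der_increasing F f x y : (forall z, derat z F (f z)) -> (forall z, 0 < f z) ->
  x < y -> F x < F y.
Proof.
move=> dF f0 xy; have [z e] := der_mvt dF (ltW xy).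
by rewrite -subr_gt0 e mulr_gt0// subr_gt0.
Qed.

Lemma cvg_indic_ball (k x : R) : \1_`[- n%:R, n%:R] x * k @[n --> \oo] --> k.
Proof.
apply: cvg_near_cst; near=> n; rewrite indic_in ?mul1r//= in_itv/= -ler_norml.
by near: n; exact: nbhs_infty_ger.
Unshelve. all: end_near. Qed.

Lemma cvg_int_ball f : L1 mu f ->
  \int[mu]_x (\1_`[- n%:R, n%:R] x * f x) @[n --> \oo] --> \int[mu]_x f x.
Proof.
move=> fi; have mf := L1_measurable fi.
have h1 (n : nat) : measurable_fun setT (fun x => \1_`[- n%:R, n%:R] x * f x) by mfun.
have h3 (n : nat) x : `|\1_`[- n%:R, n%:R] x * f x| <= `|f x|.
  by rewrite normrM ler_piMl// indicE; case: (_ \in _); rewrite ?normr1 ?normr0.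
by have [] := @dct_all _ _ _ mu _ f _ h1 mf (fun x => @cvg_indic_ball (f x) x) (L1_abs fi) h3.
Qed.

Lemma int_der_decay F f : (forall x, derat x F (f x)) -> continuous f -> L1 mu f ->
  F n%:R @[n --> \oo] --> (0 : R) -> F (- n%:R) @[n --> \oo] --> (0 : R) ->
  \int[mu]_x f x = 0.
Proof.
move=> dF cf fi F1 F2.
have e (n : nat) : \int[mu]_x (\1_`[- n%:R, n%:R] x * f x) = F n%:R - F (- n%:R).
  have h : - n%:R <= n%:R :> R by have := ler0n R n; lra.
  by have [] := ftc_itv h (fun x _ => dF x) (fun x _ => cf x).
have c2 : (F n%:R - F (- n%:R)) @[n --> \oo] --> (0 : R).
  by rewrite -[X in _ --> X](subrr 0); exact: cvgB.
apply: (cvg_unique (@Rhausdorff R) (cvg_int_ball fi)).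
by rewrite (_ : (fun n : nat => _) = (fun n : nat => F n%:R - F (- n%:R)))//; apply/funext.
Qed.

(** The fundamental theorem of calculus gives the formula on [- n, n]; surjectivity of T makes the
    image intervals exhaust the line. *)
Lemma transport_integral T t g : (forall x, derat x T (t x)) -> continuous t ->
  (forall x, 0 <= t x) -> (forall y, exists x, T x = y) ->
  continuous g -> (forall x, 0 <= g x) -> L1 mu g ->
  L1 mu (fun x => g (T x) * t x) /\ \int[mu]_x (g (T x) * t x) = \int[mu]_x g x.
Proof.
move=> dT ct t0 sT cg g0 gi.
have cT : continuous T by move=> x; exact: der_cont (dT x).
have nT x y : x <= y -> T x <= T y by exact: der_nondecreasing.
pose h x := g (T x) * t x; pose G y := \int[mu]_x (\1_`]-oo, y] x * g x).
have dG y : derat y G (g y) by exact: der_primitive.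
have ch : continuous h.
  by move=> x; apply: cvgM; [apply: (@continuous_comp _ _ _ T g); [exact: cT|exact: cg]|exact: ct].
have h0 x : 0 <= h x by rewrite mulr_ge0.
have dGT x : derat x (fun x => G (T x)) (h x).
  by apply: (der_val (der_comp (dT x) (dG (T x)))); rewrite mulrC.
have nn (n : nat) : - n%:R <= n%:R :> R by have := ler0n R n; lra.
have e1 n := ftc_itv (nn n) (fun x _ => dGT x) (fun x _ => ch x).
have e2 (n : nat) := ftc_itv (nT _ _ (nn n)) (fun x _ => dG x) (fun x _ => cg x).
have ind01 (A : set R) x : (0 : R) <= (\1_A x : R) <= 1.
  by rewrite indicE; case: (_ \in _); rewrite ?lexx ?ler01.
have i0 (A : set R) x : (0 : R) <= (\1_A x : R) by case/andP: (ind01 A x).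
have b n : \int[mu]_x (\1_`[- n%:R, n%:R] x * h x) <= \int[mu]_x g x.
  rewrite (e1 n).2 -(e2 n).2; apply: int_le (e2 n).1 gi _ => x.
  by rewrite ler_piMl//; case/andP: (ind01 (`[T (- n%:R), T n%:R]%classic) x).
have ch1 x := @cvg_indic_ball (h x) x.
have [hi _] := @L1_fatou _ _ _ mu (fun n x => \1_`[- n%:R, n%:R] x * h x) h _
  (fun n => (e1 n).1) (fun n x => mulr_ge0 (i0 _ _) (h0 x)) (continuous_measurable_fun ch) ch1 b.
split => //.
have c1 := cvg_int_ball hi.
have mg := L1_measurable gi.
have [_ c2] : L1 mu g /\ \int[mu]_x (\1_`[T (- n%:R), T n%:R] x * g x) @[n --> \oo] --> \int[mu]_x g x.
  apply: (@dct_all _ _ _ mu (fun n x => \1_`[T (- n%:R), T n%:R] x * g x) g g) => //.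
  - by move=> n; mfun.
  - move=> y; have [x Tx] := sT y; apply: cvg_near_cst; near=> n.
    have xn : `|x| <= n%:R by near: n; exact: nbhs_infty_ger.
    move: xn; rewrite ler_norml => /andP[x1 x2].
    by rewrite indic_in ?mul1r//= in_itv/= -Tx !nT.
  - by move=> n x; rewrite ger0_norm ?mulr_ge0// ler_piMl//; case/andP: (ind01 (`[T (- n%:R), T n%:R]%classic) x).
apply: (cvg_unique (@Rhausdorff R) c1).
suff -> : (fun n : nat => \int[mu]_x (\1_`[- n%:R, n%:R] x * h x)) =
  (fun n : nat => \int[mu]_x (\1_`[T (- n%:R), T n%:R] x * g x)) by [].
by apply/funext => n; rewrite (e1 n).2 (e2 n).2.
Unshelve. all: end_near. Qed.

Let prim rho y := \int[mu]_x (\1_`]-oo, y] x * rho x).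

Lemma prim_surjective rho p : continuous rho -> (forall x, 0 < rho x) -> L1 mu rho ->
  0 < p -> p < \int[mu]_x rho x -> exists y, prim rho y = p.
Proof.
move=> cr r0 ri p0 pM; have mr := L1_measurable ri.
have dP y : derat y (prim rho) (rho y) by exact: der_primitive.
have dom (A : set R) x : `|\1_A x * rho x| <= `|rho x|.
  by rewrite normrM ler_piMl// indicE; case: (_ \in _); rewrite ?normr1 ?normr0.
have c1 : prim rho n%:R @[n --> \oo] --> \int[mu]_x rho x.
  have [] // := @dct_all _ _ _ mu (fun n x => \1_`]-oo, n%:R] x * rho x) rho (fun x => `|rho x|).
  - by move=> n; mfun.
  - move=> x; apply: cvg_near_cst; near=> n; rewrite indic_in ?mul1r//= in_itv/=.
    by apply: (le_trans (ler_norm _)); near: n; exact: nbhs_infty_ger.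
  - exact: L1_abs.
have c2 : prim rho (- n%:R) @[n --> \oo] --> (0 : R).
  have [] // := @dct_all _ _ _ mu (fun n x => \1_`]-oo, - n%:R] x * rho x) (fun=> 0) (fun x => `|rho x|).
  - by move=> n; mfun.
  - move=> x; apply: cvg_near_cst; near=> n; rewrite indic_out ?mul0r//= in_itv/=.
    apply/negP; rewrite -ltNge ltrNl; apply: (le_lt_trans (ler_norm _)); rewrite normrN.
    by near: n; exact: nbhs_infty_gtr.
  - exact: L1_abs.
  by rewrite int0.
have n1 : \forall n \near \oo, p < prim rho n%:R by move/cvgr_gt : c1; apply.
have n2 : \forall n \near \oo, prim rho (- n%:R) < p by move/cvgr_lt : c2; apply.
have [N _ hN] := filterI n1 n2; have [h1 h2] := hN N (leqnn N).
have nn : - N%:R <= N%:R :> R by have := ler0n R N; lra.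
have [| |y _ <-] := @IVT R (prim rho) (- N%:R) N%:R p nn; last by exists y.
  by apply: continuous_subspaceT => z; exact: der_cont (dP z).
by rewrite ge_min le_max (ltW h1) (ltW h2) orbT.
Unshelve. all: end_near. Qed.

(** T is the inverse distribution function of rho1 after that of rho0. Equal masses give both
    distribution functions the same range, the open interval from 0 to the mass. *)
Lemma transport_map rho0 rho1 : continuous rho0 -> continuous rho1 ->
  (forall x, 0 < rho0 x) -> (forall x, 0 < rho1 x) -> L1 mu rho0 -> L1 mu rho1 ->
  \int[mu]_x rho0 x = \int[mu]_x rho1 x ->
  exists T, (forall x, derat x T (rho0 x / rho1 (T x))) /\ forall y, exists x, T x = y.
Proof.
move=> cr0 cr1 r0 r1 ri0 ri1 eM.
have pr (rho : R -> R) : continuous rho -> (forall x, 0 < rho x) -> L1 mu rho ->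
    [/\ forall y, derat y (prim rho) (rho y), forall x y, x < y -> prim rho x < prim rho y &
        forall y, 0 < prim rho y < \int[mu]_x rho x].
  move=> cr rp ri.
  have dP y : derat y (prim rho) (rho y) by exact: der_primitive.
  have inc x y : x < y -> prim rho x < prim rho y by exact: der_increasing.
  split=> // y; apply/andP; split.
    apply: (le_lt_trans _ (inc (y - 1) y _)); last by lra.
    by apply: int_ge0 => x; rewrite mulr_ge0 ?(ltW (rp x))// indicE.
  apply: (lt_le_trans (inc y (y + 1) _)); first by lra.
  apply: int_le (L1_indicM (measurable_itv _) ri) ri _ => x.
  by rewrite ler_piMl ?(ltW (rp x))// indicE; case: (_ \in _).
have [d0 inc0 b0] := pr _ cr0 r0 ri0; have [d1 inc1 b1] := pr _ cr1 r1 ri1.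
have ex p : exists y, 0 < p < \int[mu]_x rho1 x -> prim rho1 y = p.
  have [/andP[p0 pM]|np] := boolP (0 < p < \int[mu]_x rho1 x); last by exists 0.
  by have [y hy] := prim_surjective cr1 r1 ri1 p0 pM; exists y.
have /choice[X hX] := ex.
have inj1 x y : prim rho1 x = prim rho1 y -> x = y.
  by move=> e; have [h|h|//] := ltgtP x y; have := inc1 _ _ h; rewrite e ltxx.
have XK : cancel (prim rho1) X by move=> y; apply: inj1; exact: hX.
have PT x : prim rho1 (X (prim rho0 x)) = prim rho0 x.
  by apply: hX; rewrite -eM.
exists (fun x => X (prim rho0 x)); split => [x|y].
  have dX : derat (prim rho0 x) X (rho1 (X (prim rho0 x)))^-1.
    rewrite -{1}(PT x); apply: is_derive_inverse; last by rewrite gt_eqF.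
    - by near=> z; exact: XK.
    - by near=> z; exact: der_cont (d1 z).
    - exact: d1.
  exact: der_comp (d0 x) dX.
have /andP[p0 pM] := b1 y; rewrite -eM in pM.
by have [x hx] := prim_surjective cr0 r0 ri0 p0 pM; exists x; rewrite hx XK.
Unshelve. all: end_near. Qed.

(** The tangent of the concave power at 1: [1 + x <= exp x] is taken at [(1 - p) ln r] and at
    [- p ln r], and the two are combined with weights p and 1 - p. *)
Lemma powR_tangent (p r : R) : 0 < p -> p < 1 -> 0 < r -> r `^ p <= p * r + (1 - p).
Proof.
move=> p0 p1 r0; rewrite /powR gt_eqF//; set l := ln r.
have rE : r = expR l by rewrite lnK.
have h1 : expR (p * l) * (1 + (1 - p) * l) <= r.
  have -> : r = expR (p * l) * expR ((1 - p) * l) by rewrite rE -expRD; congr expR; ring.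
  by rewrite ler_wpM2l ?expR_ge0// expR_ge1Dx.
have h2 : expR (p * l) * (1 - p * l) <= 1.
  rewrite [leRHS](_ : 1 = expR (p * l) * expR (- (p * l))); last by rewrite -expRD subrr expR0.
  by rewrite ler_wpM2l ?expR_ge0// expR_ge1Dx.
have q1 : 0 <= 1 - p by lra.
have := ler_wpM2l (ltW p0) h1; have := ler_wpM2l q1 h2.
have -> : (1 - p) * (expR (p * l) * (1 - p * l)) =
  expR (p * l) - p * (expR (p * l) * (1 + (1 - p) * l)) by ring.
lra.
Qed.

(* Jensen's inequality for the concave power, by the tangent line at the mean
   slope m of T. *)
Lemma powR_jensen (p : R) (T t Z z : R -> R) x y : 0 < p -> p < 1 -> (forall u, derat u T (t u)) ->
  (forall u, derat u Z (z u)) -> (forall u, 0 < t u) -> (forall u, z u <= t u `^ p) ->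
  x < y -> Z y - Z x <= (y - x) `^ (1 - p) * (T y - T x) `^ p.
Proof.
move=> p0 p1 dT dZ t0 zt xy.
have Txy : 0 < T y - T x by rewrite subr_gt0; exact: der_increasing xy.
have d0 : 0 < y - x by rewrite subr_gt0.
pose m := (T y - T x) / (y - x); have m0 : 0 < m by rewrite divr_gt0.
have mp : 0 < m `^ p by rewrite powR_gt0.
pose H u := m `^ p * (p * (m^-1 * T u) + (1 - p) * u) - Z u.
have dH u : derat u H (m `^ p * (p * (m^-1 * t u) + (1 - p)) - z u).
  apply: der_val.
    apply: derD; last exact: derN (dZ u).
    apply: derM; [exact: der_cst|apply: derD].
      by apply: derM; [exact: der_cst|apply: derM; [exact: der_cst|exact: dT]].
    by apply: derM; [exact: der_cst|exact: der_id].
  by rewrite /=; ring.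
have H0 u : 0 <= m `^ p * (p * (m^-1 * t u) + (1 - p)) - z u.
  rewrite subr_ge0; apply: (le_trans (zt u)).
  have -> : t u = m * (m^-1 * t u) by rewrite mulVKf// gt_eqF.
  have q0 : 0 < m^-1 * t u by rewrite mulr_gt0 ?invr_gt0.
  rewrite powRM ?(ltW m0) ?(ltW q0)// mulKf ?gt_eqF// ler_wpM2l ?powR_ge0//.
  exact: powR_tangent.
have := der_nondecreasing dH H0 (ltW xy); rewrite -subr_ge0.
have -> : H y - H x = m `^ p * (p * (m^-1 * (T y - T x)) + (1 - p) * (y - x)) - (Z y - Z x).
  by rewrite /H; ring.
have -> : m^-1 * (T y - T x) = y - x.
  by rewrite /m invf_div mulrAC mulfK// gt_eqF.
have -> : p * (y - x) + (1 - p) * (y - x) = y - x by ring.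
rewrite subr_ge0 => h; apply: (le_trans h).
rewrite /m powRM ?invr_ge0 ?(ltW Txy) ?(ltW d0)//.
have e : (y - x)^-1 `^ p * (y - x) = (y - x) `^ (1 - p).
  rewrite -[X in _ * X](powRr1 (ltW d0)) -(powR_inv1 (ltW d0)) -powRrM mulN1r -powRD.
    by congr (_ `^ _); ring.
  by rewrite (gt_eqF d0) implybT.
by rewrite -mulrA e mulrC.
Qed.

End monotone_transport.

(** * The virial identity *)

Section virial.
Context (R : realType) (a c : R) (a0 : 0 < a) (a1 : a < 1) (c0 : 0 < c).
Context (v : R -> R) (hv : riesz_eq a c v).
Notation mu := (@lebesgue_measure R).
Implicit Types (x y : R) (Z z : R -> R).

Ltac alra := pose proof a0; pose proof a1; lra.

Let rho x := expR (v x).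
Let ri : L1 mu rho. Proof. by case: hv. Qed.
Let cv := riesz_eq_continuous a0 a1 hv.
Let mrho : measurable_fun setT rho. Proof. exact: L1_measurable ri. Qed.

Let crho : continuous rho.
Proof.
move=> x; apply: (@continuous_comp _ _ _ v (@expR R)); first exact: cv.
exact: continuous_expR.
Qed.

(** The inner part pairs an integrable kernel with a bounded density, the outer part a bounded
    kernel with an integrable density. *)
Lemma riesz_eq_dpowR_bound : exists2 K : R, 0 <= K &
  forall y, \int[mu]_x `|expR (v x) * dpowR a (y - x)| <= K.
Proof.
have thi := L1_inner_dpowR a0 a1.
have [_ [K1 hK] _] := nbdd_outer a0 a1 0.
have K10 : 0 <= K1 := le_trans (normr_ge0 _) (hK 0).
have [B hB] := riesz_eq_bounded_above a0 a1 c0 hv.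
pose M := \int[mu]_x rho x; pose N := \int[mu]_x `|inner_dpowR a x|.
have M0 : 0 <= M by apply: int_ge0 => x; exact: expR_ge0.
have N0 : 0 <= N by exact: int_ge0.
exists (expR B * N + K1 * M) => [|y]; first by rewrite addr_ge0 ?mulr_ge0 ?expR_ge0.
have i1 := L1_refl y (L1_abs thi).
have eN := int_refl y (L1_abs thi); rewrite /N /M -eN -(intZ _ i1) -(intZ _ ri) -(intD (L1Z _ i1) (L1Z _ ri)).
apply: int_le (L1_abs (riesz_eq_L1_dpowR a0 a1 c0 hv y)) (L1D (L1Z _ i1) (L1Z _ ri)) _ => x.
rewrite normrM (gtr0_norm (expR_gt0 _)) /inner_dpowR.
set D := dpowR a (y - x); set k := derive1 _ _.
have kK : `|k| <= K1 by exact: hK.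
have h : `|D| <= `|D - k| + `|k| by have := ler_normD (D - k) k; rewrite subrK.
apply: (le_trans (ler_wpM2l (expR_ge0 _) h)); rewrite mulrDr; apply: lerD.
  have he : expR (v x) <= expR B by rewrite ler_expR.
  exact: ler_wpM2r (normr_ge0 _) _ _ he.
rewrite mulrC; exact: ler_wpM2r (expR_ge0 _) _ _ kK.
Qed.

(* Integrate v' e^v Z by parts and antisymmetrise in x and y. *)
Lemma virial Z z (C : R) : (forall y, derat y Z (z y)) -> continuous z ->
  (forall y, `|z y| <= C) -> (forall y, `|Z y| <= C * (1 + `|y|)) ->
  L1prod mu mu (fun y x => expR (v y) * expR (v x) * (dpowR a (y - x) * (Z y - Z x))) /\
  \int[mu]_y (expR (v y) * z y) =
  c / 2 * \int[mu]_y \int[mu]_x (expR (v y) * expR (v x) * (dpowR a (y - x) * (Z y - Z x))).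
Proof.
move=> dZ cz zC ZC; have C0 : 0 <= C := le_trans (normr_ge0 _) (zC 0).
have cZ : continuous Z by move=> y; exact: der_cont (dZ y).
have mZ := continuous_measurable_fun cZ; have mz := continuous_measurable_fun cz.
have [K K0 hK] := riesz_eq_dpowR_bound.
have iD := riesz_eq_L1_dpowR a0 a1 c0 hv.
have i1 : L1 mu (fun y => rho y * (1 + `|y|)).
  apply: (eq_L1 _ (riesz_eq_moment a0 a1 c0 hv (ler01))) => y.
  by rewrite powRr1// addr_ge0.
have iZ : L1 mu (fun y => rho y * Z y).
  apply: (L1_le (L1Z C i1)); first by mfun.
  move=> y; rewrite normrM (gtr0_norm (expR_gt0 _)) mulrCA ler_wpM2l ?expR_ge0//.
have iz : L1 mu (fun y => rho y * z y).
  apply: (L1_le (L1Z C ri)); first by mfun.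
  by move=> y; rewrite normrM (gtr0_norm (expR_gt0 _)) mulrC ler_wpM2r ?expR_ge0.
pose G y x := rho y * Z y * (rho x * dpowR a (y - x)).
have md := measurable_dpowR a.
have Gi : L1prod mu mu G.
  apply: (@L1prodP _ _ _ _ _ mu mu G (fun y => `|rho y * Z y| * K)).
  - rewrite /G.
    have m1 : measurable_fun setT (fun u : R * R => rho u.1) by apply: (mfun_comp mrho); mfun.
    have m2 : measurable_fun setT (fun u : R * R => rho u.2) by apply: (mfun_comp mrho); mfun.
    have m3 : measurable_fun setT (fun u : R * R => Z u.1) by apply: (mfun_comp mZ); mfun.
    have m4 : measurable_fun setT (fun u : R * R => dpowR a (u.1 - u.2)) by apply: (mfun_comp md); mfun.
    by mfun.
  - by move=> y; exact: L1Z (iD y).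
  - move=> y; rewrite (eq_int mu (f := fun x => `|G y x|)
      (g := fun x => `|rho y * Z y| * `|rho x * dpowR a (y - x)|)); last first.
      by move=> x; rewrite /G normrM.
    by rewrite (intZ _ (L1_abs (iD y))) ler_wpM2l.
  - exact: L1Zr (L1_abs iZ).
have Gi' := L1prod_swap Gi.
have E y x : G y x + G x y = rho y * rho x * (dpowR a (y - x) * (Z y - Z x)).
  by rewrite /G -(opprB y x) dpowRN; ring.
have Si : L1prod mu mu (fun y x => G y x + G x y) by exact: L1D Gi Gi'.
split.
  by apply: (eq_L1 _ Si) => -[y x] /=; rewrite E.
pose A y := \int[mu]_x (rho x * dpowR a (y - x)).
have [iA eA] := L1prod_int1 Gi; have [iA' eA'] := L1prod_int1 Gi'.
have GA y : \int[mu]_x G y x = rho y * Z y * A y by rewrite /G (intZ _ (iD y)).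
have d y : derat y (fun y => rho y * Z y) (rho y * z y - c * (\int[mu]_x G y x)).
  apply: (der_val (derM (der_expR (riesz_eq_der a0 a1 c0 hv y)) (dZ y))).
  by rewrite GA /A /rho; ring.
have sv := riesz_eq_smooth a0 a1 c0 hv.
have cA : continuous A.
  have -> : A = fun y => - c^-1 * derive1 v y.
    apply/funext => y; rewrite (der_derive1 (riesz_eq_der a0 a1 c0 hv y)) -/(A y).
    by rewrite mulrA mulrNN mulVf ?mul1r// gt_eqF.
  move=> y; apply: cvgMl_tmp; exact: smooth_continuous (smooth_derive1 sv) y.
have idf := L1B iz (L1Z c iA).
have [B B0 hB] := riesz_eq_decay a0 a1 c0 hv (ler0n R 2).
have lim0 (s : R) : `|s| = 1 -> rho (s * n%:R) * Z (s * n%:R) @[n --> \oo] --> (0 : R).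
  move=> s1; have ch : (B * C * n.+1%:R^-1) @[n --> \oo] --> (0 : R).
    by rewrite -[X in _ --> X](mulr0 (B * C)); apply: cvgMl_tmp; exact: cvg_harmonic.
  apply/norm_cvg0P; apply: (squeeze_cvgr _ (cvg_cst 0) ch).
  apply: nearW => n; rewrite normr_ge0 /= normrM (gtr0_norm (expR_gt0 _)).
  have sn : 1 + `|s * n%:R| = n.+1%:R by rewrite normrM s1 mul1r normr_nat -natr1 addrC.
  have := hB (s * n%:R); have := ZC (s * n%:R); rewrite sn => h1 h2.
  apply: (le_trans (ler_pM (expR_ge0 _) (normr_ge0 _) h2 h1)).
  rewrite (powR_invn 2) ?ler0n//; have := ltr0Sn R n.
  move: (n.+1%:R : R) => w w0; rewrite le_eqVlt; apply/orP; left; apply/eqP.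
  by field; rewrite gt_eqF.
have l1 := lim0 1 (normr1 _); have l2 := lim0 (- 1) ltac:(by rewrite normrN normr1).
have I0 : \int[mu]_y (rho y * z y - c * (\int[mu]_x G y x)) = 0.
  apply: (int_der_decay d _ idf).
  - move=> y; apply: cvgB; first by apply: cvgM; [exact: crho|exact: cz].
    apply: cvgMl_tmp; under eq_cvg do rewrite GA.
    rewrite GA; apply: cvgM; last exact: cA.
    by apply: cvgM; [exact: crho|exact: cZ].
  - by move: l1; under eq_cvg do rewrite mul1r.
  - by move: l2; under eq_cvg do rewrite mulN1r.
rewrite (intB iz (L1Z c iA)) (intZ _ iA) in I0.
have e1 := subr0_eq I0.
rewrite e1.
have [_ eS] := L1prod_int1 Si.
have eD := @intD _ _ _ (mu \x mu)%E _ _ Gi Gi'.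
rewrite (eq_int mu (f := fun y => \int[mu]_x (expR (v y) * expR (v x) * (dpowR a (y - x) * (Z y - Z x))))
   (g := fun y => \int[mu]_x (G y x + G x y))); last first.
  by move=> y; apply: eq_int => x; rewrite E.
rewrite (etrans eS (etrans eD (congr2 +%R (esym eA) (etrans (esym eA') (esym (int_exchange mu mu G Gi)))))).
by move: (\int[mu]_y _) => I; field.
Qed.

End virial.

(** * Interaction energy and scaling *)

Section pohozaev.
Context (R : realType) (a c : R) (a0 : 0 < a) (a1 : a < 1) (c0 : 0 < c).
Notation mu := (@lebesgue_measure R).
Implicit Types (x y m : R) (v : R -> R).

(** The virial identity with [Z y = y], since [dpowR a h * h = a |h|^a]. It makes the interaction
    energy a function of the mass alone. *)
Lemma pohozaev v : riesz_eq a c v ->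
  L1 mu (fun y => expR (v y) * \int[mu]_x (expR (v x) * `|x - y| `^ a)) /\
  \int[mu]_y (expR (v y) * \int[mu]_x (expR (v x) * `|x - y| `^ a)) =
  2 / (c * a) * \int[mu]_y expR (v y).
Proof.
move=> hv.
have z1 y : `|1 : R| <= 1 by rewrite normr1.
have Z1 y : `|y| <= 1 * (1 + `|y|) by rewrite mul1r lerDr.
have c1 : continuous (fun _ : R => 1 : R) by move=> x; exact: cvg_cst.
have [Fi e] := virial a0 a1 c0 hv (fun y => der_id y) c1 z1 Z1.
have E y : \int[mu]_x (expR (v y) * expR (v x) * (dpowR a (y - x) * (y - x))) =
    a * (expR (v y) * \int[mu]_x (expR (v x) * `|x - y| `^ a)).
  have i := riesz_eq_L1_dist a0 a1 c0 hv y.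
  rewrite mulrA -(intZ _ i); apply: eq_int => x.
  have -> : dpowR a (y - x) * (y - x) = a * `|x - y| `^ a.
    rewrite distrC /dpowR; have [->|n0] := eqVneq (y - x) 0.
      by rewrite mulr0 normr0 powR0 ?gt_eqF// mulr0.
    by rewrite -(normr_powR_sqr a n0); ring.
  by ring.
have [i _] := L1prod_int1 Fi.
have i' : L1 mu (fun y => expR (v y) * \int[mu]_x (expR (v x) * `|x - y| `^ a)).
  apply: (eq_L1 _ (L1Z a^-1 i)) => y.
  by rewrite E mulKf// gt_eqF.
split=> //; move: e; rewrite (eq_int mu E) (intZ _ i').
rewrite (eq_int mu (f := fun y => expR (v y) * 1) (g := fun y => expR (v y))); last first.
  by move=> y; rewrite mulr1.
move=> ->; move: (\int[mu]_y _) => I; field.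
by rewrite !gt_eqF.
Qed.

(** With [1 + a = 2 s] this is the scaling in the family of Q_s. The mass is multiplied by [m^a], so
    every positive mass is attained. *)
Lemma riesz_eq_scale v m : 0 < m -> riesz_eq a c v ->
  riesz_eq a c (fun x => v (m * x) + (1 + a) * ln m) /\
  \int[mu]_x expR (v (m * x) + (1 + a) * ln m) = m `^ a * \int[mu]_x expR (v x).
Proof.
move=> m0 hv; have [vi [b vE]] := hv; have mn : m != 0 by rewrite gt_eqF.
have E x : expR (v (m * x) + (1 + a) * ln m) = m `^ (1 + a) * expR (v (m * x + 0)).
  by rewrite addr0 expRD mulrC /powR (gt_eqF m0).
have i := L1_affine 0 mn vi.
have mE : m `^ (1 + a) = m * m `^ a.
  by rewrite powRD ?powRr1 ?(ltW m0)// mn implybT.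
split; last first.
  rewrite (eq_int mu E) (intZ _ i) (int_affine 0 mn vi) (gtr0_norm m0) mE.
  by move: (\int[mu]_x _) => I; field.
split; first by apply: (eq_L1 _ (L1Z (m `^ (1 + a)) i)) => x; rewrite E.
exists (b + (1 + a) * ln m) => y.
have j := L1_riesz a0 a1 (m * y) vi.
have e2 := int_affine 0 mn j.
have jj := L1_affine 0 mn j.
have e3 : potential a (fun x => expR (v x)) (m * y) = m * \int[mu]_x
    (expR (v (m * x + 0)) * (`|m * x + 0 - m * y| `^ a - `|m * x + 0| `^ a)).
  by rewrite e2 (gtr0_norm m0) mulVKf.
have -> : potential a (fun x => expR (v (m * x) + (1 + a) * ln m)) y =
    potential a (fun x => expR (v x)) (m * y).
  rewrite e3 -(intZ _ jj); apply: eq_int => x.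
  rewrite E mE addr0 /riesz -mulrBr !normrM (gtr0_norm m0) !powRM ?(ltW m0)//.
  by ring.
by rewrite vE; move: (potential _ _ _) => p; ring.
Qed.

End pohozaev.

(** * Comparison of two solutions by monotone transport *)

Section comparison.
Context (R : realType) (a c : R) (a0 : 0 < a) (a1 : a < 1) (c0 : 0 < c).
Notation mu := (@lebesgue_measure R).
Context (v0 v1 : R -> R) (hv0 : riesz_eq a c v0) (hv1 : riesz_eq a c v1).
Implicit Types (x y b : R).

Let rho0 x := expR (v0 x).
Let rho1 x := expR (v1 x).

Let cexp (v : R -> R) : continuous v -> continuous (fun x => expR (v x)).
Proof.
move=> cv x; apply: (@continuous_comp _ _ _ v (@expR R)); first exact: cv.
exact: continuous_expR.
Qed.

(* Let T transport e^v0 to e^v1 monotonically. The virial identity for v0 with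
   z = (T')^a and Jensen's inequality bound the integral of e^v0 z by the mass M;
   the integral of e^v0 log z is a (b0 - b1) M; and log z <= z - 1. *)
Lemma riesz_eq_compare b0 b1 :
  (forall y, v0 y = b0 - c * \int[mu]_x (expR (v0 x) * `|x - y| `^ a)) ->
  (forall y, v1 y = b1 - c * \int[mu]_x (expR (v1 x) * `|x - y| `^ a)) ->
  \int[mu]_x expR (v0 x) = \int[mu]_x expR (v1 x) ->
  b0 <= b1 /\ (b1 <= b0 -> exists t, forall x, v0 x = v1 (x + t)).
Proof.
move=> E0 E1 eM.
have M0' := riesz_eq_mass_gt0 hv1.
have [ri0 _] := hv0; have [ri1 _] := hv1.
have [i0' P0'] := pohozaev a0 a1 c0 hv0; have [i1' P1'] := pohozaev a0 a1 c0 hv1.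
have [phi0 phi0E] : exists p : R -> R, forall y, \int[mu]_x (rho0 x * `|x - y| `^ a) = p y.
  by exists (fun y => \int[mu]_x (rho0 x * `|x - y| `^ a)).
have [phi1 phi1D] : exists p : R -> R, forall y, \int[mu]_x (rho1 x * `|x - y| `^ a) = p y.
  by exists (fun y => \int[mu]_x (rho1 x * `|x - y| `^ a)).
have [M ME] : exists M : R, \int[mu]_x rho1 x = M by exists (\int[mu]_x rho1 x).
have e0 y : v0 y = b0 - c * phi0 y by rewrite E0 phi0E.
have e1 y : v1 y = b1 - c * phi1 y by rewrite E1 phi1D.
have phi1_ge0 y : 0 <= phi1 y.
  by rewrite -phi1D; apply: int_ge0 => x; rewrite mulr_ge0 ?expR_ge0 ?powR_ge0.
have X0 y : expR (v0 y) * \int[mu]_x (expR (v0 x) * `|x - y| `^ a) = rho0 y * phi0 y.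
  by rewrite -phi0E.
have X1 y : expR (v1 y) * \int[mu]_x (expR (v1 x) * `|x - y| `^ a) = rho1 y * phi1 y.
  by rewrite -phi1D.
have i0 : L1 mu (fun y => rho0 y * phi0 y) by apply: (eq_L1 _ i0') => y; exact: X0.
have i1 : L1 mu (fun y => rho1 y * phi1 y) by apply: (eq_L1 _ i1') => y; exact: X1.
have MI : \int[mu]_x rho0 x = M by exact: etrans eM ME.
have P0 : \int[mu]_y (rho0 y * phi0 y) = 2 / (c * a) * M.
  by rewrite -(eq_int mu X0) P0' eM -ME.
have P1 : \int[mu]_y (rho1 y * phi1 y) = 2 / (c * a) * M.
  by rewrite -(eq_int mu X1) P1' -ME.
have M0 : 0 < M by rewrite -ME.
move=> {i0' P0' i1' P1' M0' E0 E1 X0 X1}.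
have cv0 := riesz_eq_continuous a0 a1 hv0; have cv1 := riesz_eq_continuous a0 a1 hv1.
have cr0 := cexp cv0; have cr1 := cexp cv1.
have p0 y : 0 < rho0 y by exact: expR_gt0.
have p1 y : 0 < rho1 y by exact: expR_gt0.
have [T [dT' sT]] := transport_map cr0 cr1 p0 p1 ri0 ri1 eM.
clear eM.
pose w x := v0 x - v1 (T x); pose t x := expR (w x).
have tE x : rho0 x / rho1 (T x) = t x by rewrite /rho0 /rho1 -expRN -expRD.
have dT x : derat x T (t x) by rewrite -tE.
have rE x : rho1 (T x) * t x = rho0 x by rewrite -tE mulrC divfK// gt_eqF.
have t0 x : 0 < t x by exact: expR_gt0.
have cT : continuous T by move=> x; exact: der_cont (dT x).
have cw : continuous w.
  move=> x; apply: cvgB; first exact: cv0.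
  by apply: (@continuous_comp _ _ _ T v1); [exact: cT|exact: cv1].
have ct := cexp cw.
have cov (g : R -> R) : continuous g -> (forall x, 0 <= g x) -> L1 mu (fun x => rho1 x * g x) ->
    L1 mu (fun x => rho0 x * g (T x)) /\
    \int[mu]_x (rho0 x * g (T x)) = \int[mu]_x (rho1 x * g x).
  move=> cg g0 gi.
  have cgr : continuous (fun x => rho1 x * g x) by move=> x; apply: cvgM; [exact: cr1|exact: cg].
  have [i e] := transport_integral dT ct (fun x => ltW (t0 x)) sT cgr
    (fun x => mulr_ge0 (ltW (p1 x)) (g0 x)) gi.
  have E x : rho1 (T x) * g (T x) * t x = rho0 x * g (T x) by rewrite mulrAC rE.
  by split; [apply: (eq_L1 _ i) => x; rewrite E|rewrite -e; apply: eq_int => x; rewrite E].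
have phi1E y : phi1 y = c^-1 * (b1 - v1 y) by rewrite e1 opprB addrC subrK mulKf// gt_eqF.
have cphi1 : continuous phi1.
  have -> : phi1 = fun y => c^-1 * (b1 - v1 y) by apply/funext => y.
  by move=> y; apply: cvgMl_tmp; apply: cvgB; [exact: cvg_cst|exact: cv1].
have [ip ep] := cov _ cphi1 phi1_ge0 i1.
have dist y : L1 mu (fun x => rho0 x * `|T x - T y| `^ a) /\
    \int[mu]_x (rho0 x * `|T x - T y| `^ a) = phi1 (T y).
  rewrite -phi1D; apply: (cov (fun z => `|z - T y| `^ a)) => [z|z|]; last 2 first.
  - exact: powR_ge0.
  - exact: (eq_L1 _ (riesz_eq_L1_dist a0 a1 c0 hv1 (T y))).
  apply: (@continuous_comp _ _ _ (fun z => z - T y) (fun z => `|z| `^ a)).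
    by apply: cvgB; [exact: cvg_id|exact: cvg_cst].
  exact: continuous_abs_powR.
(* The double integral of J is the interaction energy of v1 pulled back by T, hence [2 / (c a) M] by
   [pohozaev]. *)
pose J y x := rho0 y * (rho0 x * `|T x - T y| `^ a).
have J0 y x : 0 <= J y x by rewrite !mulr_ge0 ?expR_ge0 ?powR_ge0.
have mr0 := L1_measurable ri0; have mT := continuous_measurable_fun cT.
have JE y : \int[mu]_x J y x = rho0 y * phi1 (T y).
  by have [i e] := dist y; rewrite /J (intZ _ i) e.
have Ji : L1prod mu mu J.
  apply: (@L1prodP _ _ _ _ _ mu mu J (fun y => rho0 y * phi1 (T y))); last 1 first.
  - exact: ip.
  - rewrite /J.
    have m1 : measurable_fun setT (fun u : R * R => rho0 u.1) by apply: (mfun_comp mr0); mfun.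
    have m2 : measurable_fun setT (fun u : R * R => rho0 u.2) by apply: (mfun_comp mr0); mfun.
    have m3 : measurable_fun setT (fun u : R * R => T u.1) by apply: (mfun_comp mT); mfun.
    have m4 : measurable_fun setT (fun u : R * R => T u.2) by apply: (mfun_comp mT); mfun.
    by mfun.
  - by move=> y; exact: L1Z (dist y).1.
  - move=> y; rewrite -JE le_eqVlt; apply/orP; left; apply/eqP.
    by apply: eq_int => x; rewrite ger0_norm.
have JM : \int[mu]_y \int[mu]_x J y x = 2 / (c * a) * M.
  exact: (etrans (eq_int mu JE) (etrans ep P1)).
pose z x := expR (a * w x).
have zE x : z x = t x `^ a by rewrite /z mulrC expRM.
have caw : continuous (fun x => a * w x) by move=> x; apply: cvgMl_tmp; exact: cw.
have cz := cexp caw.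
(* z is not known to be bounded, as [virial] requires, so the identity is applied to truncations of
   z. Fatou's lemma passes to the limit and yields the inequality. *)
have zi : L1 mu (fun x => rho0 x * z x) /\ \int[mu]_x (rho0 x * z x) <= M.
  pose k (n : nat) x := @cutoff R (n.+1%:R^-1 * x + 0).
  have tk n : test_function (k n) by apply: test_affine (test_cutoff R); rewrite invr_eq0.
  pose zn n x := z x * k n x.
  have czn n : continuous (zn n).
    by move=> x; apply: cvgM; [exact: cz|exact: test_continuous (tk n) x].
  have k0 n x : 0 <= k n x by exact: cutoff_ge0.
  have zn0 n x : 0 <= zn n x by rewrite mulr_ge0 ?expR_ge0.
  have bound n : L1 mu (fun x => rho0 x * zn n x) /\ \int[mu]_x (rho0 x * zn n x) <= M.
    have [S S0 hS] : exists2 S : R, 0 <= S & forall x, S < `|x| -> zn n x = 0.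
      move/test_functionP : (tk n) => [_ [S S0 hS]]; exists S => // x xS.
      by rewrite /zn hS ?mulr0.
    have zni := L1_compact (czn n) hS; have [C C0 hC] := bounded_compact (czn n) hS.
    have [Z [N [dZ ZN N0]]] : exists Z N, [/\ forall y, derat y Z (zn n y), forall y, `|Z y| <= N & 0 <= N].
      exists (fun y => \int[mu]_x (\1_`]-oo, y] x * zn n x)), (\int[mu]_x `|zn n x|).
      split; last exact: int_ge0.
        by move=> y; exact: der_primitive.
      move=> y; apply: int_abs_le_bound (L1_indicM (measurable_itv _) zni) (L1_abs zni) _ => x.
      by rewrite normrM ler_piMl// indicE; case: (_ \in _); rewrite ?normr1 ?normr0.
    have hC' y : `|zn n y| <= C + N by apply: (le_trans (hC y)); rewrite lerDl.
    have hZ' y : `|Z y| <= (C + N) * (1 + `|y|).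
      by apply: (le_trans (ZN y)); have := normr_ge0 y; nra.
    have [Fi ->] := virial a0 a1 c0 hv0 dZ (czn n) hC' hZ'.
    split.
      have mz := continuous_measurable_fun (czn n).
      apply: (L1_le (L1Z C ri0)); first by mfun.
      by move=> x; rewrite normrM (gtr0_norm (p0 x)) mulrC; exact: ler_wpM2r (ltW (p0 x)) _ _ (hC x).
    have [_ eF] := L1prod_int1 Fi; have [_ eJ] := L1prod_int1 Ji.
    (* [powR_jensen] bounds the increment of Z by [(y - x)^(1 - a) (T y - T x)^a]; the first factor
       cancels the [(y - x)^(a - 1)] in [dpowR]. *)
    have half x y : x < y -> dpowR a (y - x) * (Z y - Z x) <= a * `|T x - T y| `^ a.
      move=> xy; have d0 : 0 < y - x by rewrite subr_gt0.
      have Txy : T x < T y := der_increasing dT t0 xy.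
      have := powR_jensen a0 a1 dT dZ t0 _ xy => /(_ _)/le_trans h.
      have dE : dpowR a (y - x) = a * (y - x) `^ (a - 1).
        have -> : a - 1 = 1 + (a - 2) by ring.
        rewrite powRD; last by rewrite (gt_eqF d0) implybT.
        by rewrite (powRr1 (ltW d0)) /dpowR (gtr0_norm d0).
      rewrite dE distrC (gtr0_norm (_ : 0 < T y - T x)) ?subr_gt0// -mulrA ler_wpM2l ?(ltW a0)//.
      have -> : (T y - T x) `^ a = (y - x) `^ (a - 1) * ((y - x) `^ (1 - a) * (T y - T x) `^ a).
        rewrite mulrA -powRD; last by rewrite (gt_eqF d0) implybT.
        by rewrite addrA subrK subrr powRr0 mul1r.
      rewrite ler_wpM2l ?powR_ge0//; apply: h => // u.
      rewrite -zE /zn ler_piMr ?expR_ge0//; exact: cutoff_le1.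
    have FJ u : expR (v0 u.1) * expR (v0 u.2) * (dpowR a (u.1 - u.2) * (Z u.1 - Z u.2)) <=
        a * J u.1 u.2.
      case: u => y x /=.
      rewrite [leRHS](_ : _ = expR (v0 y) * expR (v0 x) * (a * `|T x - T y| `^ a)); last first.
        by rewrite /J /rho0; ring.
      apply: ler_wpM2l; first by rewrite mulr_ge0 ?expR_ge0.
      have [xy|xy|->] := ltgtP x y; first exact: half.
        have := half _ _ xy; rewrite distrC -(opprB y x) dpowRN.
        by rewrite mulNr -mulrN opprB.
      by rewrite !subrr mulr0 normr0 powR0 ?gt_eqF// mulr0.
    rewrite eF; apply: (@le_trans _ _ (c / 2 * (a * (2 / (c * a) * M)))); last first.
      by rewrite le_eqVlt; apply/orP; left; apply/eqP; field; rewrite !gt_eqF.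
    rewrite ler_wpM2l ?divr_ge0 ?(ltW c0)// -JM eJ -(@intZ _ _ _ (mu \x mu)%E a _ Ji).
    exact: (@int_le _ _ _ (mu \x mu)%E _ _ Fi (L1Z a Ji) FJ).
  have mz := continuous_measurable_fun cz.
  have mrz : measurable_fun setT (fun x => rho0 x * z x) by mfun.
  have cvz x : rho0 x * zn n x @[n --> \oo] --> rho0 x * z x.
    apply: cvg_near_cst; near=> n; rewrite /zn /k cutoff1 ?mulr1// addr0.
    rewrite normrM normfV normr_nat mulrC ler_pdivrMr ?ltr0n// mul1r.
    apply: (@le_trans _ _ n%:R); last by rewrite ler_nat.
    by near: n; exact: nbhs_infty_ger.
  exact: (@L1_fatou _ _ _ mu (fun n x => rho0 x * zn n x) (fun x => rho0 x * z x) M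
    (fun n => (bound n).1) (fun n x => mulr_ge0 (ltW (p0 x)) (zn0 n x)) mrz cvz (fun n => (bound n).2)).
have [iz zM] := zi.
(* The interaction terms of v0 and of v1 transported by T have the same value, so only b0 - b1
   survives. *)
have iw : L1 mu (fun x => rho0 x * w x) /\ \int[mu]_x (rho0 x * w x) = (b0 - b1) * M.
  have E x : (b0 - b1) * rho0 x - c * (rho0 x * phi0 x) + c * (rho0 x * phi1 (T x)) = rho0 x * w x.
    by rewrite /w e0 e1; ring.
  have j1 := L1Z (b0 - b1) ri0; have j2 := L1Z c i0; have j3 := L1Z c ip.
  split; first by apply: (eq_L1 _ (L1D (L1B j1 j2) j3)) => x; rewrite E.
  rewrite -(eq_int mu E) (intD (L1B j1 j2) j3) (intB j1 j2) (intZ _ ri0) (intZ _ i0) (intZ _ ip).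
  by rewrite ep P1 P0 MI subrK.
have [iw' ew] := iw.
pose f x := rho0 x * (z x - 1 - a * w x).
have fE x : rho0 x * z x - rho0 x - a * (rho0 x * w x) = f x by rewrite /f; ring.
have fi : L1 mu f by apply: (eq_L1 _ (L1B (L1B iz ri0) (L1Z a iw'))) => x; rewrite fE.
have fI : \int[mu]_x f x <= a * (b1 - b0) * M.
  rewrite -(eq_int mu fE) (intB (L1B iz ri0) (L1Z a iw')) (intB iz ri0) (intZ _ iw') ew MI.
  rewrite (_ : a * (b1 - b0) * M = M - M - a * ((b0 - b1) * M)); last by ring.
  by rewrite lerD2r lerD2r.
have f0 x : 0 <= f x.
  by rewrite mulr_ge0 ?expR_ge0// subr_ge0 lerBrDl expR_ge1Dx.
split.
  have : 0 <= a * (b1 - b0) * M by apply: le_trans fI; exact: int_ge0.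
  by rewrite pmulr_lge0// pmulr_rge0// subr_ge0.
move=> b10; have cf : continuous f.
  move=> x; apply: cvgM; first exact: cr0.
  by apply: cvgB; [apply: cvgB; [exact: cz|exact: cvg_cst]|exact: caw].
have fI0 : \int[mu]_x f x <= 0.
  apply: (le_trans fI); rewrite pmulr_lle0// pmulr_rle0//; lra.
have fz := int_le0_eq0 fi f0 cf fI0.
(* Equality in [1 + x <= exp x] forces [a w = 0]; then T' = 1 and T is a translation. *)
have w0 x : w x = 0.
  have /eqP := fz x; rewrite mulf_eq0 (gt_eqF (p0 x))/= subr_eq0 => /eqP h.
  apply/eqP; apply: contraT => wn.
  have aw : a * w x != 0 by rewrite mulf_neq0// gt_eqF.
  by have := expR_gt1Dx aw; rewrite -/(z x); lra.
exists (T 0) => x.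
have TE : T x = x + T 0.
  have [u0|u0] := leP 0 x.
    have [u] := der_mvt dT u0; rewrite /t w0 expR0 mul1r; lra.
  have [u] := der_mvt dT (ltW u0); rewrite /t w0 expR0 mul1r; lra.
by have := w0 x; rewrite /w TE; lra.
Unshelve. all: end_near. Qed.

End comparison.

Lemma riesz_eq_unique (R : realType) (a c : R) (v0 v1 : R -> R) :
  0 < a -> a < 1 -> 0 < c -> riesz_eq a c v0 -> riesz_eq a c v1 ->
  exists m t : R, 0 < m /\ forall x, v0 x = v1 (m * (x + t)) + (1 + a) * ln m.
Proof.
move=> a0 a1 c0 h0 h1.
have M0 := riesz_eq_mass_gt0 h0; have M1 := riesz_eq_mass_gt0 h1.
set I0 := Rintegral _ _ _ in M0; set I1 := Rintegral _ _ _ in M1.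
pose m := (I0 / I1) `^ a^-1.
have q0 : 0 < I0 / I1 by rewrite divr_gt0.
have m0 : 0 < m by rewrite powR_gt0.
have ma : m `^ a = I0 / I1 by rewrite /m -powRrM mulVf ?powRr1 ?(ltW q0)// gt_eqF.
have [h2 e2] := riesz_eq_scale a0 a1 m0 h1.
rewrite ma -/I1 divfK ?gt_eqF// in e2.
have [b0 E0] := riesz_eq_dist a0 a1 c0 h0; have [b2 E2] := riesz_eq_dist a0 a1 c0 h2.
have [b02 _] := riesz_eq_compare a0 a1 c0 h0 h2 E0 E2 (esym e2).
have [b20 /(_ b02)[t ht]] := riesz_eq_compare a0 a1 c0 h2 h0 E2 E0 e2.
exists m, (- t); split=> // x; have := ht (x - t); rewrite subrK => <-.
by [].
Qed.

(** * Transfer to solutions and conclusion *)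

Lemma solution_measurable (R : realType) (s : R) (u : R -> R) :
  solution s u -> measurable_fun setT u.
Proof. by move=> [[[mu_ _ _] _] _ _]. Qed.

Lemma solution_riesz_eq (R : realType) (s : R) (u : R -> R) :
  2^-1 < s -> s < 1 -> solution s u -> L1 lebesgue_measure (fun x : R => expR (u x)) ->
  exists v : R -> R, [/\ continuous_representative u v,
    riesz_eq (2 * s - 1) (riesz_const s) v, 0 < riesz_const s & weighted_mass s u].
Proof.
move=> s0 s1 su ui; have [v [b [cv uv vi c0 vE]]] := representation s0 s1 su ui.
have hv : riesz_eq (2 * s - 1) (riesz_const s) v by split=> //; exists b.
exists v; split=> //; first by split=> //; apply: (@filterS _ _ (ae_filter_ringOfSetsType lebesgue_measure) _ _ _ uv) => x.
split=> //; have a0 : 0 < 2 * s - 1 by lra.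
have a1 : 2 * s - 1 < 1 by lra.
apply: (ae_L1 _ _ (riesz_eq_weighted a0 a1 c0 hv)).
  apply: measurable_funM.
    by apply: measurableT_comp (solution_measurable su); exact: measurable_expR.
  apply: (@measurableT_comp _ _ _ _ _ _ (fun t : R => t `^ (2 * s - 1))).
    exact: measurable_powR.
  exact: normr_measurable.
by apply: (@filterS _ _ (ae_filter_ringOfSetsType lebesgue_measure) _ _ _ uv) => x ->.
Qed.

Theorem proposition1p1 (R : realType) (s : R) (hs : 2^-1 < s < 1) :
  (forall u : R -> R, solution s u -> finite_mass u ->
     (1 <= morse_index s u < +oo)%E /\
     exists K : set R, [/\ compact K, K !=set0 & stable_outside s u K]) /\
  (forall u : R -> R, solution s u ->
     (exists K : set R, compact K /\ stable_outside s u K) ->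
     [/\ lebesgue_measure.-integrable setT (fun x : R => (expR (u x))%:E),
         exists v : R -> R,
           [/\ continuous_representative u v,
               smooth v,
               exists M : R, forall x, v x <= M,
               exists C A : R, forall x, A <= `|x| ->
                 `|v x| <= C * `|x| `^ (2 * s - 1) &
               (exists (x0 : R) (u0 : R -> R),
                  (forall r t, 0 <= r -> r < t -> u0 t < u0 r) /\
                  forall x, v x = u0 `|x - x0|) /\
               (forall Q : R -> R, is_Q s Q ->
                  exists (y mu : R), 0 < mu /\
                    forall x, v x = Q (mu * (x + y)) + 2 * s * ln mu)] &
         (morse_index s u < +oo)%E]).
Proof.
have /andP[s0 s1] := hs; have a0 : 0 < 2 * s - 1 by lra.
have a1 : 2 * s - 1 < 1 by lra.
have mass_L1 u : solution s u -> finite_mass u -> L1 lebesgue_measure (fun x : R => expR (u x)).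
  move=> su fu; apply/L1_ge0P => //.
  by apply: measurableT_comp (solution_measurable su); exact: measurable_expR.
split=> u su => [fu|[K [cK st]]].
  have [v [_ _ _ wu]] := solution_riesz_eq s0 s1 su (mass_L1 u su fu).
  have mu_ := solution_measurable su; have [_ lu _] := su.
  split; first by rewrite (morse_index_ge1 s0 s1 lu) (morse_index_finite s0 s1 mu_ wu).
  have [n hn] := stable_outside_ball s0 s1 mu_ wu.
  exists (`[- n%:R, n%:R]%classic); split=> //; first exact: segment_compact.
  by exists 0; rewrite /= in_itv /= oppr_le0 ler0n.
have [_ lu _] := su; have ui := stable_finite_mass s0 s1 cK lu st.
have [v [uv hv c0 wu]] := solution_riesz_eq s0 s1 su ui.
have mu_ := solution_measurable su.
have mf := morse_index_finite s0 s1 mu_ wu.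
split; [exact: ui| |exact: mf].
exists v; split=> //.
- by have := riesz_eq_smooth a0 a1 c0 hv.
- by have := riesz_eq_bounded_above a0 a1 c0 hv.
- by have := riesz_eq_growth a0 a1 c0 hv.
split; first by have := riesz_eq_symmetric a0 a1 c0 hv.
move=> Q [sQ fQ cQ].
have [q [[cq Qq] hq _ _]] := solution_riesz_eq s0 s1 sQ (mass_L1 Q sQ fQ).
(* Q is continuous by [is_Q], so it is its own continuous representative and satisfies the integral
   equation. *)
have QE : Q = q by apply: continuous_ae_eq => //; apply: (@filterS _ _ (ae_filter_ringOfSetsType lebesgue_measure) _ _ _ Qq) => x /(_ I).
have [m [t [m0 h]]] := riesz_eq_unique a0 a1 c0 hv hq.
exists t, m; split=> // x; rewrite QE h; congr (_ + _ * _); ring.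
Qed.
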